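(* Assume that $f$ is strictly convex on $[0,\infty)$. Let $\gamma\in\mathcal{A}_{\mathrm{pin}}$ be a $\frac12$-fold well-periodic curve. If $\gamma$ is not injective on $(0,L)$ and if $\gamma'(0)\cdot(P_1-P_0)>0$, then $\gamma$ is not a local minimizer of $\mathcal{F}$ in $\mathcal{A}_{\mathrm{pin}}$.
   Context: Let $p\in(1,\infty)$, $L>0$, and $P_0,P_1\in\mathbf{R}^2$ with $|P_0-P_1|<L$. Let $W^{2,p}_{\mathrm{arc}}(0,L;\mathbf{R}^2):=\{\gamma\in W^{2,p}(0,L;\mathbf{R}^2) : |\gamma'|\equiv 1\}$ and $$\mathcal{A}_{\mathrm{pin}}:=\{\gamma\in W^{2,p}_{\mathrm{arc}}(0,L;\mathbf{R}^2) : \gamma(0)=P_0,\ \gamma(L)=P_1\},$$ equipped with the relative topology induced by the $W^{2,p}$-norm. The signed curvature $k$ of an arclength parametrized planar curve $\gamma$ is defined by $\gamma''=kN$, where $N$ is $\gamma'$ rotated counterclockwise by $\pi/2$. Let $f:[0,\infty)\to[0,\infty]$ be a Borel function and $\mathcal{F}(\gamma):=\int_0^L f(|k|)\,ds$. A local minimizer of $\mathcal{F}$ in $X$ is an $x\in X$ with $\mathcal{F}(x)\le\mathcal{F}(x')$ for all $x'$ in some neighborhood of $x$ in $X$. An arclength parametrized planar curve $\gamma:[0,L]\to\mathbf{R}^2$ is well-periodic if it has continuous signed curvature $k\in C([0,L])$ of the form $k(s)=\Phi(s-s_0)$, where $s_0\in\mathbf{R}$ and $\Phi\in C(\mathbf{R})$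 is an odd function that is antiperiodic with antiperiod $T>0$ (i.e. $\Phi(x+T)=-\Phi(x)$ for all $x$) such that $\{s\in\mathbf{R}:\Phi(s)=0\}=T\mathbf{Z}$; $T$ is called the antiperiod of $\gamma$. For a positive integer $m$, a well-periodic curve $\gamma:[0,L]\to\mathbf{R}^2$ is $\frac m2$-fold if $k(0)=0$ and $T=L/m$. (So $\frac12$-fold means $m=1$.) *)

(* Defs.v *)
From HB Require Import structures.
From mathcomp Require Import all_boot all_order all_algebra.
From mathcomp Require Import all_classical all_reals all_analysis.
Set Implicit Arguments.
Unset Strict Implicit.
Unset Printing Implicit Defensive.
Import Order.TTheory GRing.Theory Num.Theory.
Import numFieldNormedType.Exports.
Local Open Scope classical_set_scope.
Local Open Scope ring_scope.

Section Plane.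
Context {R : realType}.
Implicit Types u v : R * R.

(* The library norm on [R * R] is the sup norm, hence [enorm]. *)
Definition dot u v : R := u.1 * v.1 + u.2 * v.2.
Definition enorm u : R := Num.sqrt (dot u u).
Definition rot90 u : R * R := (- u.2, u.1).

End Plane.

(* Functions and curves on [0, L] are total functions on [R] whose values
   outside [0, L] are irrelevant. *)
Section Sobolev.
Context {R : realType}.
Implicit Types (L p : R) (u v w phi : R -> R).
Local Notation mu := (@lebesgue_measure R).

Definition test_function L phi : Prop :=
  [/\ forall (n : nat) x, derivable (derive1n n phi) x 1,
      compact (closure [set x | phi x != 0]) &
      closure [set x | phi x != 0] `<=` `]0, L[].

Definition is_weak_derivative L u v : Prop :=
  [/\ locally_integrable `]0, L[ u, locally_integrable `]0, L[ v &
      forall phi, test_function L phi ->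
        \int[mu]_(x in `]0, L[) (u x * derive1 phi x) =
        - \int[mu]_(x in `]0, L[) (v x * phi x)].

Definition Lp L p u : Prop := u \_ `]0, L[ \in Lfun mu p%:E.

(* [u] is the continuous representative on [0, L] of an element of
   W^{2,p}(0, L). *)
Definition W2p L p u : Prop :=
  [/\ {within `[0, L], continuous u}, Lp L p u &
      exists v w, [/\ is_weak_derivative L u v, Lp L p v,
                      is_weak_derivative L v w & Lp L p w]].

(* For [u] in W^{2,p}(0, L), the continuous representative of u'
   (W^{2,p} embeds into C^1), unique on [0, L]. *)
Definition wderiv L u : R -> R :=
  xget (cst 0) [set v | {within `[0, L], continuous v} /\
                        is_weak_derivative L u v].

(* For [u] in W^{2,p}(0, L), a representative of u'', unique up to a.e.
   equality on (0, L). *)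
Definition wderiv2 L u : R -> R :=
  xget (cst 0) [set w | is_weak_derivative L (wderiv L u) w].

End Sobolev.

Section Curves.
Context {R : realType}.
Implicit Types (L p : R) (gamma : R -> R * R) (P : R * R).
Local Notation mu := (@lebesgue_measure R).

Definition W2p_curve L p gamma : Prop :=
  W2p L p (fst \o gamma) /\ W2p L p (snd \o gamma).

Definition velocity L gamma (s : R) : R * R :=
  (wderiv L (fst \o gamma) s, wderiv L (snd \o gamma) s).

Definition acceleration L gamma (s : R) : R * R :=
  (wderiv2 L (fst \o gamma) s, wderiv2 L (snd \o gamma) s).

Definition Lp_norm L p (g : R -> R * R) : \bar R :=
  Lnorm mu p%:E (EFin \o ((enorm \o g) \_ `]0, L[)).

Definition W2p_norm L p gamma : \bar R :=
  (Lp_norm L p gamma + Lp_norm L p (velocity L gamma)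
   + Lp_norm L p (acceleration L gamma))%E.

Definition arclength_param L gamma : Prop :=
  forall s, s \in `[0, L] -> enorm (velocity L gamma s) = 1.

Definition A_pin L p P0 P1 : set (R -> R * R) :=
  [set gamma | [/\ W2p_curve L p gamma, arclength_param L gamma,
                   gamma 0 = P0 & gamma L = P1]].

Definition is_signed_curvature L gamma (k : R -> R) : Prop :=
  measurable_fun `]0, L[ k /\
  {ae mu, forall s, s \in `]0, L[ ->
     acceleration L gamma s = k s *: rot90 (velocity L gamma s)}.

(* Unique up to a.e. equality on (0, L) for arclength parametrized curves. *)
Definition signed_curvature L gamma : R -> R :=
  xget (cst 0) [set k | is_signed_curvature L gamma k].

Definition energy L (f : R -> \bar R) gamma : \bar R :=
  (\int[mu]_(s in `]0%R, L[) f `|signed_curvature L gamma s|%R)%E.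

(* Neighborhoods in the relative topology of the W^{2,p}-norm. *)
Definition local_minimizer L p (F : (R -> R * R) -> \bar R)
    (X : set (R -> R * R)) gamma : Prop :=
  X gamma /\
  exists2 e : R, 0 < e &
    forall eta, X eta -> (W2p_norm L p (fun s => eta s - gamma s)%R < e%:E)%E ->
      (F gamma <= F eta)%E.

(* [gamma] is well-periodic with signed curvature [k] and antiperiod [T]. *)
Definition well_periodic L gamma (k : R -> R) (T : R) : Prop :=
  [/\ arclength_param L gamma, {within `[0, L], continuous k} &
      is_signed_curvature L gamma k] /\
  exists (s0 : R) (Phi : R -> R),
    (forall s, s \in `[0, L] -> k s = Phi (s - s0)) /\
    [/\ continuous Phi, forall x, Phi (- x) = - Phi x,
        0 < T, forall x, Phi (x + T) = - Phi x &
        [set x | Phi x = 0] = [set T * n%:~R | n in [set: int]]].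

(* [gamma] is an [m/2]-fold well-periodic curve. *)
Definition half_fold_well_periodic (m : nat) L gamma : Prop :=
  (0 < m)%N /\
  exists k T, [/\ well_periodic L gamma k T, k 0 = 0 & T = L / m%:R].

End Curves.

(* Strict inequality is required for all pairs of distinct points, so [f] is
   finite on (0, +oo); the value +oo is only possible at 0. *)
Definition strictly_convex_nneg {R : realType} (f : R -> \bar R) : Prop :=
  forall x y t : R, 0 <= x -> 0 <= y -> x != y -> 0 < t < 1 ->
    (f ((1 - t) * x + t * y)%R < (1 - t)%R%:E * f x + t%:E * f y)%E.

(* Main.v *)
(* Extend the curvature [kappa] of the curve antiperiodically and let [theta] be a
   primitive of it. In suitable coordinates the curve is [X + i Y] with
   [X' + i Y' = exp (i theta)], [Y 0 = Y L = 0] and [X L * cos (theta 0) > 0].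
   Since [X L] and [cos (theta 0)] have the same sign, cutting a piece of length [d]
   at the end decreases the distance of the endpoints to first order, whereas
   translating the arclength by [e] preserves the energy and increases the squared
   distance by [4 Y(e)^2]. A curve that is not injective has a vertical tangent at
   an interior point (Rolle's theorem for [X]); stretching a short arc there
   restores the length and does not change the distance to first order. The intercept
   at [0] of the chords of a strictly convex [f] strictly decreases as the chords
   move to the right, so replacing an almost straight piece of length [d] by a
   stretch of the curved arc strictly lowers the energy. By the intermediate value theorem, an
   interpolation of the two operations with [d > 0] keeps the distance of the
   endpoints; after a rotation it is a competitor in [A_pin] with less energy.
   If the energy of the curve is infinite, the same argument with [e < 0] and
   another stretched arc near [0] removes the zeros of [kappa] from the competitor,
   whose energy is then finite. *)
Require Import Defs.
From HB Require Import structures.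
From mathcomp Require Import all_boot all_order all_algebra.
From mathcomp Require Import all_classical all_reals all_analysis.
From mathcomp Require Import measurable_realfun ring lra.
Import Order.TTheory GRing.Theory Num.Theory.
Import numFieldNormedType.Exports.
Set Implicit Arguments.
Unset Strict Implicit.
Unset Printing Implicit Defensive.
Local Open Scope classical_set_scope.
Local Open Scope ring_scope.

(** * Derivatives and primitives on the line *)

(** Stretching by [1 / rho] turns an element of length [ds] and curvature [x] into one of length
    [ds / rho] and curvature [rho x], so a unit of added length costs
    [(f (rho x) - rho f x) / (1 - rho)], the intercept of the chord through [rho x] and [x]. A unit
    of length cut where the curvature is almost 0 saves at least the intercept of a chord further
    left, up to an arbitrarily small loss. Comparing chords involves no derivative of [f] and allows
    [f 0 = +oo]. Translation lengthens the chord of the curve only by a term of higher order, so the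
    balance with the cut is found from a change of sign along a segment of parameters. There the
    first-order effect of the cut has to exceed all errors by a fixed factor, whence tolerances on
    [cos theta] that are a fixed fraction of [|cos (theta 0)|]. Velocity, acceleration and curvature
    are values of a choice operator. They become explicit because [gamma] turns out to be C^2 on
    [0, L] and competitors have tangent angle [theta \o tau] up to a rotation: unit speed is
    automatic, the curvature is known, and only the length of the chord has to be adjusted. *)

Section Calculus.
Context {R : realType}.
Implicit Types (f g F G : R -> R) (a b x y : R).
Local Notation mu := (@lebesgue_measure R).

Lemma is_derive_continuous f df x : is_derive x (1 : R) f df -> {for x, continuous f}.
Proof. by move=> h; apply: differentiable_continuous; apply/derivable1_diffP. Qed.

Lemma derivable_continuous f df : (forall x, is_derive x (1 : R) f (df x)) -> continuous f.
Proof. by move=> h x; exact: is_derive_continuous (h x). Qed.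

Lemma continuous_integrable_cc f a b : continuous f ->
  mu.-integrable `[a, b] (EFin \o f).
Proof.
move=> cf; apply: continuous_compact_integrable; first exact: segment_compact.
exact: continuous_subspaceT.
Qed.

Lemma Rintegral_cc_split g a b c : continuous g -> a <= b -> b <= c ->
  \int[mu]_(t in `[a, c]) g t =
  \int[mu]_(t in `[a, b]) g t + \int[mu]_(t in `[b, c]) g t.
Proof.
move=> cg ab bc; apply/eqP; rewrite addrC -subr_eq; apply/eqP.
rewrite (_ : _ - _ = \int[mu]_(t in [set` `]b, c]]) g t).
  rewrite Rintegral_itv_obnd_cbnd //.
  apply: integrableS (continuous_integrable_cc b c cg) => //.
  exact: subset_itv_oc_cc.
by apply: Rintegral_itvB => //; exact: continuous_integrable_cc.
Qed.

(** Integrals over sets carry no orientation, so the signed integral from 0 to [x] is a difference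
    of two integrals from a common base point, which lies left of both 0 and [x]. *)
Definition primitive g x : R :=
  \int[mu]_(t in `[- (`|x| + 1), x]) g t - \int[mu]_(t in `[- (`|x| + 1), 0]) g t.

Lemma primitive0 g : primitive g 0 = 0.
Proof. exact: subrr. Qed.

Lemma is_derive_primitive g : continuous g ->
  forall x, is_derive x (1 : R) (primitive g) (g x).
Proof.
move=> cg x.
pose J a x := \int[mu]_(t in `[a, x]) g t.
have JE a a' y : a' <= a -> a <= y -> a <= 0 -> J a y - J a 0 = J a' y - J a' 0.
  move=> a'a ay a0; rewrite /J (@Rintegral_cc_split g a' a y) //.
  by rewrite (@Rintegral_cc_split g a' a 0) //; ring.
have GE a y : a <= - (`|y| + 1) -> primitive g y = J a y - J a 0.
  move=> ay; have h1 := ler_norm (- y); have h2 := normr_ge0 y.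
  rewrite normrN in h1.
  by apply: JE; lra.
(* One base point for all [y] with [|x - y| < 1], since then [|y| + 1 < |x| + 2]; near [x] the
   primitive is an integral from a fixed point minus a constant. *)
pose a := - (`|x| + 3).
have d : is_derive x (1 : R) (fun y => J a y - J a 0) (g x).
  have ax : a < x by rewrite /a; have := ler_norm (- x); rewrite normrN => ?; lra.
  have [d1 d2] := @continuous_FTC1_closed R g a x (x + 1) ltac:(by rewrite ltrDl)
    (continuous_integrable_cc _ _ cg) ax (cg x).
  have dJ : is_derive x (1 : R) (J a) (g x).
    by apply: DeriveDef; [exact: d1|rewrite -derive1E; exact: d2].
  have dc : is_derive x (1 : R) (cst (J a 0)) 0 by exact: is_derive_cst.
  by have := is_deriveB dJ dc; rewrite subr0.
apply: (near_eq_is_derive _ d).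
near=> y; rewrite -(GE a y) // /a.
have : `|x - y| < 1.
  by near: y; exact: (@nbhsx_ballx _ _ _ 1 ltr01).
have := ler_normB x (x - y); rewrite opprB addrC subrK; lra.
Unshelve. all: by end_near. Qed.

Lemma primitive_exists g : continuous g ->
  exists G, forall x, is_derive x (1 : R) G (g x).
Proof. by move=> cg; exists (primitive g); exact: is_derive_primitive. Qed.

Lemma ge0_derive_le f df a b : a <= b ->
  {within `[a, b], continuous f} ->
  (forall x, a < x < b -> is_derive x (1 : R) f (df x)) ->
  (forall x, a < x < b -> 0 <= df x) -> f a <= f b.
Proof.
rewrite le_eqVlt => /predU1P[-> //|ab] cf dF df0.
have [c] := @MVT R f df a b ab (fun x xab => dF x ltac:(by move: xab; rewrite in_itv)) cf.
rewrite in_itv /= => /df0 c0 E.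
by rewrite -subr_ge0 E mulr_ge0 // subr_ge0 ltW.
Qed.

Lemma gt0_derive_lt f df a b : a < b ->
  {within `[a, b], continuous f} ->
  (forall x, a < x < b -> is_derive x (1 : R) f (df x)) ->
  (forall x, a < x < b -> 0 < df x) -> f a < f b.
Proof.
move=> ab cf dF df0.
have [c] := @MVT R f df a b ab (fun x xab => dF x ltac:(by move: xab; rewrite in_itv)) cf.
rewrite in_itv /= => /df0 c0 E.
by rewrite -subr_gt0 E mulr_gt0 // subr_gt0.
Qed.

Lemma derive_eq0 f a b : a <= b ->
  {within `[a, b], continuous f} ->
  (forall x, a < x < b -> is_derive x (1 : R) f 0) -> f a = f b.
Proof.
move=> ab cf dF; apply/eqP; rewrite eq_le; apply/andP; split.
  by apply: (@ge0_derive_le f (fun=> 0) a b).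
rewrite -lerN2; apply: (@ge0_derive_le (- f) (fun=> 0) a b) => //.
  by move=> x; apply: continuousN; exact: cf.
by move=> x /dF d; rewrite -[0]oppr0; exact: is_deriveN.
Qed.

Lemma derive_norm_le f df a b M : a <= b ->
  (forall x, a <= x <= b -> is_derive x (1 : R) f (df x)) ->
  (forall x, a <= x <= b -> `|df x| <= M) -> `|f b - f a| <= M * (b - a).
Proof.
move=> ab dF dM.
have cf : {within `[a, b], continuous f}.
  by apply: derivable_within_continuous => x; rewrite in_itv => /= /dF d.
have [|c] := @MVT_segment R f df a b ab _ cf.
  by move=> x; rewrite in_itv /= => /andP[/ltW ? /ltW ?]; apply: dF; lra.
rewrite in_itv /= => /dM cM ->.
by rewrite normrM (ger0_norm (_ : 0 <= b - a)) ?subr_ge0 // ler_wpM2r // subr_ge0.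
Qed.

Lemma derive_lip f df M : (forall x, is_derive x (1 : R) f (df x)) ->
  (forall x, `|df x| <= M) -> forall x y, `|f y - f x| <= M * `|y - x|.
Proof.
move=> dF dM x y; wlog xy : x y / x <= y.
  by move=> h; have [/h //|/ltW /h] := leP x y; rewrite distrC (distrC x).
by rewrite (@ger0_norm _ (y - x)) ?subr_ge0 //; exact: (derive_norm_le xy).
Qed.

Lemma cos_lip x y : `|cos x - cos y| <= `|x - y| :> R.
Proof.
rewrite -[leRHS]mul1r; apply: (@derive_lip (@cos R) (fun t => - sin t)) => // t.
by rewrite normrN ler_norml sin_geN1 sin_le1.
Qed.

Lemma sin_lip x y : `|sin x - sin y| <= `|x - y| :> R.
Proof.
rewrite -[leRHS]mul1r; apply: (@derive_lip (@sin R) (@cos R)) => // t.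
by rewrite ler_norml cos_geN1 cos_le1.
Qed.

End Calculus.

Section DeriveRules.
Context {R : realType}.
Implicit Types (f g : R -> R) (a b c x : R).

Lemma is_derive1D f g x a b : is_derive x (1 : R) f a -> is_derive x (1 : R) g b ->
  is_derive x (1 : R) (fun y => f y + g y) (a + b).
Proof. exact: is_deriveD. Qed.

Lemma is_derive1B f g x a b : is_derive x (1 : R) f a -> is_derive x (1 : R) g b ->
  is_derive x (1 : R) (fun y => f y - g y) (a - b).
Proof. exact: is_deriveB. Qed.

Lemma is_derive1M f g x a b : is_derive x (1 : R) f a -> is_derive x (1 : R) g b ->
  is_derive x (1 : R) (fun y => f y * g y) (a * g x + f x * b).
Proof.
by move=> df dg; apply: (is_derive_eq (is_deriveM df dg)); rewrite addrC /= mulrC.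
Qed.

Lemma is_derive1Z c f x a : is_derive x (1 : R) f a ->
  is_derive x (1 : R) (fun y => c * f y) (c * a).
Proof. exact: is_deriveZ. Qed.

Lemma is_derive1_const c x : is_derive x (1 : R) (fun=> c) 0.
Proof. exact: is_derive_cst. Qed.

Lemma is_derive1V f x a : f x != 0 -> is_derive x (1 : R) f a ->
  is_derive x (1 : R) (fun y => (f y)^-1) (- a / f x ^+ 2).
Proof.
move=> f0 df; apply: (is_derive_eq (is_deriveV f0 df)).
by rewrite /GRing.scale /= mulrC mulrN mulNr.
Qed.

Lemma is_derive1X n f x a : is_derive x (1 : R) f a ->
  is_derive x (1 : R) (fun y => f y ^+ n) (n%:R * f x ^+ n.-1 * a).
Proof.
move=> df; have := is_deriveX n df.
rewrite (_ : f ^+ n = (fun y => f y ^+ n)) //.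
by apply/funext => y; rewrite exprfctE.
Qed.

Lemma is_derive1_chain f g x a b : is_derive (g x) (1 : R) f a -> is_derive x (1 : R) g b ->
  is_derive x (1 : R) (fun y => f (g y)) (a * b).
Proof. exact: is_derive1_comp. Qed.

Lemma is_derive0_quadratic f x M : (forall y, `|f y - f x| <= M * (y - x) ^+ 2) ->
  is_derive x (1 : R) f 0.
Proof.
move=> fM.
have h : (fun h : R => h^-1 *: (f (h *: (1 : R) + x) - f x)) h @[h --> 0^'] --> (0 : R).
  apply/cvgrPdist_le => e e0; near=> h.
  have h0 : h != 0 by near: h; exact: nbhs_dnbhs_neq.
  rewrite sub0r normrN /GRing.scale /= mulr1 normrM normfV.
  rewrite ler_pdivrMl ?normr_gt0 //; apply: le_trans (fM _) _.
  rewrite addrK -real_normK ?num_real // expr2 mulrA [leRHS]mulrC.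
  rewrite ler_wpM2r //.
  have Mh : `|M| * `|h| <= e.
    have h1 : `|h| <= e / (`|M| + 1).
      near: h; apply: dnbhs0_le; rewrite divr_gt0 // ltr_wpDl //.
    rewrite ler_pdivlMr ?ltr_wpDl // in h1.
    by apply: le_trans h1; rewrite mulrDr mulr1 mulrC lerDl.
  by apply: le_trans Mh; rewrite ler_wpM2r // ler_norm.
apply: DeriveDef; first by apply/cvg_ex; exists 0.
exact: cvg_lim h.
Unshelve. all: by end_near. Qed.

End DeriveRules.

(** * Test functions *)

Section Bump.
Context {R : realType}.
Implicit Types (f g F G : R -> R) (a b c x y L : R) (q : {poly R}) (m n : nat).
Local Notation mu := (@lebesgue_measure R).

(** The tower of derivatives is the witness: a family closed under differentiation, such as [bump],
    yields it by iteration. *)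
Definition smooth f : Prop :=
  exists2 F : nat -> R -> R, F 0%N = f & forall n x, is_derive x (1 : R) (F n) (F n.+1 x).

Lemma smooth_derive1n f n x : smooth f -> derivable (derive1n n f) x 1.
Proof.
move=> [F F0 dF]; suff -> : derive1n n f = F n by [].
elim: n => [//|n IH]; rewrite derive1nS IH; apply/funext => y.
by rewrite derive1E; have [_ ->] := dF n y.
Qed.

Lemma smooth_continuous f : smooth f -> continuous f.
Proof. by move=> [F <- dF]; exact: derivable_continuous (dF 0%N). Qed.

Lemma smooth_lin f g c : smooth f -> smooth g -> smooth (fun x => f x - c * g x).
Proof.
move=> [F F0 dF] [G G0 dG]; exists (fun n x => F n x - c * G n x).
  by rewrite F0 G0.
by move=> n x; apply: is_derive1B => //; exact: is_derive1Z.
Qed.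

Lemma smooth_primitive f G : smooth f -> (forall x, is_derive x (1 : R) G (f x)) -> smooth G.
Proof.
move=> [F F0 dF] dG; exists (fun n => if n is n'.+1 then F n' else G) => //.
by case=> [|n] x //; rewrite F0.
Qed.

Lemma test_functionP L f a b : 0 < a -> b < L -> smooth f ->
  (forall x, f x != 0 -> a <= x <= b) -> test_function L f.
Proof.
move=> a0 bL sf fab.
have sub : closure [set x | f x != 0] `<=` `[a, b].
  rewrite (closure_id `[a, b]).1; last exact: itv_closed.
  by apply: closure_subset => x /= /fab; rewrite in_itv.
split.
- by move=> n x; exact: smooth_derive1n.
- apply: (subclosed_compact _ (segment_compact (a:=a) (b:=b)) sub).
  exact: closed_closure.
- move=> x /sub /=; rewrite !in_itv /=; lra.
Qed.

(* With [u = (x - a) (b - x)], the functions [q exp (- c / u) / u ^ m] extended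
   by [0] are stable under differentiation. *)
Definition bump a b c q m x : R :=
  if a < x < b then q.[x] * expR (- c / ((x - a) * (b - x))) / ((x - a) * (b - x)) ^+ m
  else 0.

Let U a b : {poly R} := ('X - a%:P) * (b%:P - 'X).
(** Numerator of the derivative of [q exp (- c / U) / U ^ m] over the denominator [U ^ (m + 2)]. *)
Let nextq a b c q m : {poly R} :=
  q^`() * U a b ^+ 2 - m%:R%:P * q * (U a b)^`() * U a b + c%:P * q * (U a b)^`().

(** With [z = c / (u (n + 1))], [exp (c / u)] is the power [n + 1] of [exp z], and [exp z >= z]. *)
Lemma expR_inv_le c u n : 0 < c -> 0 < u -> expR (- c / u) <= (n.+1%:R / c * u) ^+ n.+1.
Proof.
move=> c0 u0; rewrite mulNr expRN.
have n0 : 0 < n.+1%:R :> R by rewrite ltr0n.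
pose z := c / u / n.+1%:R.
have z0 : 0 < z by rewrite !divr_gt0.
have -> : n.+1%:R / c * u = z^-1 by rewrite /z; field; rewrite !gt_eqF.
have -> : c / u = n.+1%:R * z by rewrite /z; field; rewrite !gt_eqF.
rewrite exprVn lef_pV2 ?posrE ?expR_gt0 ?exprn_gt0 // expRM_natl.
rewrite lerXn2r ?nnegrE ?expR_ge0 ?(ltW z0) //.
by apply: le_trans (expR_ge1Dx _); rewrite lerDr.
Qed.

(** The exponential absorbs the denominator [u ^ m] and leaves two spare powers of [u], enough for
    the extension by 0 to have derivative 0 at [a] and [b]. *)
Lemma bump_quadratic a b c q m : a < b -> 0 < c ->
  exists M, forall y, `|bump a b c q m y| <= M * (y - a) ^+ 2 /\
                      `|bump a b c q m y| <= M * (b - y) ^+ 2.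
Proof.
move=> ab c0.
have [y0 _ hQ] := @EVT_max R (fun y => `|q.[y]|) a b (ltW ab) ltac:(
  apply: continuous_subspaceT => y; apply: continuous_comp;
  [exact: continuous_horner|exact: norm_continuous]).
set Q := `|q.[y0]| in hQ.
have Q0 : 0 <= Q by exact: normr_ge0.
pose C := (m.+2%:R / c) ^+ m.+2.
have C0 : 0 <= C by rewrite exprn_ge0 // divr_ge0 // ltW.
have M0 : 0 <= Q * C * (b - a) ^+ 2 by rewrite mulr_ge0 ?sqr_ge0 // mulr_ge0.
exists (Q * C * (b - a) ^+ 2); move=> y.
rewrite /bump; case: ifPn => [yab|_]; last first.
  by rewrite normr0; split; apply: mulr_ge0 => //; exact: sqr_ge0.
set u := (y - a) * (b - y).
have u0 : 0 < u by rewrite mulr_gt0 ?subr_gt0 //; lra.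
have B : `|q.[y] * expR (- c / u) / u ^+ m| <= Q * C * u ^+ 2.
  rewrite 2!normrM normfV (ger0_norm (expR_ge0 _)) (ger0_norm (exprn_ge0 _ (ltW u0))).
  rewrite ler_pdivrMr ?exprn_gt0 //.
  have -> : Q * C * u ^+ 2 * u ^+ m = Q * (C * u ^+ m.+2) by rewrite !exprS; ring.
  rewrite ler_pM ?expR_ge0 //.
    by apply: hQ; rewrite in_itv /=; lra.
  by rewrite -exprMn; exact: expR_inv_le.
split; apply: (le_trans B); rewrite -[leRHS]mulrA; (apply: ler_wpM2l; first exact: mulr_ge0).
- rewrite -exprMn lerXn2r ?nnegrE ?(ltW u0) //; first by apply: mulr_ge0; lra.
  by rewrite /u mulrC ler_wpM2r //; lra.
- rewrite -exprMn lerXn2r ?nnegrE ?(ltW u0) //; first by apply: mulr_ge0; lra.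
  by rewrite /u ler_wpM2r //; lra.
Qed.

Lemma bump_derive a b c q m x : a < b -> 0 < c ->
  is_derive x (1 : R) (bump a b c q m) (bump a b c (nextq a b c q m) m.+2 x).
Proof.
move=> ab c0.
have [xab|xab] := boolP (a < x < b).
  have hU y : (U a b).[y] = (y - a) * (b - y) by rewrite !hornerE.
  have Ux0 : 0 < (U a b).[x] by rewrite hU mulr_gt0 //; lra.
  have dU : is_derive x (1 : R) (horner (U a b)) (U a b)^`().[x] by exact: is_derive_poly.
  have dq : is_derive x (1 : R) (horner q) q^`().[x] by exact: is_derive_poly.
  have dV := is_derive1V (lt0r_neq0 Ux0) dU.
  have dE := @is_derive1_chain R expR (fun y => - c * ((U a b).[y])^-1) x _ _
    (is_derive_expR _) (is_derive1Z (- c) dV).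
  have d := is_derive1M (is_derive1M dq dE) (is_derive1X m dV).
  apply: (near_eq_is_derive (f := fun y => q.[y] * expR (- c * ((U a b).[y])^-1) * ((U a b).[y])^-1 ^+ m)).
    near=> y.
    have : y \in `]a, b[ by near: y; apply: near_in_itvoo; rewrite in_itv.
    by rewrite in_itv /= => yab; rewrite /bump yab -hU exprVn.
  apply: (is_derive_eq d).
  rewrite /bump xab -hU /nextq; clear d dE dV dU dq hU.
  move: (U a b) Ux0 => W /lt0r_neq0.
  rewrite !(hornerD, hornerM, hornerN, hornerC, horner_exp).
  set E := expR _; move: W.[x] W^`().[x] q.[x] q^`().[x] E => u u' v v' E u0.
  case: m => [|m] /=; first by rewrite ?expr0 ?mul0r ?mulr0 ?addr0 ?mulr1; field.
  rewrite -!exprVn !exprS ?mulr1.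
  have -> : u^-1 * (u^-1 * (u^-1 * u^-1 ^+ m)) = u^-1 ^+ m / (u * u * u) by field.
  move: (u^-1 ^+ m) => w.
  by field.
(* Outside []a, b[] the quadratic bound is used at the endpoint that separates [x] from the
   interval: it is at least as close to [y] as [x] is. *)
have B0 : bump a b c q m x = 0 by rewrite /bump (negbTE xab).
rewrite {2}/bump (negbTE xab).
have [M hM] := bump_quadratic q m ab c0.
have M0 : 0 <= M.
  have [h _] := hM b; have := le_trans (normr_ge0 _) h.
  by rewrite pmulr_lge0 // exprn_gt0 // subr_gt0.
apply: (@is_derive0_quadratic _ _ _ M) => y; rewrite B0 subr0.
have [yab|yab] := boolP (a < y < b); last first.
  by rewrite /bump (negbTE yab) normr0 mulr_ge0 // sqr_ge0.
have /orP[xa|bx] : (x <= a) || (b <= x).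
  by move: xab; rewrite negb_and -!leNgt.
- apply: le_trans (hM y).1 _; rewrite ler_wpM2l // lerXn2r ?nnegrE; lra.
- apply: le_trans (hM y).2 _; rewrite ler_wpM2l // -[leRHS]sqrrN lerXn2r ?nnegrE; lra.
Unshelve. all: by end_near. Qed.

Lemma bump_smooth a b c q m : a < b -> 0 < c -> smooth (bump a b c q m).
Proof.
move=> ab c0.
pose step (p : {poly R} * nat) := (nextq a b c p.1 p.2, p.2.+2).
exists (fun n => bump a b c (iter n step (q, m)).1 (iter n step (q, m)).2) => // n x.
exact: bump_derive.
Qed.

Lemma bump_support a b c q m x : bump a b c q m x != 0 -> a < x < b.
Proof. by rewrite /bump; case: ifP => // _; rewrite eqxx. Qed.

Definition bump1 a b c := bump a b c 1 0.

Lemma bump1E a b c x : bump1 a b c x =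
  if a < x < b then expR (- c / ((x - a) * (b - x))) else 0.
Proof. by rewrite /bump1 /bump hornerC mul1r expr0 divr1. Qed.

Lemma bump1_ge0 a b c x : 0 <= bump1 a b c x.
Proof. by rewrite bump1E; case: ifP => // _; rewrite expR_ge0. Qed.

Lemma bump1_le1 a b c x : 0 < c -> bump1 a b c x <= 1.
Proof.
rewrite bump1E => c0; case: ifP => // xab.
rewrite -expR0 ler_expR mulNr oppr_le0 divr_ge0 ?(ltW c0) //.
by rewrite mulr_ge0 //; lra.
Qed.

Lemma bump1_cvg a b x : a < x < b -> bump1 a b n.+1%:R^-1 x @[n --> \oo] --> (1 : R).
Proof.
move=> xab; under eq_fun do rewrite bump1E xab.
set u := (x - a) * (b - x).
have h : - n.+1%:R^-1 / u @[n --> \oo] --> - 0 / u.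
  by apply: cvgMr_tmp; apply: cvgN; exact: cvg_harmonic.
rewrite oppr0 mul0r in h.
have h2 : expR (- n.+1%:R^-1 / u) @[n --> \oo] --> expR 0.
  by apply: continuous_cvg h; exact: continuous_expR.
by rewrite expR0 in h2.
Qed.

Lemma bump1_test a b c L : 0 < a -> a < b -> b < L -> 0 < c ->
  test_function L (bump1 a b c).
Proof.
move=> a0 ab bL c0; apply: (test_functionP a0 bL); first exact: bump_smooth.
by move=> x /bump_support; lra.
Qed.

End Bump.

(** * Weak derivatives *)

Section WeakDerivative.
Context {R : realType}.
Implicit Types (f g h F G phi psi : R -> R) (a b c x y L : R).
Local Notation mu := (@lebesgue_measure R).

Lemma integrable_extend0 (A B : set (measurableTypeR R)) f : measurable A -> measurable B -> A `<=` B ->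
  (forall x, B x -> ~ A x -> f x = 0) ->
  mu.-integrable A (EFin \o f) -> mu.-integrable B (EFin \o f).
Proof.
move=> mA mB AB f0 iA.
have iA' : mu.-integrable (B `&` A) (EFin \o f) by rewrite (setIidr AB).
have := (integrable_restrict mu mA mB (EFin \o f)).1 iA'.
have : {in B, ((EFin \o f) \_ A) =1 EFin \o f}.
  move=> x /set_mem Bx; rewrite patchE.
  by case: ifPn => // /negP; rewrite inE => /(f0 x Bx) /= ->.
exact: eq_integrable.
Qed.

Lemma integral_extend0 (A B : set (measurableTypeR R)) (f : R -> \bar R) : A `<=` B ->
  (forall x, B x -> ~ A x -> f x = 0%E) ->
  (\int[mu]_(x in B) f x = \int[mu]_(x in A) f x)%E.
Proof.
move=> AB f0; rewrite integral_mkcond [RHS]integral_mkcond.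
congr (integral _ _ _); apply/funext => x; rewrite !patchE.
case: ifPn => [|/negP]; rewrite inE => xB.
  by case: ifPn => // /negP; rewrite inE => /(f0 x xB).
by case: ifPn => //; rewrite inE => /AB.
Qed.

Lemma locally_integrable_sub (D K : set R) h : locally_integrable D h ->
  compact K -> K `<=` D -> mu.-integrable K (EFin \o h).
Proof.
move=> [mh oD ih] cK KD; have mK := compact_measurable cK.
apply/integrableP; split; last exact: ih.
apply/measurable_EFinP; apply: measurable_funS mh => //.
exact: open_measurable.
Qed.

Lemma test_function_continuous L phi : test_function L phi -> continuous phi.
Proof.
move=> [d _ _] x; apply: differentiable_continuous; apply/derivable1_diffP.
exact: (d 0%N).
Qed.

Lemma test_function_derive L phi : test_function L phi ->
  forall x, is_derive x (1 : R) phi (derive1 phi x).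
Proof. by move=> [d _ _] x; rewrite derive1E; apply/derivableP; exact: (d 0%N). Qed.

Lemma test_function_out L phi x : test_function L phi -> ~ (0 < x < L) -> phi x = 0.
Proof.
move=> [_ _ s] x0L; apply: contrapT => /eqP px; apply: x0L.
have := s x; rewrite /= in_itv /=; apply.
exact: subset_closure.
Qed.

Lemma test_function_deriveT L phi : test_function L phi -> test_function L (derive1 phi).
Proof.
move=> [d cK sK].
have sub : closure [set x | derive1 phi x != 0] `<=` closure [set x | phi x != 0].
  rewrite [X in _ `<=` X](closure_id _).1; last exact: closed_closure.
  apply: closure_subset => x /= px; apply: contrapT => npx.
  have : \near x, (fun=> (0 : R)) x = phi x.
    have : nbhs x (~` closure [set x | phi x != 0]).
      by apply: open_nbhs_nbhs; split => //; exact/closed_openC/closed_closure.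
    apply: filterS => y ny; apply/esym/eqP; apply: contrapT => /negP py.
    by apply: ny; exact: subset_closure.
  move=> /near_eq_is_derive /(_ (is_derive1_const 0 x)) [_ e].
  by move: px; rewrite derive1E e eqxx.
split.
- move=> n x; have := d n.+1 x.
  by rewrite /derive1n iterSr.
- apply: (subclosed_compact _ cK sub); exact: closed_closure.
- by move=> x /sub /sK.
Qed.

Lemma mul_test_integrable L h phi : locally_integrable `]0, L[ h ->
  test_function L phi -> mu.-integrable `]0, L[ (EFin \o (fun x => h x * phi x)).
Proof.
move=> lh tp; have [_ cK KL] := tp; set K := closure _ in cK KL.
apply: (integrable_extend0 (A := K)) => //.
- exact: compact_measurable.
- move=> x _ Kx; apply/eqP; rewrite mulf_eq0; apply/orP; right.
  by apply: contrapT => /negP p0; apply: Kx; exact: subset_closure.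
- have ih := locally_integrable_sub lh cK KL.
  rewrite (_ : EFin \o _ = (EFin \o h) \* (EFin \o phi))%E; last first.
    by apply/funext => x /=; rewrite EFinM.
  apply: integrableMl => //; first exact: compact_measurable.
    by apply: measurable_funTS; apply: continuous_measurable_fun; exact: test_function_continuous tp.
  have : compact (phi @` K).
    apply: continuous_compact => //; apply: continuous_subspaceT.
    exact: test_function_continuous tp.
  move=> /compact_bounded [M [Mr hM]]; exists M; split => // N MN x Kx.
  by apply: (hM N MN); exists x.
Qed.

(** As [c] tends to 0, [bump1 a b c] tends to the indicator of []a, b[] with values in [0, 1], so
    dominated convergence applies. *)
Lemma fundamental_interval L h : locally_integrable `]0, L[ h ->
  (forall a b c, 0 < a -> a < b -> b < L -> 0 < c ->
    \int[mu]_(x in `]0, L[) (h x * bump1 a b c x) = 0) ->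
  forall a b, 0 < a -> a < b -> b < L -> \int[mu]_(x in `]a, b[) h x = 0.
Proof.
move=> lh h0 a b a0 ab bL.
have abL : `]a, b[ `<=` (`]0, L[ : set R).
  by apply: subset_itv; rewrite bnd_simp ltW.
pose B n x := bump1 a b n.+1%:R^-1 x.
have tB n : test_function L (B n) by apply: bump1_test => //; rewrite invr_gt0.
have iB n : mu.-integrable `]0, L[ (EFin \o (fun x => h x * B n x)).
  exact: mul_test_integrable.
have z n : (\int[mu]_(x in `]a, b[) (h x * B n x)%:E = 0)%E.
  have := h0 a b n.+1%:R^-1 a0 ab bL; rewrite invr_gt0 ltr0n => /(_ isT).
  rewrite /Rintegral -/(B n).
  rewrite (integral_extend0 abL) => [e|x _ nab]; last first.
    rewrite -/(B n x) (_ : B n x = 0) ?mulr0 //; apply/eqP; apply: contrapT => /negP.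
    by move=> /bump_support xab; apply: nab; rewrite /= in_itv.
  have : (\int[mu]_(x in `]a, b[) (h x * B n x)%:E)%E \is a fin_num.
    by apply: integrable_fin_num => //; apply: integrableS (iB n).
  by move=> /fineK <-; rewrite e.
have ih : mu.-integrable `]a, b[ (EFin \o h).
  apply: (@integrableS _ _ _ mu `[a, b]) => //; first exact: subset_itv_oo_cc.
  apply: (locally_integrable_sub lh); first exact: segment_compact.
  by apply: subset_itv; rewrite bnd_simp.
have : (\int[mu]_(x in `]a, b[) (h x * B n x)%:E)%E @[n --> \oo] -->
       (\int[mu]_(x in `]a, b[) (h x)%:E)%E.
  apply: (@dominated_cvg _ _ _ mu _ _ (fun n x => (h x * B n x)%:E) _ (fun x => `|h x|%:E)) => //.
  - move=> n; have /measurable_int := iB n; apply: measurable_funS => //.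
  - move=> x; rewrite /= in_itv /= => xab; apply: cvg_EFin; first exact: nearW.
    rewrite -[X in _ --> X](mulr1 (h x)).
    have := @cvgMl_tmp _ _ _ _ _ (h x) _ (bump1_cvg xab); exact.
  - exact: (integrable_abse ih).
  - move=> n x _; rewrite abse_EFin lee_fin normrM ler_piMr //.
    by rewrite ger0_norm ?bump1_ge0 // bump1_le1 // invr_gt0.
under eq_fun do rewrite z.
move=> /(cvg_unique _) /(_ (cvg_cst _)) e; rewrite /Rintegral.
by rewrite e.
Qed.

End WeakDerivative.

(** * The fundamental lemma of the calculus of variations *)

Section FundamentalLemma.
Context {R : realType}.
Implicit Types (f g h F G phi psi u v w : R -> R) (a b c x y L : R).
Local Notation mu := (@lebesgue_measure R).

Lemma ae_imply (P Q : R -> Prop) : (forall x, P x -> Q x) ->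
  {ae mu, forall x, P x} -> {ae mu, forall x, Q x}.
Proof. by move=> PQ; apply: filterS => //; exact: (ae_filter_ringOfSetsType mu). Qed.

Lemma ae_imply2 (P Q S : R -> Prop) : (forall x, P x -> Q x -> S x) ->
  {ae mu, forall x, P x} -> {ae mu, forall x, Q x} -> {ae mu, forall x, S x}.
Proof. by move=> PQ; apply: filterS2 => //; exact: (ae_filter_ringOfSetsType mu). Qed.

Lemma Rintegral_oo_cc h a b : mu.-integrable `[a, b] (EFin \o h) ->
  \int[mu]_(x in `]a, b[) h x = \int[mu]_(x in `[a, b]) h x.
Proof.
move=> ih; rewrite Rintegral_itv_bndo_bndc; last first.
  by apply: integrableS ih => //; exact: subset_itv_oo_cc.
rewrite Rintegral_itv_obnd_cbnd //.
by apply: integrableS ih => //; exact: subset_itv_oc_cc.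
Qed.

Lemma Rintegral_oo_continuous g G a b : a < b -> continuous g ->
  (forall x, is_derive x (1 : R) G (g x)) ->
  \int[mu]_(x in `]a, b[) g x = G b - G a.
Proof.
move=> ab cg dG; rewrite Rintegral_oo_cc; last exact: continuous_integrable_cc.
rewrite /Rintegral (continuous_FTC2 (F := G) ab) //.
- exact: continuous_subspaceT.
- split.
  + by move=> x _; have [] := dG x.
  + by apply: cvg_at_right_filter; exact: (derivable_continuous dG).
  + by apply: cvg_at_left_filter; exact: (derivable_continuous dG).
- by move=> x _; rewrite derive1E; have [_ ->] := dG x.
Qed.

(** Lebesgue differentiation: the integrals of [h] over intervals vanish, and their derivative is
    [h] almost everywhere. As [h] is only locally integrable, this is done on compact intervals
    [[a n, b n]] exhausting []0, L[]; the denominator [n + 3] gives [a n < L / 2 < b n] from the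
    start. *)
Lemma fundamental_ae L h : locally_integrable `]0, L[ h ->
  (forall a b c, 0 < a -> a < b -> b < L -> 0 < c ->
    \int[mu]_(x in `]0, L[) (h x * bump1 a b c x) = 0) ->
  {ae mu, forall x, x \in `]0, L[ -> h x = 0}.
Proof.
move=> lh h0.
have [L0|L0] := leP L 0.
  by apply: aeW => x; rewrite in_itv /= => /andP[x0 xL]; lra.
have hI := fundamental_interval lh h0.
pose a n := L / n.+3%:R; pose b n := L - a n.
have a0 n : 0 < a n by rewrite divr_gt0.
have ab n : a n < b n.
  rewrite /b ltrBrDr /a -mulrDl ltr_pdivrMr //.
  have : 2 < n.+3%:R :> R by rewrite ltr_nat.
  nra.
have bL n : b n < L by rewrite /b; have := a0 n; lra.
have step n : {ae mu, forall x, a n < x < b n -> h x = 0}.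
  have ih : mu.-integrable `[a n, b n] (EFin \o h).
    apply: (locally_integrable_sub lh); first exact: segment_compact.
    by apply: subset_itv; rewrite bnd_simp.
  pose hn := h \_ `[a n, b n].
  have ihn : mu.-integrable setT (EFin \o hn).
    rewrite /hn -restrict_EFin.
    by apply/(integrable_restrict mu (D := `[a n, b n]) _ measurableT) => //; rewrite setTI.
  have ihny y : mu.-integrable `[a n, y] (EFin \o hn).
    by apply: integrableS ihn.
  have lhn : locally_integrable setT hn by apply: integrable_locally_restrict.
  have := FTC1 ihny lhn; apply: ae_imply => x H xab.
  have ax : ((a n)%:E < x%:E)%E by rewrite lte_fin; lra.
  have [d e] := H ax.
  move: e; rewrite {2}/hn patchE mem_set /=; last by rewrite in_itv /=; lra.
  move=> <-.
  have nz : \near x, (fun=> (0 : R)) x = \int[mu]_(t in `[a n, x]) hn t.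
    near=> y.
    have : y \in `]a n, b n[ by near: y; apply: near_in_itvoo; rewrite in_itv.
    rewrite in_itv /= => /andP[ay yb].
    rewrite -(hI (a n) y) //; last by have := bL n; lra.
    rewrite Rintegral_oo_cc.
      apply: eq_Rintegral => t; rewrite inE /= in_itv /= => tay.
      by rewrite /hn patchE mem_set //= in_itv /=; lra.
    apply: integrableS ih => //; apply: subset_itvl; rewrite bnd_simp; lra.
  have [_ e0] := near_eq_is_derive nz (is_derive1_const 0 x).
  by rewrite derive1E.
have := ae_foralln step; apply: ae_imply => x H; rewrite in_itv /= => /andP[x0 xL].
have [n hn] : exists n, a n < x /\ x < b n.
  pose m := Num.min x (L - x).
  have m0 : 0 < m by rewrite lt_min x0 subr_gt0.
  exists (Num.truncn (L / m)).
  suff : a (Num.truncn (L / m)) < m by rewrite lt_min /b => /andP[]; lra.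
  rewrite /a ltr_pdivrMr // mulrC -ltr_pdivrMr //.
  apply: lt_trans (truncnS_gt _) _.
  by rewrite ltr_nat.
by apply: (H n); apply/andP.
Unshelve. all: by end_near. Qed.

Lemma fundamental_continuous L h : locally_integrable `]0, L[ h ->
  {in `]0, L[, continuous h} ->
  (forall a b c, 0 < a -> a < b -> b < L -> 0 < c ->
    \int[mu]_(x in `]0, L[) (h x * bump1 a b c x) = 0) ->
  {in `]0, L[, forall x, h x = 0}.
Proof.
move=> lh ch h0 x; rewrite in_itv /= => x0L.
have hI := fundamental_interval lh h0.
pose a := x / 2; pose b := (x + L) / 2.
have ih : mu.-integrable `[a, b] (EFin \o h).
  apply: (locally_integrable_sub lh); first exact: segment_compact.
  by apply: subset_itv; rewrite bnd_simp /a /b; lra.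
have [d <-] := @continuous_FTC1_closed R h a x b ltac:(by rewrite /b; lra) ih
  ltac:(by rewrite /a; lra) (ch x ltac:(by rewrite in_itv)).
have nz : \near x, (fun=> (0 : R)) x = \int[mu]_(t in `[a, x]) h t.
  near=> y.
  have : y \in `]a, b[.
    by near: y; apply: near_in_itvoo; rewrite in_itv /= /a /b; lra.
  rewrite in_itv /= => /andP[ay yb].
  rewrite -(hI a y) //; [|rewrite /a; lra|by move: yb; rewrite /b; lra].
  rewrite Rintegral_oo_cc //.
  by apply: (integrableS _ _ _ ih) => //; apply: subset_itvl; rewrite bnd_simp; lra.
have [_ e0] := near_eq_is_derive nz (is_derive1_const 0 x).
by rewrite derive1E.
Unshelve. all: by end_near. Qed.

End FundamentalLemma.

(** * The lemma of du Bois-Reymond *)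

Section WeakDerivativeTheory.
Context {R : realType}.
Implicit Types (f g h F G phi psi u v w : R -> R) (a b c x y L : R).
Local Notation mu := (@lebesgue_measure R).

Lemma within_add f g (A : set R) : {within A, continuous f} -> {within A, continuous g} ->
  {within A, continuous (fun x => f x + g x)}.
Proof. by move=> cf cg x; apply: cvgD; [exact: cf|exact: cg]. Qed.

Lemma within_opp f (A : set R) : {within A, continuous f} ->
  {within A, continuous (fun x => - f x)}.
Proof. by move=> cf x; apply: cvgN; exact: cf. Qed.

Lemma within_sub f g (A : set R) : {within A, continuous f} -> {within A, continuous g} ->
  {within A, continuous (fun x => f x - g x)}.
Proof. by move=> cf cg; apply: within_add => //; exact: within_opp. Qed.

Lemma within_mul f g (A : set R) : {within A, continuous f} -> {within A, continuous g} ->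
  {within A, continuous (fun x => f x * g x)}.
Proof. by move=> cf cg x; apply: cvgM; [exact: cf|exact: cg]. Qed.

Lemma within_eq f g a b : (forall x, a <= x <= b -> f x = g x) ->
  {within `[a, b], continuous f} -> {within `[a, b], continuous g}.
Proof.
move=> fg; apply: subspace_eq_continuous => x; rewrite inE /= in_itv /=; exact: fg.
Qed.

Lemma within_locally_integrable L u : {within `[0, L], continuous u} ->
  locally_integrable `]0, L[ u.
Proof.
move=> cu; apply: open_integrable_locally; first exact: interval_open.
apply: (@integrableS _ _ _ mu `[0, L]) => //; first exact: subset_itv_oo_cc.
by apply: continuous_compact_integrable; first exact: segment_compact.
Qed.

Lemma continuous_locally_integrable L u : continuous u -> locally_integrable `]0, L[ u.
Proof.
by move=> cu; apply: within_locally_integrable; exact: continuous_subspaceT.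
Qed.

Lemma within_zero_closed L (d : R -> R) : 0 < L -> {within `[0, L], continuous d} ->
  (forall x, 0 < x < L -> d x = 0) -> forall x, 0 <= x <= L -> d x = 0.
Proof.
move=> L0 cd d0.
have dd x : 0 < x < L -> is_derive x (1 : R) d 0.
  move=> xL; apply: (near_eq_is_derive _ (is_derive1_const 0 x)).
  near=> y; have : y \in `]0, L[ by near: y; apply: near_in_itvoo; rewrite in_itv.
  by rewrite in_itv /= => /d0.
have E x y : 0 <= x -> x <= y -> y <= L -> d x = d y.
  move=> x0 xy yL; apply: derive_eq0 => //.
    by apply: continuous_subspaceW cd; apply: subset_itv; rewrite bnd_simp.
  by move=> t ht; apply: dd; lra.
have h0 : d (L / 2) = 0 by apply: d0; lra.
move=> x xL; have [xh|xh] := leP x (L / 2).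
  by rewrite (E x (L / 2)) //; lra.
by rewrite -(E (L / 2) x) //; lra.
Unshelve. all: by end_near. Qed.

(** A test function with integral 0 is the derivative of a test function. Subtracting from a bump
    [psi] the multiple of a fixed bump [rho] with the same integral gives such a function, so [h]
    and the constant [C], the mean of [h] with weight [rho], have the same integral against every
    [psi]. *)
Lemma du_bois_reymond L h : 0 < L -> {within `[0, L], continuous h} ->
  (forall phi, test_function L phi ->
    \int[mu]_(x in `]0, L[) (h x * derive1 phi x) = 0) ->
  exists c, forall x, 0 <= x <= L -> h x = c.
Proof.
move=> L0 ch h0.
pose rho := bump1 (L / 3) (2 * L / 3) 1.
have l3 : L / 3 < 2 * L / 3 by lra.
have tr : test_function L rho by apply: bump1_test => //; lra.
have sr : smooth rho by apply: bump_smooth.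
have [Gr dGr] := primitive_exists (smooth_continuous sr).
pose m := Gr L - Gr 0.
have m0 : 0 < m.
  rewrite subr_gt0.
  apply: (@le_lt_trans _ _ (Gr (L / 3))).
    apply: (ge0_derive_le _ _ (fun x _ => dGr x)); first by lra.
      exact: continuous_subspaceT (derivable_continuous dGr).
    by move=> x _; exact: bump1_ge0.
  apply: (@lt_le_trans _ _ (Gr (2 * L / 3))).
    apply: (gt0_derive_lt l3 _ (fun x _ => dGr x)).
      exact: continuous_subspaceT (derivable_continuous dGr).
    by move=> x xl; rewrite /rho bump1E xl expR_gt0.
  apply: (ge0_derive_le _ _ (fun x _ => dGr x)); first by lra.
    exact: continuous_subspaceT (derivable_continuous dGr).
  by move=> x _; exact: bump1_ge0.
pose I := \int[mu]_(x in `]0, L[) (h x * rho x).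
pose C := I / m.
exists C => x xL; apply/eqP; rewrite -subr_eq0; apply/eqP.
have chC : {within `[0, L], continuous (fun x => h x - C)}.
  by apply: within_sub => //; apply: continuous_subspaceT => y; exact: cvg_cst.
apply: (within_zero_closed L0 chC) => // {}x {}xL.
have lh := within_locally_integrable ch.
apply: (@fundamental_continuous R L (fun x => h x - C)); last by rewrite in_itv.
- exact: within_locally_integrable.
- by move=> y yL; exact: (within_continuous_continuous L0 chC yL).
move=> a b c a0 ab bL c0.
have tp : test_function L (bump1 a b c) by exact: bump1_test.
have sp : smooth (bump1 a b c) by apply: bump_smooth.
set psi := bump1 a b c in tp sp *.
have [Gp dGp] := primitive_exists (smooth_continuous sp).
pose s := (Gp L - Gp 0) / m.
pose phi y := (Gp y - s * Gr y) - (Gp 0 - s * Gr 0).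
have dphi y : is_derive y (1 : R) phi (psi y - s * rho y).
  have := is_derive1B (is_derive1B (dGp y) (is_derive1Z s (dGr y)))
    (is_derive1_const (Gp 0 - s * Gr 0) y).
  by rewrite subr0.
have phiL : phi L = 0.
  by rewrite /phi /s -/m; have := lt0r_neq0 m0; rewrite /m => mn0; field.
have phi0 : phi 0 = 0 by rewrite /phi subrr.
(* [phi] is constant on both sides of an interval containing the two supports: 0 on the left by
   normalization, and 0 on the right because [s] balances the integrals. *)
pose a' := Num.min a (L / 3); pose b' := Num.max b (2 * L / 3).
have a'0 : 0 < a' by rewrite lt_min a0; lra.
have b'L : b' < L by rewrite gt_max bL; lra.
have zero y : ~ (a' < y < b') -> psi y - s * rho y = 0.
  move=> ny.
  have -> : psi y = 0.
    apply/eqP; apply: contrapT => /negP /bump_support yy; apply: ny.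
    by rewrite gt_min lt_max; apply/andP; split; apply/orP; left; lra.
  have -> : rho y = 0; last by rewrite mulr0 subrr.
  apply/eqP; apply: contrapT => /negP /bump_support yy; apply: ny.
  by rewrite gt_min lt_max; apply/andP; split; apply/orP; right; lra.
have cphi : continuous phi := derivable_continuous dphi.
have tphi : test_function L phi.
  apply: (test_functionP a'0 b'L).
    by apply: smooth_primitive dphi; exact: smooth_lin.
  move=> y; apply: contraNT; rewrite negb_and -!ltNge => /orP[ya|yb].
  - have [y0|y0] := leP y 0.
      rewrite -phi0; apply/eqP; apply: (derive_eq0 y0).
        exact: continuous_subspaceT.
      by move=> t ht; rewrite -(zero t) //; lra.
    rewrite -phi0; apply/eqP/esym; apply: (derive_eq0 (ltW y0)).
      exact: continuous_subspaceT.
    by move=> t ht; rewrite -(zero t) //; lra.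
  - have [yL|yL] := leP y L.
      rewrite -phiL; apply/eqP; apply: (derive_eq0 yL).
        exact: continuous_subspaceT.
      by move=> t ht; rewrite -(zero t) //; lra.
    rewrite -phiL; apply/eqP/esym; apply: (derive_eq0 (ltW yL)).
      exact: continuous_subspaceT.
    by move=> t ht; rewrite -(zero t) //; lra.
have ihp := mul_test_integrable lh tp.
have ihr := mul_test_integrable lh tr.
have cC : continuous (cst C : R -> R) by exact: cst_continuous.
have icp := mul_test_integrable (continuous_locally_integrable L cC) tp.
have E1 : \int[mu]_(x in `]0, L[) (h x * psi x) = s * I.
  have := h0 _ tphi.
  rewrite (_ : (fun x => h x * derive1 phi x) = (fun x => h x * psi x - s * (h x * rho x))).
    have ishr : mu.-integrable `]0, L[ (EFin \o (fun x => s * (h x * rho x))).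
      rewrite (_ : (fun x => s * (h x * rho x)) = (fun x => s * h x * rho x)); last first.
        by apply/funext => y; rewrite mulrA.
      apply: mul_test_integrable tr; apply: within_locally_integrable.
      apply: within_mul => //; apply: continuous_subspaceT.
      by apply: (@cst_continuous R R s).
    rewrite RintegralB // RintegralZl // -/I => /eqP.
    by rewrite subr_eq0 => /eqP.
  by apply/funext => y; rewrite derive1E; have [_ ->] := dphi y; ring.
rewrite (_ : (fun x => (h x - C) * psi x) = (fun x => h x * psi x - C * psi x)); last first.
  by apply/funext => y; ring.
rewrite RintegralB // E1 RintegralZl //; last first.
  apply: (@integrableS _ _ _ mu `[0, L]) => //; first exact: subset_itv_oo_cc.
  by apply: continuous_integrable_cc; exact: smooth_continuous.
rewrite (Rintegral_oo_continuous L0 (smooth_continuous sp) dGp) /C /s.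
ring.
Qed.

End WeakDerivativeTheory.

(** * Identification of the chosen weak derivatives *)

Section WDeriv.
Context {R : realType}.
Implicit Types (f g h F G phi psi u v w U : R -> R) (a b c x y L : R).
Local Notation mu := (@lebesgue_measure R).

Lemma locally_integrable_eq L h h' : (forall x, 0 < x < L -> h x = h' x) ->
  locally_integrable `]0, L[ h -> locally_integrable `]0, L[ h'.
Proof.
move=> hh [mh oD ih]; split => //.
  apply: eq_measurable_fun mh => x; rewrite inE /= in_itv /=; exact: hh.
move=> K KD cK; have := ih K KD cK; congr (_ < _)%E; apply: eq_integral => x.
by rewrite inE => /KD; rewrite /= in_itv /= => /hh ->.
Qed.

Lemma Rintegral_oo_eq L f g : (forall x, 0 < x < L -> f x = g x) ->
  \int[mu]_(x in `]0, L[) f x = \int[mu]_(x in `]0, L[) g x.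
Proof. by move=> fg; apply: eq_Rintegral => x; rewrite inE /= in_itv; exact: fg. Qed.

Lemma weak_derivative_eq L u u' v v' : (forall x, 0 < x < L -> u x = u' x) ->
  (forall x, 0 < x < L -> v x = v' x) ->
  is_weak_derivative L u v -> is_weak_derivative L u' v'.
Proof.
move=> uu vv [lu lv h]; split; [exact: locally_integrable_eq lu|exact: locally_integrable_eq lv|].
move=> phi tp; have := h phi tp.
rewrite (@Rintegral_oo_eq _ (fun x => u x * _) (fun x => u' x * derive1 phi x)); last first.
  by move=> x /uu ->.
rewrite (@Rintegral_oo_eq _ (fun x => v x * _) (fun x => v' x * phi x)) //.
by move=> x /vv ->.
Qed.

Lemma C1_weak_derivative L U g : 0 < L -> (forall x, is_derive x (1 : R) U (g x)) ->
  continuous g -> is_weak_derivative L U g.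
Proof.
move=> L0 dU cg; have cU := derivable_continuous dU.
have lU := continuous_locally_integrable L cU.
have lg := continuous_locally_integrable L cg.
split=> // phi tp.
have tp' := test_function_deriveT tp.
have cp := test_function_continuous tp; have cp' := test_function_continuous tp'.
have dp := test_function_derive tp.
have dUp x : is_derive x (1 : R) (fun y => U y * phi y) (g x * phi x + U x * derive1 phi x).
  exact: is_derive1M.
have c : continuous (fun x => g x * phi x + U x * derive1 phi x).
  by move=> x; apply: cvgD; apply: cvgM; [exact: cg|exact: cp|exact: cU|exact: cp'].
have := Rintegral_oo_continuous L0 c dUp.
rewrite (test_function_out (x := L) tp) ?(test_function_out (x := 0) tp); try lra.
rewrite !mulr0 subrr RintegralD //; [|exact: mul_test_integrable..].
by move/eqP; rewrite addrC addr_eq0 => /eqP.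
Qed.

Lemma weak_derivative_diff L u v v' : is_weak_derivative L u v -> is_weak_derivative L u v' ->
  forall phi, test_function L phi ->
    \int[mu]_(x in `]0, L[) ((v x - v' x) * phi x) = 0.
Proof.
move=> [_ lv hv] [_ lv' hv'] phi tp.
have -> : (fun x => (v x - v' x) * phi x) = (fun x => v x * phi x - v' x * phi x).
  by apply/funext => x; rewrite mulrBl.
rewrite RintegralB //; [|exact: mul_test_integrable..].
have := hv _ tp; rewrite (hv' _ tp) => /oppr_inj ->; exact: subrr.
Qed.

Lemma weak_derivative_unique L u v v' : is_weak_derivative L u v -> is_weak_derivative L u v' ->
  {ae mu, forall x, x \in `]0, L[ -> v x = v' x}.
Proof.
move=> hv hv'.
have := @fundamental_ae R L (fun x => v x - v' x).
have [_ lv _] := hv; have [_ lv' _] := hv'.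
move=> /(_ (locally_integrableB lv lv')) H.
apply: ae_imply (H _) => [x h /h /eqP|]; first by rewrite subr_eq0 => /eqP.
by move=> a b c a0 ab bL c0; apply: (weak_derivative_diff hv hv'); exact: bump1_test.
Qed.

Lemma weak_derivative_unique_continuous L u v v' : 0 < L ->
  {within `[0, L], continuous v} -> {within `[0, L], continuous v'} ->
  is_weak_derivative L u v -> is_weak_derivative L u v' ->
  forall x, 0 <= x <= L -> v x = v' x.
Proof.
move=> L0 cv cv' hv hv' x xL; apply/eqP; rewrite -subr_eq0; apply/eqP.
have cd := within_sub cv cv'.
apply: (within_zero_closed L0 cd) xL => {}x xL.
apply: (@fundamental_continuous R L (fun x => v x - v' x)); last by rewrite in_itv.
- exact: within_locally_integrable.
- by move=> y yL; exact: (within_continuous_continuous L0 cd yL).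
- by move=> a b c a0 ab bL c0; apply: (weak_derivative_diff hv hv'); exact: bump1_test.
Qed.

Lemma wderiv_spec L u v : {within `[0, L], continuous v} -> is_weak_derivative L u v ->
  {within `[0, L], continuous (wderiv L u)} /\ is_weak_derivative L u (wderiv L u).
Proof.
by move=> cv hv; apply: (@xgetPex _ (cst 0) [set v | {within `[0, L], continuous v} /\
  is_weak_derivative L u v]); exists v.
Qed.

Lemma wderiv2_spec L u w : is_weak_derivative L (wderiv L u) w ->
  is_weak_derivative L (wderiv L u) (wderiv2 L u).
Proof. by move=> hw; apply: (xgetPex (cst 0)); exists w. Qed.

(** Continuous weak derivatives coincide up to the endpoints, so the choice in [wderiv] can only
    return the classical derivative. *)
Lemma wderivE L u U g : 0 < L -> (forall x, 0 <= x <= L -> u x = U x) ->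
  (forall x, is_derive x (1 : R) U (g x)) -> continuous g ->
  is_weak_derivative L u (wderiv L u) /\ forall x, 0 <= x <= L -> wderiv L u x = g x.
Proof.
move=> L0 uU dU cg.
have wug : is_weak_derivative L u g.
  apply: weak_derivative_eq (C1_weak_derivative L0 dU cg) => // x xL.
  by rewrite uU //; lra.
have cgw : {within `[0, L], continuous g} by exact: continuous_subspaceT.
have [c1 c2] := wderiv_spec cgw wug.
by split => //; apply: (weak_derivative_unique_continuous L0 c1 cgw c2 wug).
Qed.

Lemma wderiv2E L u U g w : 0 < L -> (forall x, 0 <= x <= L -> u x = U x) ->
  (forall x, is_derive x (1 : R) U (g x)) -> (forall x, is_derive x (1 : R) g (w x)) ->
  continuous w ->
  [/\ is_weak_derivative L (wderiv L u) (wderiv2 L u),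
      is_weak_derivative L (wderiv L u) w &
      {ae mu, forall x, x \in `]0, L[ -> wderiv2 L u x = w x}].
Proof.
move=> L0 uU dU dg cw.
have [_ E] := wderivE L0 uU dU (derivable_continuous dg).
have h : is_weak_derivative L (wderiv L u) w.
  apply: weak_derivative_eq (C1_weak_derivative L0 dg cw) => // x xL.
  by rewrite E //; lra.
have h2 := wderiv2_spec h.
by split => //; exact: weak_derivative_unique h2 h.
Qed.

(* If [u] has no continuous weak derivative, [wderiv L u] is the default [cst 0],
   which is weakly differentiable too. *)
Lemma W2p_wderiv L p u : 0 < L -> W2p L p u ->
  [/\ {within `[0, L], continuous (wderiv L u)},
      is_weak_derivative L (wderiv L u) (wderiv2 L u) &
      is_weak_derivative L u (wderiv L u) \/ wderiv L u = cst 0].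
Proof.
move=> L0 [cu _ [v [w [uv _ vw _]]]].
have [[z [cz hz]]|nz] := pselect (exists z, {within `[0, L], continuous z} /\
    is_weak_derivative L u z).
  have [c1 c2] := wderiv_spec cz hz; split => //; last by left.
  apply: (@wderiv2_spec _ _ w); split.
  - by case: c2.
  - by case: vw.
  move=> phi tp; have [_ lv hvw] := vw; rewrite -hvw //.
  have tp' := test_function_deriveT tp.
  have := weak_derivative_diff c2 uv tp'.
  have [_ l1 _] := c2; have [_ l2 _] := uv.
  have -> : (fun x => (wderiv L u x - v x) * derive1 phi x) =
      (fun x => wderiv L u x * derive1 phi x - v x * derive1 phi x).
    by apply/funext => x; rewrite mulrBl.
  rewrite RintegralB //; [|exact: mul_test_integrable..].
  by move=> /eqP; rewrite subr_eq0 => /eqP.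
have E : wderiv L u = cst 0 by apply: xgetPN => z [cz hz]; apply: nz; exists z.
split; last by right.
- rewrite E; apply: continuous_subspaceT; exact: cst_continuous.
- apply: (@wderiv2_spec _ _ (cst 0)); rewrite E.
  exact: (@C1_weak_derivative L (cst 0) (cst 0) L0 (is_derive1_const 0)
    (@cst_continuous R R 0)).
Qed.

(** Source of regularity: a weak derivative with a continuous representative makes [v] a C^1
    function, since [v - G] has weak derivative 0. *)
Lemma weak_derivative_primitive L v w g G : 0 < L ->
  {within `[0, L], continuous v} -> is_weak_derivative L v w ->
  {ae mu, forall x, x \in `]0, L[ -> w x = g x} ->
  (forall x, is_derive x (1 : R) G (g x)) -> continuous g ->
  exists c, forall x, 0 <= x <= L -> v x = G x + c.
Proof.
move=> L0 cv hv wg dG cg.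
have cG := derivable_continuous dG.
have [||c H] := @du_bois_reymond R L (fun x => v x - G x) L0.
- by apply: within_sub => //; exact: continuous_subspaceT.
- move=> phi tp; have tp' := test_function_deriveT tp.
  have [lv lw hvw] := hv; have [lG lg hGg] := C1_weak_derivative L0 dG cg.
  have -> : (fun x => (v x - G x) * derive1 phi x) =
      (fun x => v x * derive1 phi x - G x * derive1 phi x).
    by apply/funext => x; rewrite mulrBl.
  rewrite RintegralB //; [|exact: mul_test_integrable..].
  rewrite hvw // hGg // opprK addrC; apply/eqP; rewrite subr_eq0; apply/eqP.
  have i1 := mul_test_integrable lw tp; have i2 := mul_test_integrable lg tp.
  rewrite /Rintegral; congr fine; apply: ae_eq_integral => //.
  + exact: measurable_int i2.
  + exact: measurable_int i1.
  + by apply: ae_imply wg => x h; rewrite /= => xL; rewrite h.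
- by exists c => x /H <-; rewrite addrC subrK.
Qed.

End WDeriv.

(** * Bounds of Sobolev norms by uniform norms *)

Section LpBounds.
Context {R : realType}.
Implicit Types (f g u v w U : R -> R) (a b c x y L p M : R).
Local Notation mu := (@lebesgue_measure R).

Lemma lebesgue_measure_oo L : 0 < L -> mu `]0, L[ = L%:E.
Proof. by move=> L0; rewrite lebesgue_measure_itv /= lte_fin L0 oppr0 adde0. Qed.

Lemma Lnorm_le L p M g : 0 < L -> 0 < p -> 0 <= M ->
  measurable_fun (`]0, L[ : set (measurableTypeR R)) g ->
  {ae mu, forall x, x \in `]0, L[ -> `|g x| <= M} ->
  (Lnorm mu p%:E (EFin \o (g \_ `]0%R, L[)%R) <= (M * L `^ p^-1)%:E)%E.
Proof.
move=> L0 p0 M0 mg gM.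
rewrite unlock /Lnorm.
have E : (\int[mu]_x (`|(EFin \o (g \_ `]0%R, L[)) x| `^ p) =
          \int[mu]_(x in `]0%R, L[) (`|g x| `^ p)%:E)%E.
  rewrite [RHS]integral_mkcond; apply: eq_integral => x _ /=.
  rewrite !patchE; case: ifPn => _ //=.
  by rewrite normr0 powR0 // gt_eqF.
have H : (\int[mu]_(x in `]0%R, L[) (`|g x| `^ p)%:E <= (M `^ p * L)%:E)%E.
  have e1 : (\int[mu]_(x in `]0%R, L[) (cst (M `^ p)%:E) x = (M `^ p)%:E * mu `]0%R, L[)%E.
    by apply: integral_cst; exact: measurable_itv.
  rewrite lebesgue_measure_oo // in e1; rewrite EFinM -e1.
  apply: ae_ge0_le_integral.
  - exact: measurable_itv.
  - by move=> x _; rewrite lee_fin powR_ge0.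
  - apply/measurable_EFinP.
    by apply: (measurableT_comp (measurable_powR p)); exact: measurableT_comp mg.
  - by move=> x _; rewrite lee_fin powR_ge0.
  - exact: measurable_cst.
  - apply: ae_imply gM => x h xL; rewrite lee_fin.
    by apply: ge0_ler_powR; rewrite ?nnegrE ?(ltW p0) //; exact: h.
have I0 : (0 <= \int[mu]_(x in `]0%R, L[) (`|g x| `^ p)%:E)%E.
  by apply: integral_ge0 => x _; rewrite lee_fin powR_ge0.
rewrite E; move: (integral _ _ _) I0 H => I I0 H; clear mg gM E.
have p1 : 0 <= p^-1 by rewrite invr_ge0 ltW.
have I1 : I \in `[0, +oo]%E by rewrite in_itv /= I0 leey.
have B0 : 0 <= M `^ p * L by rewrite mulr_ge0 ?powR_ge0 // ltW.
have B1 : (M `^ p * L)%:E \in `[0, +oo]%E by rewrite in_itv /= leey lee_fin B0.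
apply: (le_trans (gt0_ler_poweR p1 I1 B1 H)).
rewrite poweR_EFin lee_fin powRM ?powR_ge0 ?(ltW L0) //.
by rewrite -powRrM mulfV ?gt_eqF // powRr1.
Qed.

Lemma bounded_Lp L p M g : 0 < L -> 0 < p -> 0 <= M ->
  measurable_fun (`]0, L[ : set (measurableTypeR R)) g ->
  {ae mu, forall x, x \in `]0, L[ -> `|g x| <= M} -> Lp L p g.
Proof.
move=> L0 p0 M0 mg gM; rewrite /Lp inE; apply/andP; split; rewrite inE /=.
  by apply/(measurable_restrictT _ _).1.
by apply: le_lt_trans (Lnorm_le L0 p0 M0 mg gM) _; rewrite ltry.
Qed.

Lemma continuous_bounded_cc a b f : a <= b -> {within `[a, b], continuous f} ->
  exists2 M, 0 <= M & forall x, a <= x <= b -> `|f x| <= M.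
Proof.
move=> ab cf.
have [|c _ H] := @EVT_max R (fun x => `|f x|) a b ab.
  by move=> x; apply: cvg_comp; [exact: cf|exact: norm_continuous].
by exists `|f c| => // x xab; apply: H; rewrite in_itv.
Qed.

Lemma continuous_Lp L p u U : 0 < L -> 0 < p -> continuous U ->
  (forall x, 0 < x < L -> u x = U x) -> Lp L p u.
Proof.
move=> L0 p0 cU uU.
have [M M0 HM] := continuous_bounded_cc (ltW L0) (continuous_subspaceT cU).
apply: (bounded_Lp L0 p0 M0).
  apply: (eq_measurable_fun U); first by move=> x; rewrite inE /= in_itv => /uU.
  by apply: measurable_funTS; exact: continuous_measurable_fun.
by apply: aeW => x; rewrite in_itv /= => xL; rewrite uU //; apply: HM; lra.
Qed.

Lemma C2_W2p L p u U g w : 0 < L -> 0 < p -> (forall x, 0 <= x <= L -> u x = U x) ->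
  (forall x, is_derive x (1 : R) U (g x)) -> (forall x, is_derive x (1 : R) g (w x)) ->
  continuous w -> W2p L p u.
Proof.
move=> L0 p0 uU dU dg cw.
have cU := derivable_continuous dU; have cg := derivable_continuous dg.
have uU' x : 0 < x < L -> u x = U x by move=> xL; apply: uU; lra.
split.
- apply: (@within_eq _ U); first by move=> x /uU.
  exact: continuous_subspaceT.
- exact: continuous_Lp uU'.
- exists g, w; split.
  + by apply: weak_derivative_eq (C1_weak_derivative L0 dU cg) => // x /uU'.
  + exact: continuous_Lp cg _.
  + exact: C1_weak_derivative.
  + exact: continuous_Lp cw _.
Qed.

Lemma enorm_le (z : R * R) M : `|z.1| <= M -> `|z.2| <= M -> enorm z <= 2 * M.
Proof.
move=> h1 h2; have M0 : 0 <= M by apply: le_trans h1.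
rewrite /enorm -[leRHS]ger0_norm ?mulr_ge0 // -sqrtr_sqr ler_sqrt ?sqr_ge0 // /dot.
have : z.1 ^+ 2 <= M ^+ 2 by rewrite -real_normK ?num_real // lerXn2r.
have : z.2 ^+ 2 <= M ^+ 2 by rewrite -real_normK ?num_real // lerXn2r.
rewrite !expr2; nra.
Qed.

Lemma Lp_norm_le L p M (z : R -> R * R) : 0 < L -> 0 < p -> 0 <= M ->
  measurable_fun (`]0, L[ : set (measurableTypeR R)) (fst \o z) ->
  measurable_fun (`]0, L[ : set (measurableTypeR R)) (snd \o z) ->
  {ae mu, forall x, x \in `]0, L[ -> `|(z x).1| <= M /\ `|(z x).2| <= M} ->
  (Lp_norm L p z <= (2 * M * L `^ p^-1)%:E)%E.
Proof.
move=> L0 p0 M0 m1 m2 zM; apply: Lnorm_le => //; first by rewrite mulr_ge0.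
  have ms : measurable_fun setT (@Num.sqrt R).
    exact: continuous_measurable_fun (@sqrt_continuous R).
  apply: (measurableT_comp ms).
  by apply: measurable_funD; apply: measurable_funM.
apply: ae_imply zM => x h /h [h1 h2].
by rewrite ger0_norm ?sqrtr_ge0 //; exact: enorm_le.
Qed.

(** Neighbourhoods for the W^{2,p} norm are entered through C^2 closeness. Each of the three
    summands is at most [2 M L^(1/p)]; the 7 makes their sum [6 e / 7]. *)
Lemma W2p_norm_small L p e : 0 < L -> 0 < p -> 0 < e ->
  exists2 M, 0 < M & forall (z : R -> R * R) (U1 U2 g1 g2 w1 w2 : R -> R),
    (forall x, 0 <= x <= L -> z x = (U1 x, U2 x)) ->
    (forall x, is_derive x (1 : R) U1 (g1 x)) -> (forall x, is_derive x (1 : R) U2 (g2 x)) ->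
    (forall x, is_derive x (1 : R) g1 (w1 x)) -> (forall x, is_derive x (1 : R) g2 (w2 x)) ->
    continuous w1 -> continuous w2 ->
    (forall x, 0 < x < L -> [/\ `|U1 x| <= M, `|U2 x| <= M, `|g1 x| <= M & `|g2 x| <= M] /\
      `|w1 x| <= M /\ `|w2 x| <= M) ->
    (W2p_norm L p z < e%:E)%E.
Proof.
move=> L0 p0 e0; pose B := L `^ p^-1.
have B0 : 0 < B by exact: powR_gt0.
exists (e / (7 * B)); first by rewrite divr_gt0 // mulr_gt0.
set M := e / (7 * B).
have M0 : 0 <= M by rewrite /M divr_ge0 ?mulr_ge0 // ltW.
move=> z U1 U2 g1 g2 w1 w2 zU dU1 dU2 dg1 dg2 cw1 cw2 H.
have cg1 := derivable_continuous dg1; have cg2 := derivable_continuous dg2.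
have cU1 := derivable_continuous dU1; have cU2 := derivable_continuous dU2.
have z1 x : 0 <= x <= L -> (fst \o z) x = U1 x by move=> /zU /= ->.
have z2 x : 0 <= x <= L -> (snd \o z) x = U2 x by move=> /zU /= ->.
have [[_ lv1 _] v1] := wderivE L0 z1 dU1 cg1; have [[_ lv2 _] v2] := wderivE L0 z2 dU2 cg2.
have [[_ la1 _] _ a1] := wderiv2E L0 z1 dU1 dg1 cw1.
have [[_ la2 _] _ a2] := wderiv2E L0 z2 dU2 dg2 cw2.
have meas f U : continuous U -> (forall x, 0 <= x <= L -> f x = U x) ->
    measurable_fun (`]0, L[ : set (measurableTypeR R)) f.
  move=> cU fU; apply: (eq_measurable_fun U).
    by move=> x; rewrite inE /= in_itv /= => xL; rewrite fU //; lra.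
  by apply: measurable_funTS; exact: continuous_measurable_fun.
have N1 : (Lp_norm L p z <= (2 * M * B)%:E)%E.
  apply: Lp_norm_le => //; [exact: meas z1|exact: meas z2|].
  apply: aeW => x; rewrite in_itv /= => xL; have [[h1 h2 _ _] _] := H x xL.
  by rewrite zU //; lra.
have N2 : (Lp_norm L p (velocity L z) <= (2 * M * B)%:E)%E.
  apply: Lp_norm_le => //; [exact: meas v1|exact: meas v2|].
  apply: aeW => x; rewrite in_itv /= => xL; have [[_ _ h1 h2] _] := H x xL.
  by rewrite v1 ?v2 //; lra.
have N3 : (Lp_norm L p (acceleration L z) <= (2 * M * B)%:E)%E.
  apply: Lp_norm_le => //; [by case: la1|by case: la2|].
  apply: ae_imply2 a1 a2 => x h1 h2 xL; rewrite /acceleration /= h1 // h2 //.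
  by have [_ [? ?]] := H x ltac:(by move: xL; rewrite in_itv).
apply: (@le_lt_trans _ _ ((2 * M * B)%:E + (2 * M * B)%:E + (2 * M * B)%:E)%E).
  by rewrite !leeD.
rewrite -!EFinD lte_fin.
have -> : 2 * M * B + 2 * M * B + 2 * M * B = 6 * e / 7 by rewrite /M; field; rewrite gt_eqF.
lra.
Qed.

End LpBounds.

(** * Coordinates adapted to the curve *)

Section CurveForm.
Context {R : realType}.
Implicit Types (f g v w kappa theta X Y : R -> R) (a b c x y s L p : R).
Local Notation mu := (@lebesgue_measure R).

(* [gamma = P0 + (u1 + i u2) (X + i Y)] on [0, L], where [X + i Y] is the
   primitive of [exp (i theta)] and [theta] the primitive of [kappa]. *)
Record curve_form L (gamma : R -> R * R) kappa theta X Y (u1 u2 : R) : Prop := CurveForm {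
  cf_kappa : continuous kappa;
  cf_theta : forall s, is_derive s (1 : R) theta (kappa s);
  cf_X : forall s, is_derive s (1 : R) X (cos (theta s));
  cf_Y : forall s, is_derive s (1 : R) Y (sin (theta s));
  cf_X0 : X 0 = 0;
  cf_Y0 : Y 0 = 0;
  cf_u : u1 ^+ 2 + u2 ^+ 2 = 1;
  cf_gamma : forall s, 0 <= s <= L -> gamma s =
    ((gamma 0).1 + (u1 * X s - u2 * Y s), (gamma 0).2 + (u2 * X s + u1 * Y s)) }.

(** The velocity is controlled on [0, L] only. Freezing it beyond the endpoints gives a continuous
    function on the line, to which [primitive_exists] applies. *)
Lemma clamp_continuous L v : 0 <= L -> {within `[0, L], continuous v} ->
  continuous (fun s => v (Num.max 0 (Num.min L s))).
Proof.
move=> L0 /subspace_continuousP cv x.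
pose cl s := Num.max 0 (Num.min L s).
have clL s : [set` `[0, L]] (cl s).
  by rewrite /= in_itv /= /cl le_max lexx ge_max L0 /= ge_min lexx.
have lip s : `|cl x - cl s| <= `|x - s|.
  have h1 := ler_norm (x - s); have h2 := ler_norm (s - x); rewrite distrC in h2.
  rewrite ler_norml /cl.
  case: (leP L x) => ?; case: (leP L s) => ?; rewrite ?(max_r L0);
    case: (leP 0 x) => ?; case: (leP 0 s) => ?; apply/andP; split; lra.
apply/cvgrPdist_lt => e e0; have := cv _ (clL x) => /cvgrPdist_lt /(_ e e0).
rewrite near_withinE => /nbhs_ballP[d /= d0 H].
near=> s; apply: (H (cl s) _ (clL s)); rewrite /ball /=.
apply: le_lt_trans (lip s) _; near: s.
exact: (@nbhsx_ballx _ _ x d d0).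
Unshelve. all: by end_near. Qed.

Lemma clampE L s : 0 <= s <= L -> Num.max 0 (Num.min L s) = s.
Proof. by move=> /andP[s0 sL]; rewrite min_r // max_r. Qed.

Lemma antiperiodic_int (Phi : R -> R) T (n : int) x :
  (forall x, Phi (x + T) = - Phi x) -> Phi (x + T * n%:~R *+ 2) = Phi x.
Proof.
move=> h.
have hn (m : nat) y : Phi (y + T * m%:R *+ 2) = Phi y.
  elim: m => [|m IH]; first by rewrite mulr0 mul0rn addr0.
  have -> : y + T * m.+1%:R *+ 2 = y + T * m%:R *+ 2 + T + T by rewrite -natr1; ring.
  by rewrite !h opprK.
case: n => m; first exact: hn.
rewrite NegzE mulrNz mulrN mulNrn -[RHS](hn m.+1) -{2}[x](subrK (T * m.+1%:R *+ 2)).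
by rewrite !hn.
Qed.

(** [z1 + i z2] is [exp (- i theta) (v1 + i v2)], which the system keeps constant. *)
Lemma rotation_ode L v1 v2 kappa theta : 0 < L ->
  {within `[0, L], continuous v1} -> {within `[0, L], continuous v2} ->
  (forall s, is_derive s (1 : R) theta (kappa s)) ->
  (forall s, 0 < s < L -> is_derive s (1 : R) v1 (- (kappa s * v2 s))) ->
  (forall s, 0 < s < L -> is_derive s (1 : R) v2 (kappa s * v1 s)) ->
  exists u1 u2, forall s, 0 <= s <= L ->
    v1 s = u1 * cos (theta s) - u2 * sin (theta s) /\
    v2 s = u2 * cos (theta s) + u1 * sin (theta s).
Proof.
move=> L0 c1 c2 dth d1 d2.
have dc s : is_derive s (1 : R) (fun t => cos (theta t)) (- sin (theta s) * kappa s).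
  exact: is_derive1_chain.
have ds s : is_derive s (1 : R) (fun t => sin (theta t)) (cos (theta s) * kappa s).
  exact: is_derive1_chain.
have cc : {within `[0, L], continuous (fun t => cos (theta t))}.
  exact: continuous_subspaceT (derivable_continuous dc).
have cs : {within `[0, L], continuous (fun t => sin (theta t))}.
  exact: continuous_subspaceT (derivable_continuous ds).
pose z1 s := cos (theta s) * v1 s + sin (theta s) * v2 s.
pose z2 s := cos (theta s) * v2 s - sin (theta s) * v1 s.
have sub s : 0 <= s <= L -> `[0, s] `<=` (`[0, L] : set R).
  by move=> sL; apply: subset_itv; rewrite bnd_simp //; lra.
have E1 s : 0 <= s <= L -> z1 0 = z1 s.
  move=> sL; apply: derive_eq0; first by lra.
    by apply: (continuous_subspaceW (sub s sL)); apply: within_add; apply: within_mul.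
  move=> t ht; have tL : 0 < t < L by lra.
  apply: is_derive_eq (is_derive1D (is_derive1M (dc t) (d1 t tL)) (is_derive1M (ds t) (d2 t tL))) _.
  ring.
have E2 s : 0 <= s <= L -> z2 0 = z2 s.
  move=> sL; apply: derive_eq0; first by lra.
    by apply: (continuous_subspaceW (sub s sL)); apply: within_sub; apply: within_mul.
  move=> t ht; have tL : 0 < t < L by lra.
  apply: is_derive_eq (is_derive1B (is_derive1M (dc t) (d2 t tL)) (is_derive1M (ds t) (d1 t tL))) _.
  ring.
exists (z1 0), (z2 0) => s sL; rewrite (E1 s sL) (E2 s sL) /z1 /z2.
have h := cos2Dsin2 (theta s).
by split; rewrite -[LHS]mul1r -h; ring.
Qed.

(** The curvature equation holds almost everywhere and its right-hand side is continuous. Hence the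
    velocity is C^1 and solves a linear system, whose solution is a rotation of [exp (i theta)]; one
    more integration gives the curve. *)
Lemma curve_formP L p (gamma : R -> R * R) kappa : 0 < L ->
  W2p_curve L p gamma -> arclength_param L gamma -> is_signed_curvature L gamma kappa ->
  continuous kappa -> (forall s, 0 < s < L -> kappa s != 0) ->
  exists theta X Y u1 u2, theta 0 = - theta L /\ curve_form L gamma kappa theta X Y u1 u2.
Proof.
move=> L0 [W1 W2] al [_ curv] ck k0.
have [cv1 wa1 wv1] := W2p_wderiv L0 W1; have [cv2 wa2 wv2] := W2p_wderiv L0 W2.
have [cg1 _ _] := W1; have [cg2 _ _] := W2.
set v1 := wderiv L (fst \o gamma) in cv1 wa1 wv1.
set v2 := wderiv L (snd \o gamma) in cv2 wa2 wv2.
have vn s : 0 <= s <= L -> v1 s ^+ 2 + v2 s ^+ 2 = 1.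
  move=> sL; have := al s ltac:(by rewrite in_itv); rewrite /enorm /dot /= -/v1 -/v2 => e.
  rewrite !expr2 -[LHS]sqr_sqrtr ?e ?expr1n //.
  by apply: addr_ge0; rewrite -expr2 sqr_ge0.
have [K dK] := primitive_exists ck.
(* This constant makes the end angles opposite; together with the symmetry of [kappa] it will put
   the chord on the horizontal axis. *)
pose theta s := K s - (K 0 + K L) / 2.
have dth s : is_derive s (1 : R) theta (kappa s).
  by have := is_derive1B (dK s) (is_derive1_const ((K 0 + K L) / 2) s); rewrite subr0.
have thE : theta 0 = - theta L by rewrite /theta; lra.
have cl1 := clamp_continuous (ltW L0) cv1; have cl2 := clamp_continuous (ltW L0) cv2.
pose g1 s := - (kappa s * v2 (Num.max 0 (Num.min L s))).
pose g2 s := kappa s * v1 (Num.max 0 (Num.min L s)).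
have cg1' : continuous g1.
  by move=> s; apply: cvgN; apply: cvgM; [exact: ck|exact: cl2].
have cg2' : continuous g2 by move=> s; apply: cvgM; [exact: ck|exact: cl1].
have g1E s : 0 < s < L -> g1 s = - (kappa s * v2 s).
  by move=> sL; rewrite /g1 clampE //; lra.
have g2E s : 0 < s < L -> g2 s = kappa s * v1 s.
  by move=> sL; rewrite /g2 clampE //; lra.
have [G1 dG1] := primitive_exists cg1'; have [G2 dG2] := primitive_exists cg2'.
have [c1 V1] : exists c, forall x, 0 <= x <= L -> v1 x = G1 x + c.
  apply: (weak_derivative_primitive L0 cv1 wa1 _ dG1 cg1').
  apply: ae_imply curv => s h sL; have := h sL; case=> e1 e2.
  move: sL; rewrite in_itv /= => /g1E ->.
  by rewrite e1 /GRing.scale /= mulrN.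
have [c2 V2] : exists c, forall x, 0 <= x <= L -> v2 x = G2 x + c.
  apply: (weak_derivative_primitive L0 cv2 wa2 _ dG2 cg2').
  apply: ae_imply curv => s h sL; have := h sL; case=> e1 e2.
  by move: sL; rewrite in_itv /= => /g2E ->; rewrite e2.
have dv1 s : 0 < s < L -> is_derive s (1 : R) v1 (- (kappa s * v2 s)).
  move=> sL; rewrite -g1E // -[g1 s]addr0.
  apply: (near_eq_is_derive _ (is_derive1D (dG1 s) (is_derive1_const c1 s))).
  near=> t; have : t \in `]0, L[ by near: t; apply: near_in_itvoo; rewrite in_itv.
  by rewrite in_itv /= => tL; rewrite V1 //; lra.
have dv2 s : 0 < s < L -> is_derive s (1 : R) v2 (kappa s * v1 s).
  move=> sL; rewrite -g2E // -[g2 s]addr0.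
  apply: (near_eq_is_derive _ (is_derive1D (dG2 s) (is_derive1_const c2 s))).
  near=> t; have : t \in `]0, L[ by near: t; apply: near_in_itvoo; rewrite in_itv.
  by rewrite in_itv /= => tL; rewrite V2 //; lra.
have [u1 [u2 vE]] := rotation_ode L0 cv1 cv2 dth dv1 dv2.
have L2 : 0 < L / 2 < L by lra.
have L2' : 0 <= L / 2 <= L by lra.
(* Excludes the default value of [wderiv]: if [v1] were identically 0, its derivative [- kappa v2]
   would vanish at [L / 2], where [kappa] does not, so [v2] would vanish there too, against unit
   speed. *)
have {}wv1 : is_weak_derivative L (fst \o gamma) v1.
  case: wv1 => [h|v10]; first exact: h.
  have := dv1 _ L2; rewrite v10 => -[_].
  rewrite (derive_val (f := cst 0)) => /esym/eqP; rewrite oppr_eq0 mulf_eq0.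
  rewrite (negbTE (k0 _ L2)) /= => /eqP v20.
  by have := vn _ L2'; rewrite v20 v10 expr0n /= addr0 => /eqP; rewrite eq_sym oner_eq0.
have {}wv2 : is_weak_derivative L (snd \o gamma) v2.
  case: wv2 => [h|v20]; first exact: h.
  have := dv2 _ L2; rewrite v20 => -[_].
  rewrite (derive_val (f := cst 0)) => /esym/eqP; rewrite mulf_eq0.
  rewrite (negbTE (k0 _ L2)) /= => /eqP v10.
  by have := vn _ L2'; rewrite v20 v10 expr0n /= addr0 => /eqP; rewrite eq_sym oner_eq0.
have cth := derivable_continuous dth.
have ccos : continuous (fun s => cos (theta s)).
  by move=> s; apply: continuous_comp; [exact: cth|exact: continuous_cos].
have csin : continuous (fun s => sin (theta s)).
  by move=> s; apply: continuous_comp; [exact: cth|exact: continuous_sin].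
have [X0 dX0] := primitive_exists ccos; have [Y0 dY0] := primitive_exists csin.
pose X s := X0 s - X0 0; pose Y s := Y0 s - Y0 0.
have dX s : is_derive s (1 : R) X (cos (theta s)).
  by have := is_derive1B (dX0 s) (is_derive1_const (X0 0) s); rewrite subr0.
have dY s : is_derive s (1 : R) Y (sin (theta s)).
  by have := is_derive1B (dY0 s) (is_derive1_const (Y0 0) s); rewrite subr0.
have X00 : X 0 = 0 by exact: subrr.
have Y00 : Y 0 = 0 by exact: subrr.
exists theta, X, Y, u1, u2; split => //; split => //.
  have [e1 e2] := vE 0 ltac:(lra).
  rewrite -(vn 0 ltac:(lra)) e1 e2.
  by rewrite -[LHS]mulr1 -(cos2Dsin2 (theta 0)); ring.
have [d1 D1] : exists c, forall x, 0 <= x <= L -> (fst \o gamma) x = (u1 * X x - u2 * Y x) + c.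
  apply: (weak_derivative_primitive L0 cg1 wv1
    (g := fun s => u1 * cos (theta s) - u2 * sin (theta s))).
  - by apply: aeW => s; rewrite in_itv /= => sL; have [-> _] := vE s ltac:(lra).
  - by move=> s; apply: cvgB; apply: cvgMl_tmp; [exact: ccos|exact: csin].
have [d2 D2] : exists c, forall x, 0 <= x <= L -> (snd \o gamma) x = (u2 * X x + u1 * Y x) + c.
  apply: (weak_derivative_primitive L0 cg2 wv2
    (g := fun s => u2 * cos (theta s) + u1 * sin (theta s))).
  - by apply: aeW => s; rewrite in_itv /= => sL; have [_ ->] := vE s ltac:(lra).
  - by move=> s; apply: cvgD; apply: cvgMl_tmp; [exact: ccos|exact: csin].
move=> s sL; have := D1 s sL; have := D2 s sL; have := D1 0 ltac:(lra); have := D2 0 ltac:(lra).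
rewrite /= X00 Y00 !mulr0 subr0 addr0 !add0r => -> -> e2 e1.
by rewrite [LHS]surjective_pairing e1 e2; congr pair; rewrite addrC.
Unshelve. all: by end_near. Qed.

End CurveForm.

(** * Symmetries of the curve and cutoff functions *)

Section Symmetry.
Context {R : realType}.
Implicit Types (f g kappa theta X Y : R -> R) (a b c x y s L p : R).

Lemma derive0_const f : (forall s, is_derive s (1 : R) f 0) -> forall x y, f x = f y.
Proof.
move=> df x y; wlog xy : x y / x <= y.
  by move=> h; have [/h //|/ltW /h] := leP x y.
apply: derive_eq0 => //; exact: continuous_subspaceT (derivable_continuous df).
Qed.

(** Only [x] is confined to [a, b]: competitors evaluate [kappa] at [tau s], which may leave [0, L].
    The covering argument is therefore run with [y] free. *)
Lemma uniform_continuity f a b e : continuous f -> 0 < e ->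
  exists2 d, 0 < d & forall x y, a <= x <= b -> `|y - x| <= d -> `|f y - f x| <= e.
Proof.
move=> cf e0; have := @segment_compact R a b => /compact_near_coveringP.
move=> /(_ R (0^'+) (fun d x => forall y, `|y - x| <= d -> `|f y - f x| <= e) _) H.
have e2 : 0 < e / 2 by lra.
have /H : forall x, `[a, b]%classic x -> \forall x' \near x & i \near 0^'+,
    forall y, `|y - x'| <= i -> `|f y - f x'| <= e.
  move=> x _; have /cvgrPdist_lt /(_ _ e2) /nbhs_ballP[d /= d0 hd] := cf x.
  have d2 : 0 < d / 2 by lra.
  near=> x' i => y /= yi.
  have x'd : `|x - x'| < d / 2.
    by near: x'; exact: (@nbhsx_ballx _ _ x _ d2).
  have id : i < d / 2 by near: i; exact: nbhs_right_lt.
  have h1 : `|f x - f x'| < e / 2 by apply: hd; rewrite /ball /=; lra.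
  have h2 : `|f x - f y| < e / 2.
    apply: hd; rewrite /ball /=.
    have -> : x - y = (x - x') - (y - x') by ring.
    apply: le_lt_trans (ler_normB _ _) _; lra.
  have -> : f y - f x' = (f x - f x') - (f x - f y) by ring.
  by apply: le_trans (ler_normB _ _) _; lra.
move=> K0.
have : \forall i \near (0 : R)^'+, 0 < i /\ forall x y, a <= x <= b -> `|y - x| <= i -> `|f y - f x| <= e.
  near=> i; split; first by near: i; exact: nbhs_right_gt.
  move=> x y xab; have /(_ x) : `[a, b] `<=` (fun x => forall y, `|y - x| <= i -> `|f y - f x| <= e).
    by near: i.
  by rewrite /= in_itv; apply.
by move=> /filter_ex [d [d0 hd]]; exists d.
Unshelve. all: by end_near. Qed.

(** Since [k 0 = 0], the shift [s0] is an integer multiple of the antiperiod, so [2 s0] is a period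
    of [Phi] and the shifted function is still odd. A zero in []0, L[] would be an integer strictly
    between 0 and 1, times [L]. *)
Lemma half_fold_kappa L (gamma : R -> R * R) : 0 < L ->
  half_fold_well_periodic 1 L gamma -> exists kappa,
  [/\ continuous kappa, is_signed_curvature L gamma kappa,
      forall s, kappa (- s) = - kappa s, forall s, kappa (s + L) = - kappa s &
      forall s, 0 < s < L -> kappa s != 0].
Proof.
move=> L0 [_ [k [T [[[_ ck [mk hk]] [s0 [Phi [kPhi [cPhi oddPhi T0 antiPhi zPhi]]]]] k00 TE]]]].
rewrite divr1 in TE; rewrite {}TE in T0 antiPhi zPhi.
have z0 : [set x | Phi x = 0] (- s0).
  by rewrite /= -k00 kPhi ?sub0r // in_itv /= lexx ltW.
move: z0; rewrite zPhi => -[n _ s0E].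
have kE s : 0 <= s <= L -> k s = Phi (s - s0) by move=> sL; apply: kPhi; rewrite in_itv.
exists (fun s => Phi (s - s0)); split.
- by move=> s; apply: continuous_comp; [apply: cvgB; [exact: cvg_id|exact: cvg_cst]|exact: cPhi].
- split.
    apply: eq_measurable_fun mk => s; rewrite inE /= in_itv /= => sL; apply: kE; lra.
  apply: ae_imply hk => s h sL; rewrite h // kE //.
  by move: sL; rewrite in_itv /=; lra.
- move=> s; rewrite -[in RHS](antiperiodic_int (- n) _ antiPhi).
  by rewrite -oddPhi rmorphN mulrN s0E; congr Phi; ring.
- by move=> s; rewrite -antiPhi; congr Phi; ring.
- move=> s sL; apply/eqP => h.
  have : [set x | Phi x = 0] (s - s0) by [].
  rewrite zPhi => -[m _]; rewrite -s0E => /eqP; rewrite -subr_eq -mulrBr -rmorphB /=.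
  move=> /eqP e; move: sL; rewrite -e pmulr_rgt0 // gtr_pMr // ltr0z ltrz1.
  by rewrite gtz0_ge1 => /andP[/le_lt_trans q1 /q1]; rewrite ltxx.
Qed.

(** Oddness and antiperiodicity give [kappa (L - s) = kappa s], hence [theta (L - s) = - theta s] by
    the choice of the end angles. Then [Y (L - s) - Y s] is constant, and its values at 0 and [L]
    are [Y L] and [- Y L]. *)
Lemma curve_form_symmetry L (gamma : R -> R * R) kappa theta X Y u1 u2 :
  curve_form L gamma kappa theta X Y u1 u2 ->
  (forall s, kappa (- s) = - kappa s) -> (forall s, kappa (s + L) = - kappa s) ->
  theta 0 = - theta L ->
  [/\ forall s, theta (s + L) = - theta s, forall s, X (s + L) = X L + X s,
      forall s, Y (s + L) = - Y s & Y L = 0].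
Proof.
move=> [_ dth dX dY X0 Y0 _ _] odd anti th0.
have dshift f df : (forall s, is_derive s (1 : R) f (df s)) ->
    forall s, is_derive s (1 : R) (fun t => f (t + L)) (df (s + L)).
  move=> d s; have dsh := is_derive1D (is_derive_id s (1 : R)) (is_derive1_const L s).
  by have := @is_derive1_chain R f (fun t => t + L) s _ _ (d _) dsh; rewrite addr0 mulr1.
have drefl f df : (forall s, is_derive s (1 : R) f (df s)) ->
    forall s, is_derive s (1 : R) (fun t => f (L - t)) (- df (L - s)).
  move=> d s; have dsh := is_derive1B (is_derive1_const L s) (is_derive_id s (1 : R)).
  by have := @is_derive1_chain R f (fun t => L - t) s _ _ (d _) dsh; rewrite sub0r mulrN1.
have thS s : theta (s + L) = - theta s.
  apply/eqP; rewrite -addr_eq0; apply/eqP.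
  have -> : theta (s + L) + theta s = theta (0 + L) + theta 0.
    apply: (derive0_const (f := fun t => theta (t + L) + theta t)) => t.
    by have := is_derive1D (dshift _ _ dth t) (dth t); rewrite anti addNr.
  by rewrite add0r th0 subrr.
have thR s : theta (L - s) = - theta s.
  apply/eqP; rewrite -addr_eq0; apply/eqP.
  have -> : theta (L - s) + theta s = theta (L - 0) + theta 0.
    apply: (derive0_const (f := fun t => theta (L - t) + theta t)) => t.
    have := is_derive1D (drefl _ _ dth t) (dth t).
    by rewrite [L - t]addrC anti odd opprK addNr.
  by rewrite subr0 th0 subrr.
have YL : Y L = 0.
  have H s : Y (L - s) - Y s = Y (L - 0) - Y 0.
    apply: (derive0_const (f := fun t => Y (L - t) - Y t)) => t.
    have := is_derive1B (drefl _ _ dY t) (dY t).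
    by rewrite thR sinN opprK subrr.
  by have := H L; rewrite subrr subr0 Y0; lra.
split => // s.
- apply/eqP; rewrite -subr_eq; apply/eqP.
  have -> : X (s + L) - X s = X (0 + L) - X 0; last by rewrite add0r X0 subr0.
  apply: (derive0_const (f := fun t => X (t + L) - X t)) => t.
  have := is_derive1B (dshift _ _ dX t) (dX t).
  by rewrite thS cosN subrr.
- apply/eqP; rewrite -addr_eq0; apply/eqP.
  have -> : Y (s + L) + Y s = Y (0 + L) + Y 0; last by rewrite add0r Y0 addr0.
  apply: (derive0_const (f := fun t => Y (t + L) + Y t)) => t.
  have := is_derive1D (dshift _ _ dY t) (dY t).
  by rewrite thS sinN addNr.
Qed.

(** [B] spreads a jump of arclength over []lo, hi[] and [chi] is the resulting change of speed. To
    first order only its integral 1 matters; the height [M] just limits the size of the jump. *)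
Lemma cutoff_exists lo hi : lo < hi -> exists (B chi : R -> R) M,
  [/\ continuous chi, forall s, is_derive s (1 : R) B (chi s), forall s, 0 <= chi s <= M,
      forall s, chi s != 0 -> lo < s < hi &
      (forall s, s <= lo -> B s = 0) /\ (forall s, hi <= s -> B s = 1)].
Proof.
move=> lh; pose rho : R -> R := bump1 lo hi 1.
have srho : smooth rho by apply: bump_smooth.
have crho := smooth_continuous srho.
have [G dG] := primitive_exists crho.
have cG := derivable_continuous dG.
have m0 : 0 < G hi - G lo.
  rewrite subr_gt0; apply: (gt0_derive_lt lh _ (fun x _ => dG x)).
    exact: continuous_subspaceT.
  by move=> x xl; rewrite /rho bump1E xl expR_gt0.
set m := G hi - G lo in m0.
exists (fun s => m^-1 * (G s - G lo)), (fun s => m^-1 * rho s), m^-1; split.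
- by move=> s; apply: cvgMl_tmp; exact: crho.
- move=> s; apply: is_derive1Z.
  by have := is_derive1B (dG s) (is_derive1_const (G lo) s); rewrite subr0.
- move=> s; rewrite mulr_ge0 ?bump1_ge0 ?invr_ge0 ?(ltW m0) //=.
  by rewrite ler_piMr ?invr_ge0 ?(ltW m0) // bump1_le1.
- by move=> s; rewrite mulf_eq0 negb_or => /andP[_ /bump_support].
- have zero s : ~ (lo < s < hi) -> is_derive s (1 : R) G 0.
    move=> h; have <- : rho s = 0; last exact: dG.
    by rewrite /rho bump1E; case: ifP.
  split=> s sl.
    rewrite (_ : G s = G lo) ?subrr ?mulr0 //.
    apply: derive_eq0 => //; first exact: continuous_subspaceT.
    by move=> t ht; apply: zero; lra.
  rewrite (_ : G s = G hi); first by rewrite mulVf // gt_eqF.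
  apply/esym; apply: derive_eq0 => //; first exact: continuous_subspaceT.
  by move=> t ht; apply: zero; lra.
Qed.

End Symmetry.

(** * Curves with reparametrized tangent angle *)

Section Competitor.
Context {R : realType}.
Implicit Types (g kappa theta X Y tau r k : R -> R) (a b c x y s L p : R).
Local Notation mu := (@lebesgue_measure R).

Lemma measurable_comp_norm (f : R -> \bar R) (D : set (measurableTypeR R)) k :
  measurable_fun (`[0, +oo[ : set R) f -> measurable_fun D k ->
  measurable_fun D (fun s => f `|k s|).
Proof.
move=> mf mk.
apply: (@measurable_comp _ _ _ _ _ _ (`[0, +oo[ : set R) f _ (fun s => `|k s|)) => //.
- by move=> _ [s _ <-]; rewrite /= in_itv /= normr_ge0.
- exact: (measurableT_comp (@normr_measurable R setT) mk).
Qed.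

(** [signed_curvature] is a choice, but as the velocity has norm 1, two signed curvatures agree
    wherever both satisfy the equation, hence almost everywhere. *)
Lemma energyE (f : R -> \bar R) L gamma k : measurable_fun (`[0, +oo[ : set R) f ->
  arclength_param L gamma -> is_signed_curvature L gamma k ->
  energy L f gamma = (\int[mu]_(s in `]0%R, L[) f `|k s|%R)%E.
Proof.
move=> mf al hk; have [mk ek] := hk.
have [mk' ek'] : is_signed_curvature L gamma (signed_curvature L gamma).
  by apply: (xgetPex (cst 0)); exists k.
apply: ae_eq_integral.
- exact: measurable_itv.
- exact: measurable_comp_norm.
- exact: measurable_comp_norm.
apply: ae_imply2 ek ek' => s h1 h2 sL.
have e := h1 sL; rewrite h2 // in e.
have := al s; rewrite {1}in_itv /=.
move: sL; rewrite /= in_itv /= => sL /(_ ltac:(lra)).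
move: e; rewrite /enorm /dot.
case: (velocity L gamma s) => v1 v2 /= [e1 e2] n.
have {}n : v1 * v1 + v2 * v2 = 1.
  rewrite -[LHS]sqr_sqrtr ?n ?expr1n //.
  by apply: addr_ge0; rewrite -expr2 sqr_ge0.
congr (f `| _ |); rewrite -[LHS]mulr1 -[RHS]mulr1 -n.
rewrite /GRing.scale /= !mulrN in e1 e2; move/oppr_inj: e1 => e1.
by rewrite !mulrDr !mulrA e1 e2.
Qed.

Lemma rotation_diff_le (a1 a2 b1 b2 c s c' s' E d : R) :
  `|a1 - b1| <= E -> `|a2 - b2| <= E -> `|b1| <= 1 -> `|b2| <= 1 ->
  `|c'| <= 1 -> `|s'| <= 1 -> `|c' - c| <= d -> `|s' - s| <= d ->
  `|(a1 * c' + a2 * s') - (b1 * c + b2 * s)| <= 2 * E + 2 * d.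
Proof.
move=> h1 h2 h3 h4 h5 h6 h7 h8.
have -> : (a1 * c' + a2 * s') - (b1 * c + b2 * s) =
  ((a1 - b1) * c' + (a2 - b2) * s') + (b1 * (c' - c) + b2 * (s' - s)) by ring.
have P (x y m : R) : `|x| <= m -> `|y| <= 1 -> `|x * y| <= m.
  by move=> hx hy; rewrite normrM -[m]mulr1 ler_pM.
have q1 := P _ _ _ h1 h5; have q2 := P _ _ _ h2 h6.
have q3 := P _ _ _ h7 h3; have q4 := P _ _ _ h8 h4.
rewrite mulrC in q3; rewrite mulrC in q4.
apply: le_trans (ler_normD _ _) _.
apply: le_trans (lerD (ler_normD _ _) (ler_normD _ _)) _; lra.
Qed.

Lemma norm_le1_of_sq (u1 u2 : R) : u1 ^+ 2 + u2 ^+ 2 = 1 -> `|u1| <= 1 /\ `|u2| <= 1.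
Proof.
move=> h; rewrite !ler_norml; split; apply/andP; split; nra.
Qed.

(** The coefficients are the real and imaginary parts of [(u1 + i u2) (a - i b) / D]; multiplied by
    [a + i b] of modulus [|D|] this gives [(u1 + i u2) D]. *)
Lemma rotate_onto (u1 u2 a b D : R) : D != 0 -> a ^+ 2 + b ^+ 2 = D ^+ 2 ->
  (u1 * a + u2 * b) / D * a - (u2 * a - u1 * b) / D * b = u1 * D /\
  (u2 * a - u1 * b) / D * a + (u1 * a + u2 * b) / D * b = u2 * D.
Proof.
move=> D0 h; split.
  have -> : (u1 * a + u2 * b) / D * a - (u2 * a - u1 * b) / D * b =
    u1 * (a ^+ 2 + b ^+ 2) / D by field.
  by rewrite h; field.
have -> : (u2 * a - u1 * b) / D * a + (u1 * a + u2 * b) / D * b =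
  u2 * (a ^+ 2 + b ^+ 2) / D by field.
by rewrite h; field.
Qed.

(** Composing the tangent angle with [tau] keeps the speed 1 and multiplies the curvature
    [kappa (tau s)] by [r]. If the chord has the right length, the rotation [w1 + i w2] puts the
    second endpoint in place. *)
Lemma competitor_in_A_pin L p (gamma : R -> R * R) kappa theta X Y u1 u2 tau r :
  0 < L -> 0 < p -> curve_form L gamma kappa theta X Y u1 u2 -> Y L = 0 -> X L != 0 ->
  continuous r -> (forall s, is_derive s (1 : R) tau (r s)) ->
  let A := primitive (fun s => cos (theta (tau s))) in
  let B := primitive (fun s => sin (theta (tau s))) in
  A L ^+ 2 + B L ^+ 2 = X L ^+ 2 ->
  let w1 := (u1 * A L + u2 * B L) / X L in
  let w2 := (u2 * A L - u1 * B L) / X L in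
  let eta s := ((gamma 0).1 + (w1 * A s - w2 * B s), (gamma 0).2 + (w2 * A s + w1 * B s)) in
  [/\ A_pin L p (gamma 0) (gamma L) eta, arclength_param L eta,
      is_signed_curvature L eta (fun s => kappa (tau s) * r s) &
      [/\ forall s, is_derive s (1 : R) A (cos (theta (tau s))),
          forall s, is_derive s (1 : R) B (sin (theta (tau s))),
          forall s, is_derive s (1 : R) (fun t => cos (theta (tau t))) (- sin (theta (tau s)) * (kappa (tau s) * r s)) &
          forall s, is_derive s (1 : R) (fun t => sin (theta (tau t))) (cos (theta (tau s)) * (kappa (tau s) * r s))]].
Proof.
move=> L0 p0 [ck dth dX dY X0 Y0 u12 gE] YL XL cr dtau A B AB w1 w2 eta.
have ctau := derivable_continuous dtau.
have dtt s : is_derive s (1 : R) (fun t => theta (tau t)) (kappa (tau s) * r s).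
  exact: (is_derive1_chain (dth (tau s)) (dtau s)).
have dc s : is_derive s (1 : R) (fun t => cos (theta (tau t))) (- sin (theta (tau s)) * (kappa (tau s) * r s)).
  exact: (is_derive1_chain (is_derive_cos (theta (tau s))) (dtt s)).
have ds s : is_derive s (1 : R) (fun t => sin (theta (tau t))) (cos (theta (tau s)) * (kappa (tau s) * r s)).
  exact: (is_derive1_chain (is_derive_sin (theta (tau s))) (dtt s)).
have dA := is_derive_primitive (derivable_continuous dc).
have dB := is_derive_primitive (derivable_continuous ds).
have ck' : continuous (fun s => kappa (tau s) * r s).
  by move=> s; apply: cvgM; [apply: continuous_comp; [exact: ctau|exact: ck]|exact: cr].
have cc := derivable_continuous dc; have cs := derivable_continuous ds.
have w12 : w1 ^+ 2 + w2 ^+ 2 = 1.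
  rewrite /w1 /w2 !expr_div_n -mulrDl.
  have -> : (u1 * A L + u2 * B L) ^+ 2 + (u2 * A L - u1 * B L) ^+ 2 =
    (u1 ^+ 2 + u2 ^+ 2) * (A L ^+ 2 + B L ^+ 2) by ring.
  by rewrite u12 AB mul1r mulfV // sqrf_eq0.
pose g1 s := w1 * cos (theta (tau s)) - w2 * sin (theta (tau s)).
pose g2 s := w2 * cos (theta (tau s)) + w1 * sin (theta (tau s)).
pose h1 s := - (kappa (tau s) * r s * g2 s).
pose h2 s := kappa (tau s) * r s * g1 s.
have d1 s : is_derive s (1 : R) (fst \o eta) (g1 s).
  have := is_derive1D (is_derive1_const (gamma 0).1 s)
    (is_derive1B (is_derive1Z w1 (dA s)) (is_derive1Z w2 (dB s))).
  by rewrite add0r.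
have d2 s : is_derive s (1 : R) (snd \o eta) (g2 s).
  have := is_derive1D (is_derive1_const (gamma 0).2 s)
    (is_derive1D (is_derive1Z w2 (dA s)) (is_derive1Z w1 (dB s))).
  by rewrite add0r.
have dg1 s : is_derive s (1 : R) g1 (h1 s).
  apply: (is_derive_eq (is_derive1B (is_derive1Z w1 (dc s)) (is_derive1Z w2 (ds s)))).
  by rewrite /h1 /g2; ring.
have dg2 s : is_derive s (1 : R) g2 (h2 s).
  apply: (is_derive_eq (is_derive1D (is_derive1Z w2 (dc s)) (is_derive1Z w1 (ds s)))).
  by rewrite /h2 /g1; ring.
have cg1 := derivable_continuous dg1; have cg2 := derivable_continuous dg2.
have ch1 : continuous h1 by move=> s; apply: cvgN; apply: cvgM; [exact: ck'|exact: cg2].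
have ch2 : continuous h2 by move=> s; apply: cvgM; [exact: ck'|exact: cg1].
have [_ v1] := wderivE L0 (fun x _ => erefl) d1 cg1.
have [_ v2] := wderivE L0 (fun x _ => erefl) d2 cg2.
have [_ _ a1] := wderiv2E L0 (fun x _ => erefl) d1 dg1 ch1.
have [_ _ a2] := wderiv2E L0 (fun x _ => erefl) d2 dg2 ch2.
have al : arclength_param L eta.
  move=> s; rewrite in_itv /= => sL; rewrite /enorm /dot /velocity /= v1 // v2 //.
  have -> : g1 s * g1 s + g2 s * g2 s = (w1 ^+ 2 + w2 ^+ 2) *
     (cos (theta (tau s)) ^+ 2 + sin (theta (tau s)) ^+ 2) by rewrite /g1 /g2; ring.
  by rewrite w12 cos2Dsin2 mulr1 sqrtr1.
split=> //.
- split => //.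
  + by split; [exact: (C2_W2p L0 p0 (fun x _ => erefl) d1 dg1 ch1)
              |exact: (C2_W2p L0 p0 (fun x _ => erefl) d2 dg2 ch2)].
  + by rewrite /eta /A /B !primitive0 !mulr0 subr0 !addr0 -surjective_pairing.
  + rewrite (gE L) ?lexx ?(ltW L0) // YL !mulr0 subr0 addr0 /eta.
    by have [-> ->] := rotate_onto u1 u2 XL AB.
- split; first by apply: measurable_funTS; exact: continuous_measurable_fun.
  apply: ae_imply2 a1 a2 => s e1 e2 sL.
  have sL' : 0 <= s <= L by move: sL; rewrite in_itv => /andP[/ltW -> /ltW ->].
  rewrite /acceleration /velocity (e1 sL) (e2 sL) (v1 s sL') (v2 s sL').
  by congr pair; rewrite /h1 /GRing.scale /= mulrN.
Qed.

End Competitor.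

(** * Competitors of a local minimizer *)

Section LocalMinimizer.
Context {R : realType}.
Implicit Types (g kappa theta X Y tau r k : R -> R) (a b c x y s L p : R).
Local Notation mu := (@lebesgue_measure R).

(** [C d] bounds the error of the velocity: [2 d / D] for each coefficient of the rotation and [K d]
    for the cosine and the sine of the angle, all counted twice. [Q] dominates every coefficient of
    [d]. *)
Lemma closeness_constants (m K D L d1 : R) :
  0 < m -> 0 <= K -> 0 < D -> 0 < L -> 0 < d1 ->
  let C := 4 / D + 2 * K in
  exists d, [/\ 0 < d, d <= 1 & d <= d1] /\
    [/\ C * d <= m, C * d * L <= m, K * d <= m / 4, K * (C * d) <= m / 4 & 0 <= C * d].
Proof.
move=> m0 K0 D0 L0 d10 C.
have C0 : 0 <= C by rewrite addr_ge0 ?divr_ge0 ?mulr_ge0 // ltW.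
clearbody C; pose Q := (C + 1) * (L + 1) * (K + 1).
have CL0 : 0 <= C * L by apply: mulr_ge0 => //; lra.
have CK0 : 0 <= C * K by apply: mulr_ge0.
have LK0 : 0 <= L * K by apply: mulr_ge0 => //; lra.
have CLK0 : 0 <= C * L * K by apply: mulr_ge0.
have QE : Q = C * L * K + C * L + C * K + C + L * K + L + K + 1 by rewrite /Q; ring.
have Q0 : 0 < Q by lra.
pose d := Num.min (Num.min 1 d1) (m / (4 * Q)).
have d0 : 0 < d.
  rewrite !lt_min ltr01 d10 /=; apply: divr_gt0 => //; exact: mulr_gt0.
have dQ : d * Q <= m / 4.
  have : d <= m / (4 * Q) by rewrite /d ge_min lexx orbT.
  by rewrite ler_pdivlMr ?mulr_gt0 //; lra.
have le z : z <= Q -> z * d <= m / 4.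
  by move=> zQ; apply: le_trans dQ; rewrite mulrC ler_wpM2l // ltW.
have e1 := le C ltac:(lra); have e2 := le (C * L) ltac:(lra).
have e3 := le K ltac:(lra); have e4 := le (C * K) ltac:(lra).
exists d; split; split.
- exact: d0.
- by rewrite /d !ge_min lexx.
- by rewrite /d !ge_min lexx orbT.
- by clear -e1 m0; lra.
- by rewrite mulrAC; clear -e2 m0; lra.
- exact: e3.
- by rewrite mulrCA mulrA.
- by rewrite mulr_ge0 // ltW.
Qed.

(** Turns local minimality into an inequality about reparametrizations [tau] close to the identity
    in C^1, with no Sobolev norm left. *)
Lemma local_minimizer_competitor L p P0 P1 (f : R -> \bar R) (gamma : R -> R * R)
    kappa theta X Y u1 u2 :
  0 < L -> 0 < p -> measurable_fun (`[0, +oo[ : set R) f ->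
  curve_form L gamma kappa theta X Y u1 u2 -> Y L = 0 -> X L != 0 ->
  is_signed_curvature L gamma kappa ->
  local_minimizer L p (energy L f) (A_pin L p P0 P1) gamma ->
  exists2 d, 0 < d & forall tau r,
    continuous r -> (forall s, is_derive s (1 : R) tau (r s)) ->
    (forall s, 0 <= s <= L -> `|tau s - s| <= d /\ `|r s - 1| <= d) ->
    let A := primitive (fun s => cos (theta (tau s))) in
    let B := primitive (fun s => sin (theta (tau s))) in
    `|A L - X L| <= d -> `|B L| <= d -> A L ^+ 2 + B L ^+ 2 = X L ^+ 2 ->
    (\int[mu]_(s in `]0%R, L[) f `|kappa s|%R <=
     \int[mu]_(s in `]0%R, L[) f `|kappa (tau s) * r s|%R)%E.
Proof.
move=> L0 p0 mf cf YL XL sck [Ag [e e0 He]].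
have [ck dth dX dY X0 Y0 u12 gE] := cf.
have [_ alg g0 gL] := Ag.
have [m m0 Hm] := W2p_norm_small L0 p0 e0.
(* Since [d <= 1], the values [tau s] stay in [[- 1, L + 1]]. *)
have [K K0 HK] := @continuous_bounded_cc R (- 1) (L + 1) kappa ltac:(lra) (continuous_subspaceT ck).
(* The error of the acceleration is at most [2 (K d + m / 8) + K C d <= 2 (m / 4 + m / 8) + m / 4 =
   m]. *)
have m8 : 0 < m / 8 by lra.
have [d1 d10 Hd1] := @uniform_continuity R kappa 0 L (m / 8) ck m8.
pose D := `|X L|; have D0 : 0 < D by rewrite normr_gt0.
pose C := 4 / D + 2 * K.
have [d [[d0 dle1 dled1] [b1 b2 b3 b4 Cd0]]] := closeness_constants m0 K0 D0 L0 d10.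
rewrite -/C in b1 b2 b4 Cd0.
exists d; first exact: d0.
move=> tau r cr dtau close A B hA hB AB.
have [Aeta aleta sceta [dA dB dc ds]] := competitor_in_A_pin L0 p0 cf YL XL cr dtau AB.
move: Aeta aleta sceta; rewrite -/A -/B.
set w1 := _ / X L; set w2 := (_ - _) / X L; set eta := fun s => _.
move=> Aeta aleta sceta.
rewrite -(energyE mf alg sck) -(energyE mf aleta sceta).
apply: He; first by rewrite -g0 -gL; exact: Aeta.
have [u1le u2le] := norm_le1_of_sq u12.
pose E := 2 * d / D.
have wu1 : `|w1 - u1| <= E.
  have -> : w1 - u1 = (u1 * (A L - X L) + u2 * B L) / X L by rewrite /w1; field.
  rewrite normrM normfV -/D ler_pM2r ?invr_gt0 //.
  apply: le_trans (ler_normD _ _) _; rewrite !normrM mulr2n mulrDl mul1r.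
  by apply: lerD; rewrite -[leRHS]mul1r ler_pM.
have wu2 : `|w2 - u2| <= E.
  have -> : w2 - u2 = (u2 * (A L - X L) - u1 * B L) / X L by rewrite /w2; field.
  rewrite normrM normfV -/D ler_pM2r ?invr_gt0 //.
  apply: le_trans (ler_normB _ _) _; rewrite !normrM mulr2n mulrDl mul1r.
  by apply: lerD; rewrite -[leRHS]mul1r ler_pM.
have thle s : 0 <= s <= L -> `|theta (tau s) - theta s| <= K * d.
  move=> sL; have [t1 _] := close s sL; have := t1; rewrite ler_norml => /andP[t2 t3].
  have kb z : - 1 <= z <= L + 1 -> `|kappa z| <= K by exact: HK.
  apply: (@le_trans _ _ (K * `|tau s - s|)); last by rewrite ler_wpM2l.
  have [ts|st] := leP (tau s) s.
    rewrite distrC (distrC (tau s)) [X in _ * X]ger0_norm ?subr_ge0 //.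
    apply: (derive_norm_le ts (fun x _ => dth x)) => x xs; apply: kb.
    by clear -xs t2 t3 sL dle1; lra.
  rewrite [X in _ * X]ger0_norm ?subr_ge0 ?(ltW st) //.
  apply: (derive_norm_le (ltW st) (fun x _ => dth x)) => x xs; apply: kb.
  by clear -xs t2 t3 sL dle1; lra.
have kle s : 0 <= s <= L -> `|kappa (tau s) * r s - kappa s| <= K * d + m / 8.
  move=> sL; have [t1 t2] := close s sL; have := t1; rewrite ler_norml => /andP[t3 t4].
  have -> : kappa (tau s) * r s - kappa s =
    kappa (tau s) * (r s - 1) + (kappa (tau s) - kappa s) by ring.
  apply: le_trans (ler_normD _ _) _; apply: lerD.
    by rewrite normrM ler_pM //; apply: HK; clear -t3 t4 sL dle1; lra.
  by apply: Hd1 => //; exact: le_trans dled1.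
have cle s : 0 <= s <= L -> `|cos (theta (tau s)) - cos (theta s)| <= K * d.
  by move=> /thle h; apply: le_trans (cos_lip _ _) h.
have sle s : 0 <= s <= L -> `|sin (theta (tau s)) - sin (theta s)| <= K * d.
  by move=> /thle h; apply: le_trans (sin_lip _ _) h.
have c1 x : `|cos x| <= 1 :> R by rewrite ler_norml cos_geN1 cos_le1.
have s1 x : `|sin x| <= 1 :> R by rewrite ler_norml sin_geN1 sin_le1.
have EC : 2 * E + 2 * (K * d) = C * d by rewrite /E /C; field; rewrite gt_eqF.
have rot a1 a2 z1 z2 s : `|a1 - z1| <= E -> `|a2 - z2| <= E -> `|z1| <= 1 -> `|z2| <= 1 ->
    0 <= s <= L ->
    `|(a1 * cos (theta (tau s)) + a2 * sin (theta (tau s))) -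
      (z1 * cos (theta s) + z2 * sin (theta s))| <= C * d.
  by move=> h1 h2 h3 h4 sL; rewrite -EC; apply: rotation_diff_le => //; [exact: cle|exact: sle].
have nE (x y : R) : `|x - y| <= E -> `|- x - - y| <= E by rewrite -opprD normrN.
have n1 (x : R) : `|x| <= 1 -> `|- x| <= 1 by rewrite normrN.
pose U1 s := (w1 * A s - w2 * B s) - (u1 * X s - u2 * Y s).
pose U2 s := (w2 * A s + w1 * B s) - (u2 * X s + u1 * Y s).
pose G1 s := (w1 * cos (theta (tau s)) - w2 * sin (theta (tau s))) -
  (u1 * cos (theta s) - u2 * sin (theta s)).
pose G2 s := (w2 * cos (theta (tau s)) + w1 * sin (theta (tau s))) -
  (u2 * cos (theta s) + u1 * sin (theta s)).
pose W1 s := - ((kappa (tau s) * r s) * (w2 * cos (theta (tau s)) + w1 * sin (theta (tau s)))) +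
  kappa s * (u2 * cos (theta s) + u1 * sin (theta s)).
pose W2 s := (kappa (tau s) * r s) * (w1 * cos (theta (tau s)) - w2 * sin (theta (tau s))) -
  kappa s * (u1 * cos (theta s) - u2 * sin (theta s)).
have dcos s : is_derive s (1 : R) (fun t => cos (theta t)) (- sin (theta s) * kappa s).
  exact: (is_derive1_chain (is_derive_cos (theta s)) (dth s)).
have dsin s : is_derive s (1 : R) (fun t => sin (theta t)) (cos (theta s) * kappa s).
  exact: (is_derive1_chain (is_derive_sin (theta s)) (dth s)).
have dU1 s : is_derive s (1 : R) U1 (G1 s).
  exact: (is_derive1B (is_derive1B (is_derive1Z w1 (dA s)) (is_derive1Z w2 (dB s)))
    (is_derive1B (is_derive1Z u1 (dX s)) (is_derive1Z u2 (dY s)))).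
have dU2 s : is_derive s (1 : R) U2 (G2 s).
  exact: (is_derive1B (is_derive1D (is_derive1Z w2 (dA s)) (is_derive1Z w1 (dB s)))
    (is_derive1D (is_derive1Z u2 (dX s)) (is_derive1Z u1 (dY s)))).
have dG1 s : is_derive s (1 : R) G1 (W1 s).
  apply: (is_derive_eq (is_derive1B (is_derive1B (is_derive1Z w1 (dc s)) (is_derive1Z w2 (ds s)))
    (is_derive1B (is_derive1Z u1 (dcos s)) (is_derive1Z u2 (dsin s))))).
  by rewrite /W1; ring.
have dG2 s : is_derive s (1 : R) G2 (W2 s).
  apply: (is_derive_eq (is_derive1B (is_derive1D (is_derive1Z w2 (dc s)) (is_derive1Z w1 (ds s)))
    (is_derive1D (is_derive1Z u2 (dcos s)) (is_derive1Z u1 (dsin s))))).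
  by rewrite /W2; ring.
have ctau := derivable_continuous dtau.
have cct := derivable_continuous dc; have cst := derivable_continuous ds.
have cc := derivable_continuous dcos; have cs := derivable_continuous dsin.
have ckt : continuous (fun s => kappa (tau s) * r s).
  by move=> s; apply: cvgM; [apply: continuous_comp; [exact: ctau|exact: ck]|exact: cr].
have cW1 : continuous W1.
  move=> s; apply: cvgD; [apply: cvgN; apply: cvgM; first exact: ckt|apply: cvgM; first exact: ck];
    by apply: cvgD; apply: cvgMl_tmp; [exact: cct|exact: cst] || (apply: cvgD; apply: cvgMl_tmp; [exact: cc|exact: cs]).
have cW2 : continuous W2.
  move=> s; apply: cvgB; apply: cvgM; [exact: ckt| |exact: ck|];
    by apply: cvgB; apply: cvgMl_tmp; [exact: cct|exact: cst] || (apply: cvgB; apply: cvgMl_tmp; [exact: cc|exact: cs]).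
apply: (Hm (fun s => eta s - gamma s) U1 U2 G1 G2 W1 W2) => //.
  move=> s sL; rewrite /eta (gE s sL) /U1 /U2.
  by congr pair; rewrite /=; ring.
have G1le s : 0 <= s <= L -> `|G1 s| <= C * d.
  move=> sL; have := rot w1 (- w2) u1 (- u2) s wu1 (nE _ _ wu2) u1le (n1 _ u2le) sL.
  by rewrite !mulNr.
have G2le s : 0 <= s <= L -> `|G2 s| <= C * d.
  by move=> sL; exact: (rot w2 w1 u2 u1 s wu2 wu1 u2le u1le sL).
have U10 : U1 0 = 0 by rewrite /U1 /A /B !primitive0 X0 Y0; ring.
have U20 : U2 0 = 0 by rewrite /U2 /A /B !primitive0 X0 Y0; ring.
have Ule (U G : R -> R) : (forall s, is_derive s (1 : R) U (G s)) -> U 0 = 0 ->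
    (forall s, 0 <= s <= L -> `|G s| <= C * d) -> forall s, 0 <= s <= L -> `|U s| <= m.
  move=> dU U00 Gle s sL.
  have : `|U s - U 0| <= C * d * (s - 0).
    apply: (@derive_norm_le R U G 0 s (C * d)); first by case/andP: sL.
    by move=> x xs; apply: Gle; clear -xs sL; lra.
  rewrite U00 !subr0 => h; apply: (le_trans h); apply: le_trans b2.
  by rewrite ler_wpM2l //; clear -sL; lra.
have acc (k k' x y : R) : `|k' - k| <= K * d + m / 8 -> `|k| <= K -> `|x - y| <= C * d ->
    `|x| <= 2 -> `|k' * x - k * y| <= m.
  move=> h1 h2 h3 h4.
  have -> : k' * x - k * y = (k' - k) * x + k * (x - y) by ring.
  apply: le_trans (ler_normD _ _) _; rewrite !normrM.
  have q1 := ler_pM (normr_ge0 _) (normr_ge0 _) h1 h4.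
  have q2 := ler_pM (normr_ge0 _) (normr_ge0 _) h2 h3.
  by clear -q1 q2 b3 b4; lra.
have [w1le w2le] : `|w1| <= 1 /\ `|w2| <= 1.
  apply: norm_le1_of_sq; rewrite /w1 /w2 !expr_div_n -mulrDl.
  have -> : (u1 * A L + u2 * B L) ^+ 2 + (u2 * A L - u1 * B L) ^+ 2 =
    (u1 ^+ 2 + u2 ^+ 2) * (A L ^+ 2 + B L ^+ 2) by ring.
  by rewrite u12 AB mul1r mulfV // sqrf_eq0.
have two (a1 a2 x : R) : `|a1| <= 1 -> `|a2| <= 1 -> `|a1 * cos x + a2 * sin x| <= 2.
  move=> h1 h2; apply: le_trans (ler_normD _ _) _; rewrite !normrM.
  have q1 := ler_pM (normr_ge0 _) (normr_ge0 _) h1 (c1 x).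
  have q2 := ler_pM (normr_ge0 _) (normr_ge0 _) h2 (s1 x).
  by clear -q1 q2; lra.
move=> s sL; have sL' : 0 <= s <= L by clear -sL; lra.
have kK : `|kappa s| <= K by apply: HK; clear -sL; lra.
split; first split.
- exact: (Ule U1 G1).
- exact: (Ule U2 G2).
- by apply: le_trans b1; exact: G1le.
- by apply: le_trans b1; exact: G2le.
split.
- rewrite /W1 addrC -normrN opprB; apply: acc => //; first exact: kle.
    exact: G2le.
  exact: two.
- rewrite /W2; apply: acc => //; first exact: kle.
    exact: G1le.
  by have := two w1 (- w2) (theta (tau s)) w1le (n1 _ w2le); rewrite mulNr.
Qed.

End LocalMinimizer.

(** * Strictly convex integrands *)

Section ConvexIntegrand.
Context {R : realType} (f : R -> \bar R).
Context (f_ge0 : forall x : R, 0 <= x -> (0 <= f x)%E) (fcvx : strictly_convex_nneg f).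
Implicit Types (u v w x y t a b p q : R).

Let F x := fine (f x).

(** [f x] is strictly below a mean of two values of [f], hence below [+oo]. *)
Lemma convex_fin x : 0 < x -> f x = (F x)%:E.
Proof.
move=> x0; rewrite fineK // ge0_fin_numE; last by apply: f_ge0; exact: ltW.
have := fcvx (x := x / 2) (y := 3 * x / 2) (t := 1 / 2).
have -> : (1 - 1 / 2) * (x / 2) + 1 / 2 * (3 * x / 2) = x by field.
move=> /(_ ltac:(lra) ltac:(lra) ltac:(lra) ltac:(lra)) h.
by apply: lt_le_trans h _; rewrite leey.
Qed.

Lemma F_ge0 x : 0 <= x -> 0 <= F x.
Proof. by move=> x0; apply: fine_ge0; exact: f_ge0. Qed.

Lemma F_convex u v w : 0 < u -> u < v -> v < w ->
  F v * (w - u) < F u * (w - v) + F w * (v - u).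
Proof.
move=> u0 uv vw; pose t := (v - u) / (w - u).
have wu : 0 < w - u by lra.
have t0 : 0 < t by rewrite divr_gt0 //; lra.
have t1 : t < 1 by rewrite ltr_pdivrMr //; lra.
have := fcvx (x := u) (y := w) (t := t) (ltW u0) ltac:(lra) ltac:(lra) ltac:(lra).
have -> : (1 - t) * u + t * w = v by rewrite /t; field; rewrite gt_eqF.
rewrite !convex_fin -?EFinM -?EFinD ?lte_fin; try lra.
rewrite -(ltr_pM2r wu); congr (_ < _).
by rewrite /t; field; rewrite gt_eqF.
Qed.

(* Value at [0] of the chord of [f] through [u] and [v]. *)
Definition chord0 u v := (F u * v - F v * u) / (v - u).

Lemma chord0_lt u v w : 0 < u -> u < v -> v < w -> chord0 v w < chord0 u v.
Proof.
move=> u0 uv vw; rewrite /chord0 ltr_pdivrMr ?subr_gt0 //.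
rewrite mulrAC ltr_pdivlMr ?subr_gt0 //.
have := F_convex u0 uv vw; have v0 : 0 < v by lra.
move=> h; rewrite -subr_gt0 in h; rewrite -subr_gt0.
have -> : (F u * v - F v * u) * (w - v) - (F v * w - F w * v) * (v - u) =
  v * (F u * (w - v) + F w * (v - u) - F v * (w - u)) by ring.
exact: mulr_gt0.
Qed.

Lemma below_chord t p q : 0 <= t -> t < p -> p < q ->
  (((F p * (q - t) - F q * (p - t)) / (q - p))%:E <= f t)%E.
Proof.
move=> t0 tp pq; pose s := (p - t) / (q - t).
have qt : 0 < q - t by lra.
have s0 : 0 < s by rewrite divr_gt0 //; lra.
have s1 : s < 1 by rewrite ltr_pdivrMr //; lra.
have := fcvx (x := t) (y := q) (t := s) t0 ltac:(lra) ltac:(lra) ltac:(lra).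
have -> : (1 - s) * t + s * q = p by rewrite /s; field; rewrite gt_eqF.
have := f_ge0 t0; case: (f t) => [ft _|_ _|//]; last by rewrite leey.
have p0 : 0 < p by lra.
have q0 : 0 < q by lra.
rewrite (convex_fin p0) (convex_fin q0).
rewrite -!EFinM -EFinD lte_fin lee_fin => h.
rewrite ler_pdivrMr ?subr_gt0 //.
rewrite -(ltr_pM2r qt) in h.
have e : ((1 - s) * ft + s * F q) * (q - t) = ft * (q - p) + F q * (p - t).
  by rewrite /s; field; rewrite gt_eqF.
by rewrite e in h; lra.
Qed.

(** The points [p < q < p' < q'] are 1, 2, 3 and 4 tenths of [x1], all below [x1 / 2 <= rho x]. So
    the chord through [rho x] and [x] has its intercept below [l'], that of [p'] and [q'], which is
    below [l0], that of [p] and [q]. The bound [l] is the midpoint of [l'] and [l0]: left of [p],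
    [f] is above the prolonged chord of [p] and [q], and the slope of that chord costs at most [g]
    up to [g / (S + 1)]. *)
Lemma intercept_gap x1 : 0 < x1 -> exists l l' t0,
  [/\ l' < l, 0 < t0, forall t, 0 <= t <= t0 -> (l%:E <= f t)%E &
     forall x rho, x1 <= x -> 1 / 2 <= rho <= 1 -> F (rho * x) <= rho * F x + (1 - rho) * l'].
Proof.
move=> x10.
pose p := x1 / 10; pose q := x1 / 5; pose p' := 3 * x1 / 10; pose q' := 2 * x1 / 5.
have p0 : 0 < p by rewrite /p; lra.
have pq : p < q by rewrite /p /q; lra.
have qp : q < p' by rewrite /q /p'; lra.
have pq' : p' < q' by rewrite /p' /q'; lra.
have q'x : q' < x1 / 2 by rewrite /q'; lra.
pose l0 := chord0 p q; pose l' := chord0 p' q'.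
have ll : l' < l0.
  have h1 := chord0_lt p0 pq qp; have h2 := chord0_lt (lt_trans p0 pq) qp pq'.
  exact: lt_trans h2 h1.
pose S := `|(F q - F p) / (q - p)|.
have S0 : 0 <= S by exact: normr_ge0.
pose g := (l0 - l') / 2.
have g0 : 0 < g by rewrite /g; lra.
have Sg0 : 0 < g / (S + 1) by rewrite divr_gt0 //; lra.
exists (l' + g), l', (Num.min (p / 2) (g / (S + 1))); split.
- by rewrite ltrDl.
- by rewrite lt_min Sg0 andbT; lra.
- move=> t; rewrite le_min => /andP[t0 /andP[tp tg]].
  have tp' : t < p by lra.
  apply: le_trans (below_chord t0 tp' pq); rewrite lee_fin.
  have -> : (F p * (q - t) - F q * (p - t)) / (q - p) = l0 + (F q - F p) / (q - p) * t.
    by rewrite /l0 /chord0; field; rewrite subr_eq0 gt_eqF.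
  have h1 : - (S * t) <= (F q - F p) / (q - p) * t.
    by rewrite -mulNr ler_wpM2r // lerNl ler_normr lexx orbT.
  have h2 : S * t <= g.
    rewrite ler_pdivlMr in tg; last by lra.
    by rewrite mulrDr mulr1 in tg; rewrite mulrC; lra.
  by move: h1 h2 tg tp; rewrite /g => *; lra.
- move=> x rho xx /andP[r1 r2].
  have x0 : 0 < x by lra.
  move: r2; rewrite le_eqVlt => /predU1P[->|r2]; first by rewrite !mul1r subrr mul0r addr0.
  have u1 : x1 / 2 <= rho * x by nra.
  have u2 : rho * x < x by rewrite gtr_pMl.
  have h1 : chord0 (rho * x) x < chord0 q' (rho * x) by apply: chord0_lt => //; lra.
  have h2 : chord0 q' (rho * x) < chord0 p' q' by apply: chord0_lt => //; lra.
  have h3 : chord0 (rho * x) x < l' by exact: lt_trans h2.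
  have e : chord0 (rho * x) x = (F (rho * x) - rho * F x) / (1 - rho).
    have k1 : 1 - rho != 0 by rewrite subr_eq0 gt_eqF.
    have -> : chord0 (rho * x) x = (F (rho * x) * x - F x * (rho * x)) / ((1 - rho) * x).
      by rewrite /chord0; congr (_ / _); ring.
    by field; rewrite k1 gt_eqF.
  rewrite e ltr_pdivrMr in h3; last by lra.
  rewrite [l' * _]mulrC in h3; move: h3.
  by move: (F (rho * x)) (rho * F x) ((1 - rho) * l') => A B C' ?; lra.
Qed.

Lemma F_bounded a b x : 0 < a -> a <= x <= b -> F x <= F a + F b.
Proof.
move=> a0 /andP[ax xb].
have Fa := F_ge0 (ltW a0); have Fb : 0 <= F b by apply: F_ge0; lra.
move: ax; rewrite le_eqVlt => /predU1P[<-|ax]; first by lra.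
move: xb; rewrite le_eqVlt => /predU1P[->|xb]; first by lra.
have h := F_convex a0 ax xb.
have ba : 0 < b - a by lra.
rewrite -(ler_pM2r ba); apply: le_trans (ltW h) _.
rewrite mulrDl lerD // ler_wpM2l //; lra.
Qed.

(** Between [x / 2] and [2 x] the graph is squeezed between the two lines through the point at [x]
    with the chord slopes [s1] and [s2]. *)
Lemma F_locally_lipschitz x : 0 < x -> exists M, 0 <= M /\
  forall y, x / 2 < y < 2 * x -> `|F y - F x| <= M * `|y - x|.
Proof.
move=> x0; pose a := x / 2; pose b := 2 * x.
pose s1 := (F x - F a) / (x - a); pose s2 := (F b - F x) / (b - x).
exists (`|s1| + `|s2|); split; first by rewrite addr_ge0.
have n1 := ler_norm s1; have n2 := ler_norm s2.
have n3 := ler_norm (- s1); have n4 := ler_norm (- s2); rewrite normrN in n3 n4.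
have p1 := normr_ge0 s1; have p2 := normr_ge0 s2.
have a0 : 0 < a by rewrite /a; lra.
have ax : a < x by rewrite /a; lra.
have xb : x < b by rewrite /b; lra.
have e1 : F x - F a = s1 * (x - a) by rewrite /s1; field; rewrite subr_eq0 gt_eqF.
have e2 : F b - F x = s2 * (b - x) by rewrite /s2; field; rewrite subr_eq0 gt_eqF.
move=> y; rewrite -/a -/b => /andP[ay yb].
case: (ltgtP y x) => [yx|xy|->]; last by rewrite !subrr !normr0 mulr0.
- have h1 := F_convex a0 ay yx; have h2 := F_convex (lt_trans a0 ay) yx xb.
  have k1 : F y - F x <= - s1 * (x - y).
    rewrite -(ler_pM2r (_ : 0 < x - a)); last by lra.
    rewrite mulNr mulNr mulrAC -e1; lra.
  have k2 : - s2 * (x - y) <= F y - F x.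
    rewrite -(ler_pM2r (_ : 0 < b - x)); last by lra.
    rewrite mulNr mulNr mulrAC -e2; lra.
  rewrite (ltr0_norm (_ : y - x < 0)) ?subr_lt0 // opprB ler_norml; apply/andP; split.
    apply: le_trans k2; rewrite -mulNr ler_wpM2r; lra.
  apply: le_trans k1 _; rewrite ler_wpM2r; lra.
- have h1 := F_convex a0 ax xy; have h2 := F_convex x0 xy yb.
  have k1 : s1 * (y - x) <= F y - F x.
    rewrite -(ler_pM2r (_ : 0 < x - a)); last by lra.
    rewrite mulrAC -e1; lra.
  have k2 : F y - F x <= s2 * (y - x).
    rewrite -(ler_pM2r (_ : 0 < b - x)); last by lra.
    rewrite mulrAC -e2; lra.
  rewrite (gtr0_norm (_ : 0 < y - x)) ?subr_gt0 // ler_norml; apply/andP; split.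
    apply: le_trans k1; rewrite -mulNr ler_wpM2r; lra.
  apply: le_trans k2 _; rewrite ler_wpM2r; lra.
Qed.

Lemma F_continuous x : 0 < x -> {for x, continuous F}.
Proof.
move=> x0; have [M [M0 hM]] := F_locally_lipschitz x0.
apply/cvgrPdist_le => e e0.
have M1 : 0 < M + 1 by lra.
near=> y.
have yx : y \in `]x / 2, 2 * x[.
  by near: y; apply: near_in_itvoo; rewrite in_itv /=; lra.
rewrite in_itv /= in yx; rewrite distrC; apply: le_trans (hM y yx) _.
have : `|x - y| < e / (M + 1).
  by near: y; apply: (@nbhsx_ballx _ _ x); rewrite divr_gt0.
rewrite distrC ltr_pdivlMr // => h.
have := normr_ge0 (y - x); nra.
Unshelve. all: by end_near. Qed.

End ConvexIntegrand.

(** * Energy comparison *)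

Section EnergyIntegrals.
Context {R : realType}.
Implicit Types (h : R -> \bar R) (kappa tau r G : R -> R) (a b c d e s t x y L : R).
Local Notation mu := (@lebesgue_measure R).

Lemma preimage_addr_itv (b1 b2 : bool) a b t :
  (fun s => s + t) @^-1` [set` Interval (BSide b1 (a + t)) (BSide b2 (b + t))] =
  [set` Interval (BSide b1 a) (BSide b2 b)].
Proof.
by case: b1; case: b2; apply/seteqP; split => s /=; rewrite !in_itv /= ?lerD2r ?ltrD2r.
Qed.

Lemma addr_measurable t :
  measurable_fun setT ((fun s => s + t) : measurableTypeR R -> measurableTypeR R).
Proof.
apply: (@continuous_measurable_fun R (fun s => s + t)) => s.
by apply: cvgD; [exact: cvg_id|exact: cvg_cst].
Qed.

Lemma lebesgue_measure_translate t (A : set (measurableTypeR R)) : measurable A ->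
  pushforward mu ((fun s => s + t) : _ -> measurableTypeR R) A = mu A.
Proof.
move=> mA; apply/esym/lebesgue_measure_unique => //; first exact: addr_measurable.
move=> mt /= _ [[a b]] _ <-.
rewrite /pushforward /=.
have -> : (fun s => s + t) @^-1` `]a, b] = `](a - t), (b - t)]%classic.
  by rewrite -(preimage_addr_itv false false (a - t) (b - t) t) !subrK.
rewrite !lebesgue_measure_itv /= !lte_fin ltrD2r.
by case: ifP => // _; rewrite -EFinB; congr EFin; ring.
Qed.

Lemma integral_translate h a b t : measurable_fun (setT : set (measurableTypeR R)) h ->
  (forall x, 0 <= h x)%E ->
  (\int[mu]_(s in `[a, b[) h (s + t)%R = \int[mu]_(s in `[(a + t)%R, (b + t)%R[) h s)%E.
Proof.
move=> mh h0.
rewrite -(preimage_addr_itv true true a b t).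
rewrite -(@ge0_integral_pushforward _ _ _ _ _ _ (addr_measurable t) mu _ h) //.
- apply: eq_measure_integral => [|mt A mA AS]; first exact: addr_measurable.
  exact: lebesgue_measure_translate.
- exact: measurable_funS mh.
Qed.

Lemma integral_co_split h a b c : measurable_fun (setT : set (measurableTypeR R)) h ->
  (forall x, 0 <= h x)%E -> a <= b -> b <= c ->
  (\int[mu]_(s in `[a, c[) h s = \int[mu]_(s in `[a, b[) h s + \int[mu]_(s in `[b, c[) h s)%E.
Proof.
move=> mh h0 ab bc.
have -> : `[a, c[%classic = (`[a, b[ `|` `[b, c[)%classic :> set (measurableTypeR R).
  apply/seteqP; split => s; rewrite /= !in_itv /=.
    by move=> /andP[-> sc]; have [sb|bs] := ltP s b; [left|right].
  by case=> /andP[h1 h2]; apply/andP; split; lra.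
rewrite ge0_integral_setU //.
- exact: measurable_funS mh.
- by apply/disj_setPS => s [] /=; rewrite !in_itv /= => /andP[_ sb] /andP[bs _]; lra.
Qed.

Lemma integral_oo_co h a b : measurable_fun (setT : set (measurableTypeR R)) h ->
  (\int[mu]_(s in `]a, b[) h s = \int[mu]_(s in `[a, b[) h s)%E.
Proof. by move=> mh; apply: integral_itv_obnd_cbnd; exact: measurable_funS mh. Qed.

Lemma integral_co_cc h a b : measurable_fun (setT : set (measurableTypeR R)) h ->
  (\int[mu]_(s in `[a, b[) h s = \int[mu]_(s in `[a, b]) h s)%E.
Proof. by move=> mh; apply: integral_itv_bndo_bndc; exact: measurable_funS mh. Qed.

Lemma integral_co_ge h a b (l : R) : measurable_fun (setT : set (measurableTypeR R)) h ->
  (forall x, 0 <= h x)%E -> a <= b -> (forall x, (a <= x <= b)%R -> l%:E <= h x)%E ->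
  (((b - a) * l)%:E <= \int[mu]_(s in `[a, b[) h s)%E.
Proof.
move=> mh h0 ab hl; have [l0|l0] := leP l 0.
  apply: (@le_trans _ _ 0%E); last exact: integral_ge0.
  by rewrite lee_fin mulr_ge0_le0 // subr_ge0.
have e : (\int[mu]_(x in `[a, b[) (cst l%:E) x = l%:E * mu `[a, b[)%E.
  by apply: integral_cst; exact: measurable_itv.
have em : mu `[a, b[ = (b - a)%:E.
  rewrite lebesgue_measure_itv /= lte_fin; case: ltP => // ba.
  have -> : b = a by apply/eqP; rewrite eq_le ab ba.
  by rewrite subrr.
rewrite mulrC EFinM -em -e; apply: ge0_le_integral.
- exact: measurable_itv.
- by move=> x _; rewrite lee_fin ltW.
- exact: measurable_cst.
- exact: measurable_funS mh.
- by move=> x /=; rewrite in_itv /= => /andP[h1 h2]; apply: hl; rewrite h1 ltW.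
Qed.

End EnergyIntegrals.

Section Energy.
Context {R : realType} (f : R -> \bar R) (kappa : R -> R).
Context (f_ge0 : forall x : R, 0 <= x -> (0 <= f x)%E).
Context (f_borel : measurable_fun (`[0, +oo[ : set R) f).
Context (fcvx : strictly_convex_nneg f) (ck : continuous kappa).
Implicit Types (tau r : R -> R) (a b c d e s t y L lo hi l x : R).
Local Notation mu := (@lebesgue_measure R).

Lemma energy_density_measurable (k : R -> R) (D : set (measurableTypeR R)) :
  continuous k -> measurable D -> measurable_fun D (fun s => f `|k s|).
Proof.
move=> kc mD; apply: measurable_comp_norm f_borel _.
apply: measurable_funTS; exact: continuous_measurable_fun.
Qed.

(** The pointwise gap bounds the new density by [r F (tau s) + (1 - r) l']. By substitution the
    first term integrates to the energy of the original arc, and the second to [l'] times the length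
    gained. On this arc [|kappa| >= x1 > 0], so [f] is finite and continuous there. *)
Lemma stretched_energy_le tau r lo hi x1 l' : lo < hi -> 0 < x1 ->
  continuous r -> (forall s, is_derive s (1 : R) tau (r s)) ->
  (forall s, lo <= s <= hi -> 1 / 2 <= r s <= 1) ->
  (forall y, tau lo <= y <= tau hi -> x1 <= `|kappa y|) ->
  (forall x rho, x1 <= x -> 1 / 2 <= rho <= 1 ->
    fine (f (rho * x)) <= rho * fine (f x) + (1 - rho) * l') ->
  (\int[mu]_(s in `[lo, hi]) f `|kappa (tau s) * r s|%R <=
   \int[mu]_(s in `[tau lo, tau hi]) f `|kappa s|%R +
     (((hi - lo) - (tau hi - tau lo)) * l')%:E)%E.
Proof.
move=> lohi x10 cr dtau hr hk gap.
have ctau := derivable_continuous dtau.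
have ktc : continuous (fun s => kappa (tau s) * r s).
  by move=> s; apply: cvgM; [apply: continuous_comp; [exact: ctau|exact: ck]|exact: cr].
pose F y := fine (f `|kappa y|).
have tinc x y : lo <= x -> y <= hi -> x < y -> tau x < tau y.
  move=> h1 h2 xy; apply: (gt0_derive_lt xy (continuous_subspaceT ctau) (fun x _ => dtau x)).
  by move=> z hz; have := hr z ltac:(lra); lra.
have tin s : lo <= s <= hi -> tau lo <= tau s <= tau hi.
  move=> /andP[h1 h2]; apply/andP; split.
    by move: h1; rewrite le_eqVlt => /predU1P[->//|h1]; apply/ltW/tinc.
  by move: h2; rewrite le_eqVlt => /predU1P[->//|h2]; apply/ltW/tinc.
have fE y : tau lo <= y <= tau hi -> f `|kappa y| = (F y)%:E.
  by move=> /hk h; apply: convex_fin => //; lra.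
have Fc y : tau lo <= y <= tau hi -> {for y, continuous F}.
  move=> /hk h; apply: (@continuous_comp _ _ _ (fun y => `|kappa y|) (fine \o f)).
    by apply: cvg_norm; exact: ck.
  by apply: F_continuous => //; lra.
have FcW : {within `[tau lo, tau hi], continuous F}.
  by apply: continuous_in_subspaceT => y; rewrite inE /= in_itv /=; exact: Fc.
have derr : derive1 tau = r.
  by apply/funext => s; rewrite derive1E; have h := dtau s; exact: derive_val.
have sub : (\int[mu]_(s in `[tau lo, tau hi]) (F s)%:E =
    \int[mu]_(s in `[lo, hi]) (F (tau s) * r s)%:E)%E.
  rewrite (@integration_by_substitution_increasing R tau F lo hi (ltW lohi)) ?derr //.
  - by move=> x y; rewrite !in_itv /= => /andP[h1 _] /andP[_ h2]; exact: tinc.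
  - apply/cvg_ex; exists (r lo); apply: cvg_at_right_filter; exact: cr.
  - apply/cvg_ex; exists (r hi); apply: cvg_at_left_filter; exact: cr.
  - split; first by move=> x _; exact: ex_derive.
      by apply: cvg_at_right_filter; exact: ctau.
    by apply: cvg_at_left_filter; exact: ctau.
have -> : (\int[mu]_(s in `[tau lo, tau hi]) f `|kappa s|%R =
    \int[mu]_(s in `[tau lo, tau hi]) (F s)%:E)%E.
  by apply: eq_integral => y; rewrite inE /= in_itv /= => /fE.
rewrite sub.
have c1r : continuous (fun s => (1 - r s) * l').
  by move=> s; apply: cvgM; [apply: cvgB; [exact: cvg_cst|exact: cr]|exact: cvg_cst].
have FTC : (\int[mu]_(s in `[lo, hi]) ((1 - r s) * l')%:E =
    (((hi - lo) - (tau hi - tau lo)) * l')%:E)%E.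
  pose T s := (s - tau s) * l'.
  have dT s : is_derive s (1 : R) T ((1 - r s) * l').
    have := is_derive1Z l' (is_derive1B (is_derive_id s (1 : R)) (dtau s)).
    rewrite mulrC (_ : T = fun z => l' * (z - tau z)) //.
    by apply/funext => z; rewrite /T mulrC.
  have cT := derivable_continuous dT.
  rewrite (@continuous_FTC2 R _ T) //.
  - by rewrite -EFinB /T; congr EFin; ring.
  - exact: continuous_subspaceT.
  - split; first by move=> x _; exact: ex_derive.
      by apply: cvg_at_right_filter; exact: cT.
    by apply: cvg_at_left_filter; exact: cT.
  - by move=> s _; rewrite derive1E; have h := dT s; exact: derive_val.
have FrW : {within `[lo, hi], continuous (fun s => F (tau s) * r s)}.
  apply: continuous_in_subspaceT => s; rewrite inE /= in_itv /= => sI.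
  apply: cvgM; last exact: cr.
  by apply: (@continuous_comp _ _ _ tau F); [exact: ctau|apply: Fc; exact: tin].
have iF : mu.-integrable `[lo, hi] (EFin \o (fun s => F (tau s) * r s)).
  by apply: continuous_compact_integrable FrW; exact: segment_compact.
have i1 : mu.-integrable `[lo, hi] (EFin \o (fun s => (1 - r s) * l')).
  exact: continuous_integrable_cc.
rewrite -FTC -(integralD_EFin _ iF i1); last exact: measurable_itv.
apply: ge0_le_integral.
- exact: measurable_itv.
- by move=> s _; exact: f_ge0.
- exact: energy_density_measurable.
- apply: (measurable_int mu); exact: integrableD iF i1.
move=> s; rewrite /= in_itv /= => sI; have kx := hk _ (tin s sI); have rs := hr s sI.
have -> : `|kappa (tau s) * r s| = r s * `|kappa (tau s)|.
  by rewrite normrM mulrC (@ger0_norm _ (r s)) //; lra.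
rewrite /F (convex_fin f_ge0 fcvx); last by apply: mulr_gt0; lra.
rewrite lee_fin (mulrC _ (r s)); exact: gap.
Qed.

End Energy.

Lemma ereal_gain (R : realType) (A B W C Wt : \bar R) (m n : R) :
  (0 <= A)%E -> (0 <= B)%E -> (0 <= W)%E -> (0 <= C)%E -> (0 <= Wt)%E ->
  (B + (A + (W + C)) < +oo)%E -> (m%:E <= B)%E -> (Wt <= W + n%:E)%E -> n < m ->
  (A + (Wt + C) < B + (A + (W + C)))%E.
Proof.
case: A => [A||] //; case: B => [B||] //; case: W => [W||] //; case: C => [C||] //.
case: Wt => [Wt||] //; rewrite -?EFinD ?lee_fin ?lte_fin.
by move=> _ _ _ _ _ _ h1 h2 h3; lra.
Qed.

Section EnergyDecrease.
Context {R : realType} (f : R -> \bar R) (kappa : R -> R).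
Context (f_ge0 : forall x : R, 0 <= x -> (0 <= f x)%E).
Context (f_borel : measurable_fun (`[0, +oo[ : set R) f).
Context (fcvx : strictly_convex_nneg f) (ck : continuous kappa).
Implicit Types (tau r : R -> R) (a b c d e s t y L lo hi l x : R).
Local Notation mu := (@lebesgue_measure R).

(** As [|kappa|] has period [L], the energy is also the integral over [[e, L + e]]. The competitor
    skips [[e, e + d]], saving at least [d l], and stretches [[lo + e + d, hi + e]] by the length
    [d], which costs at most [d l']; the rest is only translated. *)
Lemma energy_decrease L tau r lo hi e d x1 l l' :
  (forall s, `|kappa (s + L)| = `|kappa s|) ->
  0 <= e -> e <= L -> 0 < d -> 0 <= lo -> lo < hi -> hi <= L -> 0 < x1 -> l' < l ->
  continuous r -> (forall s, is_derive s (1 : R) tau (r s)) ->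
  (forall s, 1 / 2 <= r s <= 1) ->
  (forall s, s <= lo -> tau s = s + (e + d) /\ r s = 1) ->
  (forall s, hi <= s -> tau s = s + e /\ r s = 1) ->
  (forall y, lo + (e + d) <= y <= hi + e -> x1 <= `|kappa y|) ->
  (forall y, 0 <= y <= e + d -> (l%:E <= f `|kappa y|)%E) ->
  (forall x rho, x1 <= x -> 1 / 2 <= rho <= 1 ->
    fine (f (rho * x)) <= rho * fine (f x) + (1 - rho) * l') ->
  (\int[mu]_(s in `]0%R, L[) f `|kappa s|%R < +oo)%E ->
  (\int[mu]_(s in `]0%R, L[) f `|kappa (tau s) * r s|%R <
   \int[mu]_(s in `]0%R, L[) f `|kappa s|%R)%E.
Proof.
move=> per e0 eL d0 lo0 lohi hiL x10 ll cr dtau hr tlo thi hk hl gap fin.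
have L0 : 0 <= L by lra.
have ctau := derivable_continuous dtau.
have ktc : continuous (fun s => kappa (tau s) * r s).
  by move=> s; apply: cvgM; [apply: continuous_comp; [exact: ctau|exact: ck]|exact: cr].
pose h s := f `|kappa s|.
pose ht s := f `|kappa (tau s) * r s|.
have mh : measurable_fun (setT : set (measurableTypeR R)) h.
  exact: energy_density_measurable.
have mht : measurable_fun (setT : set (measurableTypeR R)) ht.
  by apply: energy_density_measurable => //; exact: ktc.
have h0 s : (0 <= h s)%E by exact: f_ge0.
have ht0 s : (0 <= ht s)%E by exact: f_ge0.
pose J x y := (\int[mu]_(s in `[x, y[) h s)%E.
have wmid : lo + (e + d) <= hi + e.
  have [<- _] := tlo lo (lexx _); have [<- _] := thi hi (lexx _).
  apply: (ge0_derive_le (ltW lohi) (continuous_subspaceT ctau) (fun x _ => dtau x)).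
  by move=> z _; have := hr z; lra.
have JE : (\int[mu]_(s in `]0%R, L[) h s = J e (e + d)%R + (J (e + d)%R (lo + (e + d))%R +
    (J (lo + (e + d))%R (hi + e)%R + J (hi + e)%R (L + e)%R)))%E.
  rewrite integral_oo_co // (@integral_co_split R h 0 e L) // addeC.
  have -> : (\int[mu]_(s in `[0%R, e[) h s = J L (L + e)%R)%E.
    rewrite -[X in J X _]add0r (addrC L e) /J -integral_translate //.
    by apply: eq_integral => s _; rewrite /h per.
  rewrite -(@integral_co_split R h e L (L + e)) //; last by lra.
  rewrite (@integral_co_split R h e (e + d) (L + e)) //; [|lra|lra].
  rewrite (@integral_co_split R h (e + d) (lo + (e + d)) (L + e)) //; [|lra|lra].
  by rewrite (@integral_co_split R h (lo + (e + d)) (hi + e) (L + e)) //; lra.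
have JtE : (\int[mu]_(s in `]0%R, L[) ht s = J (e + d)%R (lo + (e + d))%R +
    (\int[mu]_(s in `[lo, hi[) ht s + J (hi + e)%R (L + e)%R))%E.
  rewrite integral_oo_co // (@integral_co_split R ht 0 lo L) //; last by lra.
  rewrite (@integral_co_split R ht lo hi L) //; last by lra.
  congr (_ + (_ + _))%E.
    rewrite -[X in J X _]add0r /J -integral_translate //.
    apply: eq_integral => s; rewrite inE /= in_itv /= => /andP[_ sl].
    by have [e1 e2] := tlo s (ltW sl); rewrite /ht /h e1 e2 mulr1.
  rewrite /J -integral_translate //.
  apply: eq_integral => s; rewrite inE /= in_itv /= => /andP[sl _].
  by have [e1 e2] := thi s sl; rewrite /ht /h e1 e2 mulr1.
have J0 x y : (0 <= J x y)%E by apply: integral_ge0 => s _; exact: h0.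
rewrite -/h in fin; rewrite -/h -/ht.
rewrite JE JtE; rewrite JE in fin.
apply: (@ereal_gain _ _ _ _ _ _ (d * l) (d * l')) => //.
- by apply: integral_ge0 => s _; exact: ht0.
- have ed : e <= e + d by lra.
  have hle y : e <= y <= e + d -> (l%:E <= h y)%E.
    by move=> /andP[y1 y2]; apply: hl; rewrite y2 (le_trans e0 y1).
  by have := integral_co_ge mh h0 ed hle; rewrite (addrC e d) addrK.
- rewrite /J !integral_co_cc //.
  have [e1 _] := tlo lo (lexx _); have [e2 _] := thi hi (lexx _).
  have := @stretched_energy_le _ _ _ f_ge0 f_borel fcvx ck tau r lo hi x1 l' lohi x10 cr dtau.
  rewrite e1 e2; have -> : (hi - lo - (hi + e - (lo + (e + d)))) = d by ring.
  by apply=> // s _; exact: hr.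
- by rewrite ltr_pM2l.
Qed.

Lemma energy_finite L tau r a b : 0 < L -> 0 < a -> continuous r ->
  (forall s, is_derive s (1 : R) tau (r s)) ->
  (forall s, 0 <= s <= L -> a <= `|kappa (tau s) * r s| <= b) ->
  (\int[mu]_(s in `]0%R, L[) f `|kappa (tau s) * r s|%R < +oo)%E.
Proof.
move=> L0 a0 cr dtau hab.
have ctau := derivable_continuous dtau.
have ktc : continuous (fun s => kappa (tau s) * r s).
  by move=> s; apply: cvgM; [apply: continuous_comp; [exact: ctau|exact: ck]|exact: cr].
pose M := fine (f a) + fine (f b).
apply: (@le_lt_trans _ _ (\int[mu]_(s in `]0%R, L[) cst M%:E s)%E); last first.
  have -> : (\int[mu]_(s in `]0%R, L[) cst M%:E s = M%:E * mu `]0%R, L[)%E.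
    by apply: integral_cst; exact: measurable_itv.
  by rewrite lebesgue_measure_oo // -EFinM ltry.
apply: ge0_le_integral.
- exact: measurable_itv.
- by move=> s _; exact: f_ge0.
- by apply: energy_density_measurable => //; exact: ktc.
- exact: measurable_cst.
move=> s; rewrite /= in_itv /= => sL.
have /andP[h1 h2] := hab s ltac:(lra).
rewrite (convex_fin f_ge0 fcvx); last by lra.
by rewrite lee_fin; apply: F_bounded => //; rewrite h1 h2.
Qed.

End EnergyDecrease.

(** * Geometry of the curve *)

Section CurveFacts.
Context {R : realType}.
Implicit Types (kappa theta X Y : R -> R) (a b e s x y L K : R).

Lemma antiperiodic_bounded kappa L : 0 < L -> continuous kappa ->
  (forall s, kappa (s + L) = - kappa s) -> exists2 K, 0 <= K & forall s, `|kappa s| <= K.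
Proof.
move=> L0 ck anti; have L2 : 0 <= 2 * L by lra.
have [K K0 HK] := continuous_bounded_cc L2 (continuous_subspaceT ck).
exists K => // s.
pose n := Num.floor (s / (2 * L)).
have L20 : 0 < 2 * L by lra.
have /andP[n1 n2] : n%:~R <= s / (2 * L) < n%:~R + 1 by rewrite -intrD1 floor_itv.
rewrite ler_pdivlMr // in n1; rewrite ltr_pdivrMr // in n2.
have -> : s = (s - n%:~R * (2 * L)) + L * n%:~R *+ 2 by rewrite mulr2n; ring.
by rewrite antiperiodic_int //; apply: HK; lra.
Qed.

Lemma positive_min kappa a b : a <= b -> continuous kappa ->
  (forall s, a <= s <= b -> kappa s != 0) ->
  exists2 m, 0 < m & forall s, a <= s <= b -> m <= `|kappa s|.
Proof.
move=> ab ck k0.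
have cn : continuous (fun s => `|kappa s|) by move=> s; apply: cvg_norm; exact: ck.
have [c cab Hc] := EVT_min ab (continuous_subspaceT cn).
exists `|kappa c|; first by rewrite normr_gt0; apply: k0; rewrite in_itv in cab.
by move=> s sab; apply: Hc; rewrite in_itv.
Qed.

Lemma rolle_global (g dg : R -> R) a b : a < b -> (forall s, is_derive s (1 : R) g (dg s)) ->
  g a = g b -> exists2 c, a < c < b & dg c = 0.
Proof.
move=> ab d gab.
have [||c cab dc] := Rolle ab _ _ gab.
- by move=> x _; exact: ex_derive.
- exact: continuous_subspaceT (derivable_continuous d).
exists c; first by rewrite in_itv in cab.
by have h := d c; rewrite -(@derive_val _ _ _ _ _ _ _ h) (@derive_val _ _ _ _ _ _ _ dc).
Qed.

Lemma vertical_tangent L gamma kappa theta X Y u1 u2 :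
  curve_form L gamma kappa theta X Y u1 u2 -> ~ {in `]0, L[ &, injective gamma} ->
  exists2 s, 0 < s < L & cos (theta s) = 0.
Proof.
move=> [_ _ dX _ _ _ u12 gE] ninj; apply: contrapT => H; apply: ninj.
have key x y : 0 < x -> y < L -> x < y -> gamma x <> gamma y.
  move=> x0 yL xy gxy.
  have XE : X x = X y.
    have xL : 0 <= x <= L by lra.
    have yL' : 0 <= y <= L by lra.
    move: gxy; rewrite (gE x xL) (gE y yL').
    case=> /addrI e1 /addrI e2.
    have : u1 * (u1 * X x - u2 * Y x) + u2 * (u2 * X x + u1 * Y x) =
      u1 * (u1 * X y - u2 * Y y) + u2 * (u2 * X y + u1 * Y y) by rewrite e1 e2.
    have E z w : u1 * (u1 * z - u2 * w) + u2 * (u2 * z + u1 * w) = (u1 ^+ 2 + u2 ^+ 2) * z by ring.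
    by rewrite !E u12 !mul1r.
  have [c cxy dc] := rolle_global xy dX XE.
  by apply: H; exists c => //; lra.
move=> x y; rewrite !in_itv /= => /andP[x0 xL] /andP[y0 yL] gxy.
have [xy|yx|//] := ltgtP x y; first by case: (key x y).
by case: (key y x).
Qed.

(** Provides translations that really lengthen the chord. If [Y] vanished at 0, [e / 2] and [e],
    then [sin theta] would have two zeros and its derivative [cos theta * kappa] one between
    them. *)
Lemma lifted_height kappa theta Y e : 0 < e ->
  (forall s, is_derive s (1 : R) theta (kappa s)) ->
  (forall s, is_derive s (1 : R) Y (sin (theta s))) -> Y 0 = 0 ->
  (forall s, 0 < s < e -> kappa s != 0) -> (forall s, 0 < s < e -> cos (theta s) != 0) ->
  Y e != 0 \/ Y (e / 2) != 0.
Proof.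
move=> e0 dth dY Y0 k0 c0.
have [Ye|] := eqVneq (Y e) 0; last by left.
right; apply/eqP => Ye2.
have [c1 h1 s1] : exists2 c, 0 < c < e / 2 & sin (theta c) = 0.
  by apply: (rolle_global _ dY); rewrite ?Y0 ?Ye2 //; lra.
have [c2 h2 s2] : exists2 c, e / 2 < c < e & sin (theta c) = 0.
  by apply: (rolle_global _ dY); rewrite ?Ye ?Ye2 //; lra.
have dsin s : is_derive s (1 : R) (fun t => sin (theta t)) (cos (theta s) * kappa s).
  exact: (is_derive1_chain (is_derive_sin (theta s)) (dth s)).
have [c h3 /eqP] : exists2 c, c1 < c < c2 & cos (theta c) * kappa c = 0.
  by apply: (rolle_global _ dsin); rewrite ?s1 ?s2 //; lra.
have ce : 0 < c < e by lra.
by rewrite mulf_eq0 (negPf (k0 c ce)) (negPf (c0 c ce)).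
Qed.

(** The rotation [u1 + i u2] preserves the scalar product and [Y L = 0]; the hypothesis on the
    initial direction becomes the sign of [X L * cos (theta 0)]. *)
Lemma chord_direction L gamma kappa theta X Y u1 u2 : 0 < L ->
  curve_form L gamma kappa theta X Y u1 u2 -> Y L = 0 ->
  dot (velocity L gamma 0) (gamma L - gamma 0) = X L * cos (theta 0).
Proof.
move=> L0 [ck dth dX dY X0 Y0 u12 gE] YL.
have cth := derivable_continuous dth.
have cc : continuous (fun s => cos (theta s)).
  by move=> s; apply: continuous_comp; [exact: cth|exact: continuous_cos].
have cs : continuous (fun s => sin (theta s)).
  by move=> s; apply: continuous_comp; [exact: cth|exact: continuous_sin].
have d1 s : is_derive s (1 : R) (fun t => (gamma 0).1 + (u1 * X t - u2 * Y t))
    (u1 * cos (theta s) - u2 * sin (theta s)).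
  have := is_derive1D (is_derive1_const (gamma 0).1 s)
    (is_derive1B (is_derive1Z u1 (dX s)) (is_derive1Z u2 (dY s))).
  by rewrite add0r.
have d2 s : is_derive s (1 : R) (fun t => (gamma 0).2 + (u2 * X t + u1 * Y t))
    (u2 * cos (theta s) + u1 * sin (theta s)).
  have := is_derive1D (is_derive1_const (gamma 0).2 s)
    (is_derive1D (is_derive1Z u2 (dX s)) (is_derive1Z u1 (dY s))).
  by rewrite add0r.
have g1 x : 0 <= x <= L -> (fst \o gamma) x = (gamma 0).1 + (u1 * X x - u2 * Y x).
  by move=> xL; rewrite [LHS]/= (gE x xL).
have g2 x : 0 <= x <= L -> (snd \o gamma) x = (gamma 0).2 + (u2 * X x + u1 * Y x).
  by move=> xL; rewrite [LHS]/= (gE x xL).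
have cv1 : continuous (fun s => u1 * cos (theta s) - u2 * sin (theta s)).
  by move=> s; apply: cvgB; apply: cvgMl_tmp; [exact: cc|exact: cs].
have cv2 : continuous (fun s => u2 * cos (theta s) + u1 * sin (theta s)).
  by move=> s; apply: cvgD; apply: cvgMl_tmp; [exact: cc|exact: cs].
have [_ v1] := wderivE L0 g1 d1 cv1.
have [_ v2] := wderivE L0 g2 d2 cv2.
rewrite /dot /velocity /= v1 ?v2 ?lexx ?ltW // (gE L) ?lexx ?ltW //= YL.
rewrite -[RHS]mul1r -u12; ring.
Qed.

End CurveFacts.

(** * Endpoints of the competitors *)

Lemma first_order_arith (R : realType) (V VL Xe Xs q e c d k0 ne nc m n : R) :
  V - VL - Xe + Xs - c * q <= k0 * nc -> - (k0 * nc) <= V - VL - Xe + Xs - c * q ->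
  k0 * m <= k0 * n ->
  - (k0 * ne) <= Xe - q * e -> Xe - q * e <= k0 * ne ->
  - (k0 * m) <= Xs - q * (e + c + d) -> Xs - q * (e + c + d) <= k0 * m ->
  - (k0 * n + k0 * ne + k0 * nc) <= V - VL + q * d <= k0 * n + k0 * ne + k0 * nc.
Proof.
have -> : q * (e + c + d) = q * e + c * q + q * d by ring.
by move=> *; apply/andP; split; lra.
Qed.

(* The factor [32] makes the linear term [- 2 D q d] dominate the error. *)
Lemma endsq_arith (R : realType) (D q k0 C N d rho U V : R) :
  0 <= D * q -> 32 * k0 = `|q| -> `|U - D + q * d| <= 2 * k0 * N -> `|U - D| <= C * N ->
  `|V| <= C * N -> 0 <= N <= rho -> 0 <= k0 -> 2 * C ^+ 2 * rho <= `|D| * k0 ->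
  `|U ^+ 2 + V ^+ 2 - D ^+ 2 + 64 * (`|D| * k0) * d| <= 5 * (`|D| * k0) * N.
Proof.
move=> Dq qk h1 h2 h3 /andP[N0 Nr] k00 hr.
have DqE : D * q = 32 * (`|D| * k0).
  by rewrite -(ger0_norm Dq) normrM -qk; ring.
have -> : U ^+ 2 + V ^+ 2 - D ^+ 2 + 64 * (`|D| * k0) * d =
  2 * D * (U - D + q * d) + ((U - D) ^+ 2 + V ^+ 2).
  have -> : 64 * (`|D| * k0) * d = 2 * (D * q) * d by rewrite DqE; ring.
  by ring.
have sq (x : R) : `|x| <= C * N -> `|x ^+ 2| <= C ^+ 2 * (rho * N).
  move=> hx; rewrite normrX; apply: (@le_trans _ _ ((C * N) ^+ 2)).
    by rewrite !expr2; apply: ler_pM.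
  by rewrite exprMn; apply: ler_wpM2l; [exact: sqr_ge0|rewrite expr2 ler_wpM2r].
have e1 : `|2 * D * (U - D + q * d)| <= 2 * `|D| * (2 * k0 * N).
  by rewrite !normrM (ger0_norm (ler0n _ _)) ler_wpM2l // mulr_ge0.
have e2 := sq _ h2; have e3 := sq _ h3.
apply: le_trans (ler_normD _ _) _; apply: le_trans (lerD e1 (ler_normD _ _)) _.
have e4 : 2 * C ^+ 2 * rho * N <= `|D| * k0 * N by rewrite ler_wpM2r.
have -> : 5 * (`|D| * k0) * N = 2 * `|D| * (2 * k0 * N) + `|D| * k0 * N by ring.
apply: lerD => //; apply: le_trans e4; apply: le_trans (lerD e2 e3) _.
by have -> : 2 * C ^+ 2 * rho * N = C ^+ 2 * (rho * N) + C ^+ 2 * (rho * N) by ring.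
Qed.

Section Endpoint.
Context {R : realType} (L K : R) (kappa theta X Y B1 chi1 B2 chi2 : R -> R).
Context (L0 : 0 < L) (K0 : 0 <= K) (Kk : forall s, `|kappa s| <= K).
Context (dth : forall s, is_derive s (1 : R) theta (kappa s)).
Context (dX : forall s, is_derive s (1 : R) X (cos (theta s))).
Context (dY : forall s, is_derive s (1 : R) Y (sin (theta s))).
Context (X0 : X 0 = 0) (Y0 : Y 0 = 0).
Context (cchi1 : continuous chi1) (cchi2 : continuous chi2).
Context (dB1 : forall s, is_derive s (1 : R) B1 (chi1 s)).
Context (dB2 : forall s, is_derive s (1 : R) B2 (chi2 s)).
Context (chi1_ge0 : forall s, 0 <= chi1 s) (chi2_ge0 : forall s, 0 <= chi2 s).
Context (B10 : B1 0 = 0) (B1L : B1 L = 1) (B20 : B2 0 = 0) (B2L : B2 L = 1).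
Implicit Types (e c d s t x y : R).

(* The arclength [s] of the competitor corresponds to [tau s] on the periodic
   extension of the curve: a piece of length [e] is moved from one end to the
   other, and a piece of length [c + d] is cut and compensated by stretching the
   supports of [chi1] and [chi2]. *)
Definition tau e c d s := e + c + d + s - c * B1 s - d * B2 s.
Definition rate c d s := 1 - c * chi1 s - d * chi2 s.
Definition endX e c d := primitive (fun s => cos (theta (tau e c d s))) L.
Definition endY e c d := primitive (fun s => sin (theta (tau e c d s))) L.

Lemma rate_continuous c d : continuous (rate c d).
Proof.
move=> s; apply: cvgB; [apply: cvgB; first exact: cvg_cst|]; apply: cvgMl_tmp;
  [exact: cchi1|exact: cchi2].
Qed.

Lemma tau_derive e c d s : is_derive s (1 : R) (tau e c d) (rate c d s).
Proof.
have h := is_derive1B (is_derive1B (is_derive1D (is_derive1_const (e + c + d) s)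
  (is_derive_id s (1 : R))) (is_derive1Z c (dB1 s))) (is_derive1Z d (dB2 s)).
by rewrite add0r in h; exact: h.
Qed.

Lemma cutoff01 (B chi : R -> R) : (forall s, is_derive s (1 : R) B (chi s)) ->
  (forall s, 0 <= chi s) -> B 0 = 0 -> B L = 1 ->
  forall s, 0 <= s <= L -> 0 <= B s <= 1.
Proof.
move=> dB chi0 b0 bL s /andP[s0 sL]; have cB := derivable_continuous dB.
apply/andP; split; [rewrite -b0|rewrite -bL];
  apply: (ge0_derive_le _ _ (fun x _ => dB x)) => //; exact: continuous_subspaceT.
Qed.

Let B101 := cutoff01 dB1 chi1_ge0 B10 B1L.
Let B201 := cutoff01 dB2 chi2_ge0 B20 B2L.

Lemma tau_lip e c d e' c' d' s : 0 <= s <= L ->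
  `|tau e c d s - tau e' c' d' s| <= `|e - e'| + `|c - c'| + `|d - d'|.
Proof.
move=> sL.
have -> : tau e c d s - tau e' c' d' s = (e - e') + (c - c') * (1 - B1 s) + (d - d') * (1 - B2 s).
  by rewrite /tau; ring.
have P (x b : R) : 0 <= b <= 1 -> `|x * (1 - b)| <= `|x|.
  by move=> hb; rewrite normrM ler_piMr // ger0_norm; lra.
apply: le_trans (ler_normD _ _) _; apply: lerD; last exact: P (B201 sL).
apply: le_trans (ler_normD _ _) _; apply: lerD => //; exact: P (B101 sL).
Qed.

Lemma tau_id s : tau 0 0 0 s = s.
Proof. by rewrite /tau !mul0r !subr0 !addr0 add0r. Qed.

Lemma tau_near e c d s : 0 <= s <= L -> `|tau e c d s - s| <= `|e| + `|c| + `|d|.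
Proof. by move=> /(@tau_lip e c d 0 0 0); rewrite tau_id !subr0. Qed.

Lemma theta_lip x y : `|theta x - theta y| <= K * `|x - y|.
Proof. by apply: derive_lip dth Kk _ _. Qed.

Lemma cos_theta_lip x y : `|cos (theta x) - cos (theta y)| <= K * `|x - y|.
Proof. exact: le_trans (cos_lip _ _) (theta_lip _ _). Qed.

Lemma sin_theta_lip x y : `|sin (theta x) - sin (theta y)| <= K * `|x - y|.
Proof. exact: le_trans (sin_lip _ _) (theta_lip _ _). Qed.

Let cth := derivable_continuous dth.

Lemma costau_continuous e c d : continuous (fun s => cos (theta (tau e c d s))).
Proof.
move=> s; apply: continuous_comp; last exact: continuous_cos.
by apply: continuous_comp; [exact: (derivable_continuous (tau_derive e c d))|exact: cth].
Qed.

Lemma sintau_continuous e c d : continuous (fun s => sin (theta (tau e c d s))).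
Proof.
move=> s; apply: continuous_comp; last exact: continuous_sin.
by apply: continuous_comp; [exact: (derivable_continuous (tau_derive e c d))|exact: cth].
Qed.

Lemma primitive_diff_le (g h : R -> R) M : continuous g -> continuous h ->
  (forall s, 0 <= s <= L -> `|g s - h s| <= M) -> `|primitive g L - primitive h L| <= M * L.
Proof.
move=> cg ch gh.
have d s := is_derive1B (is_derive_primitive cg s) (is_derive_primitive ch s).
have := derive_norm_le (ltW L0) (fun x _ => d x) gh.
by rewrite !primitive0 !subr0.
Qed.

Lemma endX_lip e c d e' c' d' :
  `|endX e c d - endX e' c' d'| <= K * (`|e - e'| + `|c - c'| + `|d - d'|) * L.
Proof.
apply: primitive_diff_le; [exact: costau_continuous..|].
move=> s sL; apply: le_trans (cos_theta_lip _ _) _; rewrite ler_wpM2l //; exact: tau_lip.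
Qed.

Lemma endY_lip e c d e' c' d' :
  `|endY e c d - endY e' c' d'| <= K * (`|e - e'| + `|c - c'| + `|d - d'|) * L.
Proof.
apply: primitive_diff_le; [exact: sintau_continuous..|].
move=> s sL; apply: le_trans (sin_theta_lip _ _) _; rewrite ler_wpM2l //; exact: tau_lip.
Qed.

Lemma primitive_eq (g G : R -> R) x : continuous g ->
  (forall s, is_derive s (1 : R) G (g s)) -> primitive g x = G x - G 0.
Proof.
move=> cg dG.
have H : primitive g x - G x = primitive g 0 - G 0.
  apply: (derive0_const (f := fun t => primitive g t - G t)) => t.
  by have := is_derive1B (is_derive_primitive cg t) (dG t); rewrite subrr.
by rewrite primitive0 in H; lra.
Qed.

Lemma tau_shift e s : tau e 0 0 s = s + e.
Proof. by rewrite /tau !mul0r !subr0 !addr0 addrC. Qed.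

Lemma derive_shift1 (f df : R -> R) e : (forall s, is_derive s (1 : R) f (df s)) ->
  forall s, is_derive s (1 : R) (fun t => f (t + e)) (df (s + e)).
Proof.
move=> d s; have h := is_derive1D (is_derive_id s (1 : R)) (is_derive1_const e s).
by have := @is_derive1_chain R f (fun t => t + e) s _ _ (d _) h; rewrite addr0 mulr1.
Qed.

Lemma endX_shift e : endX e 0 0 = X (L + e) - X e.
Proof.
have h s : is_derive s (1 : R) (fun t => X (t + e)) (cos (theta (tau e 0 0 s))).
  by rewrite tau_shift; exact: derive_shift1 dX s.
by have := primitive_eq L (@costau_continuous e 0 0) h; rewrite add0r.
Qed.

Lemma endY_shift e : endY e 0 0 = Y (L + e) - Y e.
Proof.
have h s : is_derive s (1 : R) (fun t => Y (t + e)) (sin (theta (tau e 0 0 s))).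
  by rewrite tau_shift; exact: derive_shift1 dY s.
by have := primitive_eq L (@sintau_continuous e 0 0) h; rewrite add0r.
Qed.

Lemma endX_near e c d : `|endX e c d - X L| <= K * L * (`|e| + `|c| + `|d|).
Proof.
have := endX_lip e c d 0 0 0; rewrite endX_shift addr0 X0 !subr0 => h.
by rewrite mulrAC.
Qed.

Lemma endY_near e c d : `|endY e c d - Y L| <= K * L * (`|e| + `|c| + `|d|).
Proof.
have := endY_lip e c d 0 0 0; rewrite endY_shift addr0 Y0 !subr0 => h.
by rewrite mulrAC.
Qed.

Lemma X_first_order k0 rho0 t : K * rho0 <= k0 -> `|t| <= rho0 ->
  `|X t - cos (theta 0) * t| <= k0 * `|t|.
Proof.
move=> Kr tr.
pose Z s := X s - cos (theta 0) * s.
have dZ s : is_derive s (1 : R) Z (cos (theta s) - cos (theta 0)).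
  have := is_derive1B (dX s) (is_derive1Z (cos (theta 0)) (is_derive_id s (1 : R))).
  by rewrite mulr1.
have bnd s : `|s| <= rho0 -> `|cos (theta s) - cos (theta 0)| <= k0.
  move=> sr; apply: le_trans (cos_theta_lip _ _) _; rewrite subr0.
  by apply: le_trans Kr; rewrite ler_wpM2l.
have Z0 : Z 0 = 0 by rewrite /Z X0; ring.
have [t0|t0] := leP 0 t.
  rewrite (ger0_norm t0) in tr *.
  have H : `|Z t - Z 0| <= k0 * (t - 0).
    apply: (derive_norm_le t0 (fun x _ => dZ x)) => x xt.
    by apply: bnd; rewrite ger0_norm; lra.
  by rewrite Z0 !subr0 in H.
rewrite (ltr0_norm t0) in tr *.
have H : `|Z 0 - Z t| <= k0 * (0 - t).
  apply: (derive_norm_le (ltW t0) (fun x _ => dZ x)) => x xt.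
  by apply: bnd; rewrite ler0_norm; lra.
by rewrite Z0 !sub0r normrN in H.
Qed.

(** With the factor [rate] the integrand would be the derivative of [X (tau s)]. So [endX] is
    [X (L + e) - X (e + c + d)] plus the integral of [cos (theta (tau s)) (c chi1 s + d chi2 s)],
    where the cosine is about [q] on the first window and about 0 on the second. Expanding [X] at 0,
    the terms in [e] and [c] cancel and [X L - q d] remains. *)
Lemma endX_first_order k0 e c d :
  (forall s, X (s + L) = X L + X s) ->
  (forall s, 0 <= s <= L -> chi1 s != 0 ->
    `|cos (theta (tau e c d s)) - cos (theta 0)| <= k0) ->
  (forall s, 0 <= s <= L -> chi2 s != 0 -> `|cos (theta (tau e c d s))| <= k0) ->
  K * (`|e| + `|c| + `|d|) <= k0 ->
  `|endX e c d - X L + cos (theta 0) * d| <= 2 * k0 * (`|e| + `|c| + `|d|).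
Proof.
move=> XS h1 h2 hK; set q := cos (theta 0) in h1 *.
set N := `|e| + `|c| + `|d|.
have k0ge : 0 <= k0 by apply: le_trans hK; rewrite mulr_ge0 // !addr_ge0.
pose A := primitive (fun s => cos (theta (tau e c d s))).
have dA := is_derive_primitive (@costau_continuous e c d).
have dXt s : is_derive s (1 : R) (fun t => X (tau e c d t)) (cos (theta (tau e c d s)) * rate c d s).
  exact: (is_derive1_chain (dX (tau e c d s)) (tau_derive e c d s)).
pose Z s := A s - X (tau e c d s) - c * q * B1 s.
pose z s := cos (theta (tau e c d s)) * (c * chi1 s + d * chi2 s) - c * q * chi1 s.
have dZ s : is_derive s (1 : R) Z (z s).
  apply: (is_derive_eq (is_derive1B (is_derive1B (dA s) (dXt s)) (is_derive1Z (c * q) (dB1 s)))).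
  by rewrite /z /rate; ring.
(* A majorant that grows like [Z]: a uniform bound of [z] would bring in the heights of [chi1] and
   [chi2], whereas their integrals are 1. *)
pose W s := k0 * (`|c| * B1 s + `|d| * B2 s).
pose w s := k0 * (`|c| * chi1 s + `|d| * chi2 s).
have dW s : is_derive s (1 : R) W (w s).
  exact: (is_derive1Z k0 (is_derive1D (is_derive1Z `|c| (dB1 s)) (is_derive1Z `|d| (dB2 s)))).
have zw s : 0 <= s <= L -> `|z s| <= w s.
  move=> sL.
  have -> : z s = (cos (theta (tau e c d s)) - q) * (c * chi1 s) + cos (theta (tau e c d s)) * (d * chi2 s).
    by rewrite /z; ring.
  rewrite /w mulrDr; apply: le_trans (ler_normD _ _) _; apply: lerD.
    have [->|n0] := eqVneq (chi1 s) 0; first by rewrite !mulr0 normr0.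
    rewrite !normrM (ger0_norm (chi1_ge0 s)).
    by apply: ler_wpM2r; [rewrite mulr_ge0|exact: h1].
  have [->|n0] := eqVneq (chi2 s) 0; first by rewrite !mulr0 normr0.
  rewrite !normrM (ger0_norm (chi2_ge0 s)).
  by apply: ler_wpM2r; [rewrite mulr_ge0|exact: h2].
have cZ := derivable_continuous dZ; have cW := derivable_continuous dW.
have up : Z L - Z 0 <= W L - W 0.
  have dWZ s : is_derive s (1 : R) (fun t => W t - Z t) (w s - z s) by exact: is_derive1B.
  have := @ge0_derive_le R _ _ 0 L (ltW L0) (continuous_subspaceT (derivable_continuous dWZ)) (fun x _ => dWZ x).
  move=> /(_ _)/wrap[s sL|]; last by lra.
  by have := zw s ltac:(lra); rewrite ler_norml; lra.
have lo : - (W L - W 0) <= Z L - Z 0.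
  have dWZ s : is_derive s (1 : R) (fun t => W t + Z t) (w s + z s) by exact: is_derive1D.
  have := @ge0_derive_le R _ _ 0 L (ltW L0) (continuous_subspaceT (derivable_continuous dWZ)) (fun x _ => dWZ x).
  move=> /(_ _)/wrap[s sL|]; last by lra.
  by have := zw s ltac:(lra); rewrite ler_norml; lra.
have WE : W L - W 0 = k0 * (`|c| + `|d|) by rewrite /W B10 B20 B1L B2L; ring.
have ZE : Z L - Z 0 = endX e c d - X L - X e + X (e + c + d) - c * q.
  rewrite /Z /tau B10 B20 B1L B2L /A primitive0 -/(endX e c d).
  have -> : e + c + d + L - c * 1 - d * 1 = e + L by ring.
  have -> : e + c + d + 0 - c * 0 - d * 0 = e + c + d by ring.
  by rewrite XS; ring.
have ecd : `|e + c + d| <= N.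
  by apply: le_trans (ler_normD _ _) _; rewrite lerD2r ler_normD.
have eN : `|e| <= N by rewrite /N -addrA lerDl addr_ge0.
have x1 := X_first_order hK eN; have x2 := X_first_order hK ecd.
rewrite -/q in x1 x2.
have x3 : k0 * `|e + c + d| <= k0 * N by rewrite ler_wpM2l.
rewrite WE ZE in up lo.
move: x1 x2; rewrite !ler_norml => /andP[x4 x5] /andP[x6 x7].
have EN : 2 * k0 * N = k0 * N + k0 * `|e| + k0 * (`|c| + `|d|) by rewrite /N; ring.
rewrite EN; exact: (first_order_arith up lo x3 x4 x5 x6 x7).
Qed.

Context (XS : forall s, X (s + L) = X L + X s) (YS : forall s, Y (s + L) = - Y s).
Context (YL : Y L = 0).
(** [k0] is the tolerated deviation of [cos theta], [h] the scale of the windows around which this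
    deviation is controlled, and [rho] the range of the parameters [e], [c], [d]. *)
Context (k0 h rho s2 M1 M2 : R).
Context (k0_gt0 : 0 < k0) (qk : 32 * k0 = `|cos (theta 0)|) (Dq : 0 < X L * cos (theta 0)).
Context (h0 : 0 < h) (hK : K * (3 * h) <= k0) (cs2 : cos (theta s2) = 0).
Context (win1 : forall s, chi1 s != 0 -> h < s < 2 * h).
Context (win2 : forall s, chi2 s != 0 -> s2 - h < s < s2 + h).
Context (rho0 : 0 < rho) (rhoh : rho <= h) (rhoC : 2 * (K * L) ^+ 2 * rho <= `|X L| * k0).
Context (M1chi : forall s, chi1 s <= M1) (M2chi : forall s, chi2 s <= M2).
Context (rhoM1 : rho * M1 <= 1 / 4) (rhoM2 : rho * M2 <= 1 / 4).
Local Notation size e c d := (`|e : R| + `|c : R| + `|d : R|).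

Definition endsq e c d := endX e c d ^+ 2 + endY e c d ^+ 2.

(** [Y L = 0] makes [endY] contribute only at second order. The bound on [rho] turns all quadratic
    terms into one unit of [|X L| k0 N], with [N] the size of the parameters; the first-order error
    accounts for the other four. *)
Lemma endsq_near e c d : size e c d <= rho ->
  `|endsq e c d - X L ^+ 2 + 64 * (`|X L| * k0) * d| <= 5 * (`|X L| * k0) * size e c d.
Proof.
move=> Nr.
have N0 : 0 <= size e c d by rewrite !addr_ge0.
have KN : K * (size e c d) <= K * h by rewrite ler_wpM2l // (le_trans Nr).
have Kh : 0 <= K * h by rewrite mulr_ge0 // ltW.
have hK' : 3 * (K * h) <= k0 by move: hK; rewrite mulrCA.
apply: (@endsq_arith R (X L) (cos (theta 0)) k0 (K * L) _ d rho) => //; try exact: ltW.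
(* Origin of [3 h]: as [N <= rho <= h], [tau s] stays within [3 h] of 0 for [s] in the first window
   and within [2 h] of [s2] for [s] in the second. *)
- apply: (endX_first_order XS).
  + move=> s sL /win1 sw; apply: le_trans (cos_theta_lip _ _) _.
    rewrite subr0; apply: le_trans hK; apply: ler_wpM2l => //.
    have t1 := tau_near e c d sL.
    have -> : tau e c d s = (tau e c d s - s) + s by ring.
    apply: le_trans (ler_normD _ _) _; rewrite (ger0_norm (x := s)); last by lra.
    have t2 := le_trans t1 (le_trans Nr rhoh).
    have -> : 3 * h = h + 2 * h by ring.
    by apply: lerD => //; case/andP: sw => _ /ltW.
  + move=> s sL /win2 sw; rewrite -[cos _]subr0 -cs2.
    apply: le_trans (cos_theta_lip _ _) _.
    apply: le_trans hK; apply: ler_wpM2l => //.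
    have t1 := tau_near e c d sL.
    have -> : tau e c d s - s2 = (tau e c d s - s) + (s - s2) by ring.
    apply: le_trans (ler_normD _ _) _.
    have t2 := le_trans t1 (le_trans Nr rhoh).
    have t3 : `|s - s2| <= h by move: sw; rewrite ler_norml => /andP[? ?]; apply/andP; split; lra.
    by apply: le_trans (lerD t2 t3) _; lra.
  + lra.
- exact: endX_near.
- have := endY_near e c d.
  by rewrite YL subr0.
- by rewrite N0.
Qed.

Lemma rate_near c d s : `|c| + `|d| <= rho -> 1 / 2 <= rate c d s <= 3 / 2.
Proof.
move=> cd.
have P (z x M : R) : `|z| <= rho -> 0 <= x -> x <= M -> rho * M <= 1 / 4 -> `|z * x| <= 1 / 4.
  move=> zr x0 xM rM; apply: le_trans rM; rewrite normrM (ger0_norm x0); exact: ler_pM.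
have c0 := normr_ge0 c; have d0 := normr_ge0 d.
have := P c (chi1 s) M1 ltac:(lra) (chi1_ge0 s) (M1chi s) rhoM1.
have := P d (chi2 s) M2 ltac:(lra) (chi2_ge0 s) (M2chi s) rhoM2.
by rewrite /rate !ler_norml; lra.
Qed.

Lemma rate_le1 d s : 0 <= d -> rate 0 d s <= 1.
Proof. by move=> d0; rewrite /rate mul0r subr0 gerBl mulr_ge0. Qed.

(** By the symmetries [endX] remains [X L] and [endY] becomes [- 2 Y e]. *)
Lemma endsq_shift e : endsq e 0 0 = X L ^+ 2 + 4 * Y e ^+ 2.
Proof.
rewrite /endsq endX_shift endY_shift.
by rewrite (addrC L) XS YS; ring.
Qed.

Lemma affine_path_continuous (g : R -> R -> R) C e0 d0 e1 d1 : 0 <= C ->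
  (forall e d e' d', `|g e d - g e' d'| <= C * (`|e - e'| + `|d - d'|)) ->
  continuous (fun t => g ((1 - t) * e0 + t * e1) ((1 - t) * d0 + t * d1)).
Proof.
move=> C0 hg t; apply/cvgrPdist_le => z z0.
pose m := C * (`|e1 - e0| + `|d1 - d0|).
have m0 : 0 <= m by rewrite mulr_ge0 // addr_ge0.
near=> u; apply: le_trans (hg _ _ _ _) _.
have -> : (1 - t) * e0 + t * e1 - ((1 - u) * e0 + u * e1) = (t - u) * (e1 - e0) by ring.
have -> : (1 - t) * d0 + t * d1 - ((1 - u) * d0 + u * d1) = (t - u) * (d1 - d0) by ring.
rewrite !normrM -mulrDr mulrCA -/m.
have tu : `|t - u| <= z / (m + 1).
  by near: u; apply: cvgr_dist_le; [exact: cvg_id|rewrite divr_gt0 //; lra].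
apply: (@le_trans _ _ (z / (m + 1) * (m + 1))).
  by apply: ler_pM => //; lra.
by rewrite divfK // gt_eqF //; lra.
Unshelve. all: by end_near. Qed.

(** Strict inequalities at both ends exclude [t = 0] and [t = 1]; [0 < t] will make the cut piece
    [d] nonempty. *)
Lemma endsq_ivt e0 d0 e1 d1 c v : v < endsq e0 c d0 -> endsq e1 c d1 < v ->
  exists2 t, 0 < t < 1 & endsq ((1 - t) * e0 + t * e1) c ((1 - t) * d0 + t * d1) = v.
Proof.
move=> h1 h2.
pose g t := endsq ((1 - t) * e0 + t * e1) c ((1 - t) * d0 + t * d1).
have KL : 0 <= K * L by rewrite mulr_ge0 // ltW.
have cg : continuous g.
  move=> t; apply: cvgD.
    under eq_fun do rewrite expr2; rewrite expr2.
    have lx : continuous (fun t => endX ((1 - t) * e0 + t * e1) c ((1 - t) * d0 + t * d1)).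
      apply: (@affine_path_continuous (fun e d => endX e c d) (K * L)) => // e d e' d'.
      have := endX_lip e c d e' c d'.
      by rewrite subrr normr0 addr0 mulrAC.
    by apply: cvgM; exact: lx.
  under eq_fun do rewrite expr2; rewrite expr2.
  have ly : continuous (fun t => endY ((1 - t) * e0 + t * e1) c ((1 - t) * d0 + t * d1)).
    apply: (@affine_path_continuous (fun e d => endY e c d) (K * L)) => // e d e' d'.
    have := endY_lip e c d e' c d'.
    by rewrite subrr normr0 addr0 mulrAC.
  by apply: cvgM; exact: ly.
have g0 : g 0 = endsq e0 c d0 by rewrite /g !mul0r !addr0 !subr0 !mul1r.
have g1 : g 1 = endsq e1 c d1 by rewrite /g !subrr !mul0r !add0r !mul1r.
have [|t t01 gt] := @IVT R g 0 1 v ler01 (continuous_subspaceT cg).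
  by rewrite g0 g1 (min_idPr _) ?(max_idPl _) ?(ltW h1) ?(ltW h2) //; exact: ltW (lt_trans h2 h1).
exists t => //.
move: t01; rewrite in_itv /= => /andP[t0 t1].
have n0 : t != 0 by apply/eqP => tE; rewrite tE g0 in gt; lra.
have n1 : t != 1 by apply/eqP => tE; rewrite tE g1 in gt; lra.
by rewrite !lt_def n0 t0 eq_sym n1.
Qed.

Context (f : R -> \bar R) (f_ge0 : forall x : R, 0 <= x -> (0 <= f x)%E).
Context (f_borel : measurable_fun (`[0, +oo[ : set R) f).
Context (fcvx : strictly_convex_nneg f) (ck : continuous kappa).
Context (kanti : forall s, kappa (s + L) = - kappa s) (k00 : kappa 0 = 0).
Context (kn0 : forall s, 0 < s < L -> kappa s != 0).
Context (B2lo : forall s, s <= s2 - h -> B2 s = 0) (B2hi : forall s, s2 + h <= s -> B2 s = 1).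
Context (s2h : 2 * h <= s2) (s2L : s2 + 3 * h <= L).
Local Notation mu := (@lebesgue_measure R).

Let A := `|X L| * k0.
Let A0 : 0 < A.
Proof.
by rewrite mulr_gt0 // normr_gt0; apply/eqP => XL0; move: Dq; rewrite XL0 mul0r ltxx.
Qed.

(** On [[0, h]] the cosine varies by at most [k0] from a value of modulus [32 k0], so it has no zero
    and [lifted_height] applies. *)
Lemma small_lift eps : 0 < eps -> eps <= h -> exists2 e, 0 < e <= eps & Y e != 0.
Proof.
move=> e0 eh; have [q1 q2 q3] := And3 h0 s2h s2L.
have cn s : 0 < s < eps -> cos (theta s) != 0.
  move=> se; apply/eqP => c0.
  have := cos_theta_lip s 0; rewrite c0 sub0r normrN -qk subr0 ger0_norm; last by lra.
  have h1 : K * s <= K * (3 * h) by apply: ler_wpM2l => //; lra.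
  by move=> h2; have h3 : 32 * k0 <= k0 := le_trans h2 (le_trans h1 hK); have := k0_gt0; lra.
have kn s : 0 < s < eps -> kappa s != 0 by move=> se; apply: kn0; lra.
have [Ye|Ye] := lifted_height e0 dth dY Y0 kn cn.
  by exists eps => //; rewrite e0 lexx.
by exists (eps / 2) => //; lra.
Qed.

(** The segment runs from the pure translation [e = eps] to the pure cut [d = eps]. Along it
    [e + d = eps], so the piece removed stays in [[0, eps]], where [kappa] is small enough for the
    bound [l]. *)
Lemma competitor_energy_lt :
  (\int[mu]_(s in `]0%R, L[) f `|kappa s|%R < +oo)%E -> exists e d,
  [/\ size e 0 d <= rho, endsq e 0 d = X L ^+ 2 &
    (\int[mu]_(s in `]0%R, L[) f `|(kappa (tau e 0 d s) * rate 0 d s)%R|%R <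
     \int[mu]_(s in `]0%R, L[) f `|kappa s|%R)%E].
Proof.
move=> fin; have [q1 q2 q3 q4] := And4 h0 s2h s2L rhoh.
(* As [e + d = eps <= h], the arc to be stretched, the image under [tau] of the second window, lies
   in [[s2 - h, s2 + 2 h]], away from the zeros of [kappa]. *)
have w2 : s2 - h <= s2 + 2 * h by lra.
have [|x1 x10 hx1] := @positive_min R kappa (s2 - h) (s2 + 2 * h) w2 ck.
  by move=> s hs; apply: kn0; lra.
have [l [l' [t0 [ll t00 hl gap]]]] := intercept_gap f_ge0 fcvx x10.
have [eta eta0 heta] := uniform_continuity 0 L ck t00.
pose eps0 := Num.min eta rho.
have eps00 : 0 < eps0 by rewrite lt_min eta0.
have [eps1 eps2] : eps0 <= eta /\ eps0 <= rho by rewrite !ge_min !lexx orbT.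
have [eps /andP[eps_gt0 eps_le] Yeps] := small_lift eps00 (le_trans eps2 rhoh).
have G0 : X L ^+ 2 < endsq eps 0 0.
  by rewrite endsq_shift ltrDl mulr_gt0 // exprn_even_gt0.
have N1 : size (0 : R) 0 eps = eps by rewrite normr0 !add0r gtr0_norm.
have G1 : endsq 0 0 eps < X L ^+ 2.
  have := @endsq_near 0 0 eps; rewrite N1 => /(_ (le_trans eps_le eps2)).
  have := mulr_gt0 A0 eps_gt0; rewrite -/A ler_norml => h1 /andP[_ h2].
  have e1 : 64 * A * eps = 64 * (A * eps) by ring.
  have e2 : 5 * A * eps = 5 * (A * eps) by ring.
  by rewrite e1 e2 in h2; lra.
have [t t01] := endsq_ivt G0 G1.
rewrite !mulr0 addr0 add0r.
set e := (1 - t) * eps; set d := t * eps => Gt.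
have d0 : 0 < d by rewrite mulr_gt0 //; lra.
have e0 : 0 <= e by rewrite mulr_ge0 //; lra.
have ed : e + d = eps by rewrite /e /d; ring.
have sz : size e 0 d = eps by rewrite normr0 addr0 !ger0_norm // ltW.
have cd : `|0 : R| + `|d| <= rho by rewrite normr0 add0r gtr0_norm //; lra.
exists e, d; split => //; first by rewrite sz; exact: le_trans eps2.
have chi0 s : ~ (s2 - h < s < s2 + h) -> chi2 s = 0.
  by move=> ns; apply/eqP/negPn/negP => /win2.
have eL : e <= L by lra.
have lo0 : 0 <= s2 - h by lra.
have lohi : s2 - h < s2 + h by lra.
have hiL : s2 + h <= L by lra.
apply: (@energy_decrease R f kappa f_ge0 f_borel fcvx ck L (tau e 0 d) (rate 0 d)
  (s2 - h) (s2 + h) e d x1 l l') => //.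
- by move=> s; rewrite kanti normrN.
- exact: rate_continuous.
- exact: tau_derive.
- by move=> s; rewrite (rate_le1 s (ltW d0)) andbT; case/andP: (rate_near s cd).
- move=> s sl; rewrite /tau /rate (B2lo sl) (chi0 s); last by lra.
  by split; ring.
- move=> s sl; rewrite /tau /rate (B2hi sl) (chi0 s); last by lra.
  by split; ring.
- by move=> y hy; apply: hx1; lra.
- move=> y hy; apply: hl; rewrite normr_ge0 /=.
  have := heta 0 y; rewrite k00 !subr0; apply; first by lra.
  by rewrite ger0_norm; lra.
Qed.

(* [f 0] may be [+oo], so the competitor must avoid the zeros of [kappa] at the
   endpoints: [e = - c / 4] and [|d| <= c / 2] keep [tau] in [c / 4, L - c / 4]. *)
Lemma competitor_energy_fin : exists e c d,
  [/\ size e c d <= rho, endsq e c d = X L ^+ 2 &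
    (\int[mu]_(s in `]0%R, L[) f `|kappa (tau e c d s) * rate c d s|%R < +oo)%E].
Proof.
have [q1 q2 q3 q4 q5] := And5 h0 s2h s2L rhoh rho0.
(* The size is at most [c / 4 + c + c / 2 = 7 c / 4 <= rho]. At [d = c / 2] and [d = - c / 2] the
   main term has modulus [32 A c] and the error is at most [5 * 7 / 4 A c], so the two ends give
   opposite signs. *)
pose c := rho / 2; pose e := - (c / 4).
have c0 : 0 < c by rewrite divr_gt0.
have ec : `|e| = c / 4 by rewrite normrN gtr0_norm //; lra.
have Ac := mulr_gt0 A0 c0.
have szle d : `|d| <= c / 2 -> size e c d <= 7 / 4 * c.
  by move=> hd; rewrite ec (gtr0_norm c0); lra.
have c7 : 7 / 4 * c <= rho by rewrite /c; lra.
have near d : `|d| <= c / 2 ->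
    `|endsq e c d - X L ^+ 2 + 64 * A * d| <= 35 / 4 * (A * c).
  move=> hd; have hs := szle d hd; apply: le_trans (endsq_near (le_trans hs c7)) _.
  have -> : 35 / 4 * (A * c) = 5 * A * (7 / 4 * c) by field.
  by rewrite ler_wpM2l // mulr_ge0 // ltW.
have G0 : X L ^+ 2 < endsq e c (- (c / 2)).
  have := near (- (c / 2)); rewrite normrN ger0_norm; last by lra.
  move=> /(_ (lexx _)); rewrite ler_norml => /andP[h1 _].
  have e1 : 64 * A * - (c / 2) = - (32 * (A * c)) by field.
  by rewrite e1 in h1; lra.
have G1 : endsq e c (c / 2) < X L ^+ 2.
  have := near (c / 2); rewrite ger0_norm; last by lra.
  move=> /(_ (lexx _)); rewrite ler_norml => /andP[_ h1].
  have e1 : 64 * A * (c / 2) = 32 * (A * c) by field.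
  by rewrite e1 in h1; lra.
have [t t01] := endsq_ivt G0 G1.
have -> : (1 - t) * e + t * e = e by ring.
set d := _ + _ => Gt.
have tc : 0 < t * c < c by rewrite mulr_gt0 ?gtr_pMl //; lra.
have dE : d = t * c - c / 2 by rewrite /d; field.
have hd : `|d| <= c / 2 by rewrite ler_norml dE; lra.
have sz := le_trans (szle d hd) c7.
have cd : `|c| + `|d| <= rho by apply: le_trans sz; rewrite -addrA lerDr.
exists e, c, d; split => //.
have dtau s := tau_derive e c d s.
have ctau := derivable_continuous dtau.
have tmono x y : x <= y -> tau e c d x <= tau e c d y.
  move=> xy; apply: (ge0_derive_le xy (continuous_subspaceT ctau) (fun x _ => dtau x)).
  by move=> s _; have := rate_near s cd; lra.
have t0E : tau e c d 0 = e + c + d by rewrite /tau B10 B20; ring.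
have tLE : tau e c d L = L + e by rewrite /tau B1L B2L; ring.
have tin s : 0 <= s <= L -> c / 4 <= tau e c d s <= L - c / 4.
  move=> /andP[s0 sL]; have := tmono _ _ s0; have := tmono _ _ sL.
  by rewrite t0E tLE /e; move: hd; rewrite ler_norml; lra.
have cL : c / 4 <= L - c / 4 by rewrite /c; lra.
have [|m m0 hm] := @positive_min R kappa (c / 4) (L - c / 4) cL ck.
  by move=> s hs; apply: kn0; lra.
apply: (@energy_finite R f kappa f_ge0 f_borel fcvx ck L (tau e c d) (rate c d)
  (m / 2) (K * (3 / 2))) => //.
- by lra.
- exact: rate_continuous.
move=> s sL; have hr := rate_near s cd; have hk := hm _ (tin s sL).
rewrite normrM (ger0_norm (x := rate c d s)); last by lra.
apply/andP; split; last by apply: ler_pM => //; lra.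
have -> : m / 2 = m * (1 / 2) by field.
by apply: ler_pM => //; lra.
Qed.

End Endpoint.

(** * Choice of the constants and conclusion *)

Lemma mulr_le_of_le_div (R : realType) (a b x : R) : 0 <= a -> 0 <= x -> x <= b / (a + 1) ->
  x * a <= b.
Proof.
move=> a0 x0; rewrite ler_pdivlMr; last by lra.
by move=> h; apply: le_trans h; rewrite mulrDr mulr1 lerDl.
Qed.

Lemma common_lower_bound (R : realType) (a b c : R) : 0 < a -> 0 < b -> 0 < c ->
  exists h, [/\ 0 < h, h <= a, h <= b & h <= c].
Proof.
move=> a0 b0 c0; exists (Num.min a (Num.min b c)).
by rewrite !lt_min a0 b0 c0 !ge_min !lexx !orbT.
Qed.

(** [C] bounds every rate of change involved: 1 for [tau], [M1 + M2] for [rate], [K L] for both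
    coordinates of the endpoint. Small parameters thus meet all the closeness conditions of
    [local_minimizer_competitor]. *)
Lemma local_minimizer_family (R : realType) (L p : R) P0 P1 f (gamma : R -> R * R)
    (kappa theta X Y B1 chi1 B2 chi2 : R -> R) u1 u2 K M1 M2 :
  0 < L -> 0 < p -> measurable_fun (`[0, +oo[ : set R) f ->
  curve_form L gamma kappa theta X Y u1 u2 -> Y L = 0 -> X L != 0 ->
  is_signed_curvature L gamma kappa ->
  local_minimizer L p (energy L f) (A_pin L p P0 P1) gamma ->
  0 <= K -> (forall s, `|kappa s| <= K) ->
  continuous chi1 -> continuous chi2 ->
  (forall s, is_derive s (1 : R) B1 (chi1 s)) -> (forall s, is_derive s (1 : R) B2 (chi2 s)) ->
  (forall s, 0 <= chi1 s <= M1) -> (forall s, 0 <= chi2 s <= M2) ->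
  B1 0 = 0 -> B1 L = 1 -> B2 0 = 0 -> B2 L = 1 ->
  exists2 delta, 0 < delta & forall e c d, `|e| + `|c| + `|d| <= delta ->
    endsq L theta B1 B2 e c d = X L ^+ 2 ->
    (\int[lebesgue_measure]_(s in `]0%R, L[) f `|kappa s|%R <=
     \int[lebesgue_measure]_(s in `]0%R, L[)
       f `|(kappa (tau B1 B2 e c d s) * rate chi1 chi2 c d s)%R|%R)%E.
Proof.
move=> L0 p0 mf cf YL XL sck lm K0 Kk cchi1 cchi2 dB1 dB2 hM1 hM2 B10 B1L B20 B2L.
have [delta delta0 H] := local_minimizer_competitor L0 p0 mf cf YL XL sck lm.
have [ck dth dX dY X0 Y0 _ _] := cf.
have chi1_ge0 s : 0 <= chi1 s by case/andP: (hM1 s).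
have chi2_ge0 s : 0 <= chi2 s by case/andP: (hM2 s).
have M10 : 0 <= M1 by case/andP: (hM1 0) => a b; exact: le_trans b.
have M20 : 0 <= M2 by case/andP: (hM2 0) => a b; exact: le_trans b.
pose C := K * L + M1 + M2 + 1.
have KL : 0 <= K * L by rewrite mulr_ge0 // ltW.
have C1 : 0 < C + 1 by rewrite /C; lra.
exists (delta / (C + 1)); first by rewrite divr_gt0.
move=> e c d Nd G.
have N0 : 0 <= `|e| + `|c| + `|d| by rewrite !addr_ge0.
have CN : (`|e| + `|c| + `|d|) * C <= delta by apply: mulr_le_of_le_div; rewrite // /C; lra.
have le_delta M : 0 <= M -> M <= C -> M * (`|e| + `|c| + `|d|) <= delta.
  by move=> M0 MC; apply: le_trans CN; rewrite mulrC ler_wpM2l.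
have N1 : `|e| + `|c| + `|d| <= delta.
  by have := le_delta 1 ler01; rewrite mul1r; apply; rewrite /C; lra.
apply: H.
- exact: rate_continuous.
- exact: tau_derive.
- move=> s sL; split.
    by apply: le_trans N1; exact: (tau_near dB1 dB2 chi1_ge0 chi2_ge0 B10 B1L B20 B2L).
  apply: le_trans (le_delta (M1 + M2) ltac:(lra) ltac:(rewrite /C; lra)).
  have -> : rate chi1 chi2 c d s - 1 = - (c * chi1 s + d * chi2 s) by rewrite /rate; ring.
  rewrite normrN mulrDl; apply: le_trans (ler_normD _ _) _.
  have cN : `|c| <= `|e| + `|c| + `|d| by rewrite addrAC lerDr addr_ge0.
  have dN : `|d| <= `|e| + `|c| + `|d| by rewrite lerDr addr_ge0.
  apply: lerD; rewrite normrM mulrC; apply: ler_pM => //; rewrite ger0_norm //.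
    by case/andP: (hM1 s).
  by case/andP: (hM2 s).
- apply: le_trans (le_delta (K * L) KL ltac:(rewrite /C; lra)).
  exact: (endX_near L0 K0 Kk dth dX X0 dB1 dB2 chi1_ge0 chi2_ge0 B10 B1L B20 B2L).
- apply: le_trans (le_delta (K * L) KL ltac:(rewrite /C; lra)).
  have := endY_near L0 K0 Kk dth dY Y0 dB1 dB2 chi1_ge0 chi2_ge0 B10 B1L B20 B2L e c d.
  by rewrite YL subr0.
- exact: G.
Qed.

Theorem theorem2p8 (R : realType) (p L : R) (P0 P1 : R * R)
    (f : R -> \bar R) (gamma : R -> R * R)
    (p_gt1 : 1 < p) (L_gt0 : 0 < L) (P01 : enorm (P0 - P1) < L)
    (f_ge0 : forall x : R, 0 <= x -> (0 <= f x)%E)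
    (f_borel : measurable_fun (`[0, +oo[ : set R) f)
    (f_convex : strictly_convex_nneg f)
    (gamma_pin : A_pin L p P0 P1 gamma)
    (gamma_fold : half_fold_well_periodic 1 L gamma)
    (gamma_ninj : ~ {in `]0, L[ &, injective gamma})
    (gamma_dir : 0 < dot (velocity L gamma 0) (P1 - P0)) :
  ~ local_minimizer L p (energy L f) (A_pin L p P0 P1) gamma.
Proof.
move=> lm; have [W al g0 gL] := gamma_pin.
have p0 : 0 < p by apply: lt_trans p_gt1.
have [kappa [ck sck kodd kanti kn0]] := half_fold_kappa L_gt0 gamma_fold.
have [theta [X [Y [u1 [u2 [th0 cf]]]]]] := curve_formP L_gt0 W al sck ck kn0.
have [XT XS YS YL] := curve_form_symmetry cf kodd kanti th0.
have [s2 s2L cs2] := vertical_tangent cf gamma_ninj.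
have Dq : 0 < X L * cos (theta 0) by rewrite -(chord_direction L_gt0 cf YL) g0 gL.
have [_ dth dX dY X0 Y0 _ _] := cf.
have [K K0 Kk] := antiperiodic_bounded L_gt0 ck kanti.
have kap0 : kappa 0 = 0 by have := kodd 0; rewrite oppr0 => h; clear -h; lra.
have XL : X L != 0 by apply/eqP => XL0; rewrite XL0 mul0r ltxx in Dq.
have q0 : cos (theta 0) != 0 by apply/eqP => c0; rewrite c0 mulr0 ltxx in Dq.
pose k0 := `|cos (theta 0)| / 32.
have qk : 32 * k0 = `|cos (theta 0)| by rewrite /k0; field.
have k00 : 0 < k0 by rewrite divr_gt0 // normr_gt0.
have K31 : 0 < 3 * K + 1 by clear -K0; lra.
(* The first two bounds keep the second window and its displaced image inside []0, L[]; the third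
   gives [3 K h <= k0]. *)
have [h [h0 h1 h2 h3]] := @common_lower_bound R (s2 / 2) ((L - s2) / 3) (k0 / (3 * K + 1))
  ltac:(clear -s2L; lra) ltac:(clear -s2L; lra) (divr_gt0 k00 K31).
have hK : K * (3 * h) <= k0.
  have -> : K * (3 * h) = h * (3 * K) by ring.
  by apply: mulr_le_of_le_div => //; [clear -K0; lra|exact: ltW].
have [s2h s2L3] : 2 * h <= s2 /\ s2 + 3 * h <= L by clear -h1 h2; split; lra.
have w1 : h < 2 * h by clear -h0; lra.
have w2 : s2 - h < s2 + h by clear -h0; lra.
have [B1 [chi1 [M1 [cchi1 dB1 hM1 win1 [B1lo B1hi]]]]] := cutoff_exists w1.
have [B2 [chi2 [M2 [cchi2 dB2 hM2 win2 [B2lo B2hi]]]]] := cutoff_exists w2.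
have [B10 B20] : B1 0 = 0 /\ B2 0 = 0 by split; [apply: B1lo|apply: B2lo]; clear -h0 s2h; lra.
have [B1L B2L] : B1 L = 1 /\ B2 L = 1 by split; [apply: B1hi|apply: B2hi]; clear -h0 s2h s2L3; lra.
have [delta delta0 H] := local_minimizer_family L_gt0 p0 f_borel cf YL XL sck lm K0 Kk
  cchi1 cchi2 dB1 dB2 hM1 hM2 B10 B1L B20 B2L.
have M1chi s : chi1 s <= M1 by case/andP: (hM1 s).
have M2chi s : chi2 s <= M2 by case/andP: (hM2 s).
have chi1_ge0 s : 0 <= chi1 s by case/andP: (hM1 s).
have chi2_ge0 s : 0 <= chi2 s by case/andP: (hM2 s).
have M10 : 0 <= M1 by exact: le_trans (chi1_ge0 0) (M1chi 0).
have M20 : 0 <= M2 by exact: le_trans (chi2_ge0 0) (M2chi 0).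
pose C := 2 * (K * L) ^+ 2.
have C0 : 0 <= C by rewrite mulr_ge0 // sqr_ge0.
have XL0 : 0 < `|X L| by rewrite normr_gt0.
have quarter : 0 < 1 / 4 :> R by rewrite divr_gt0.
(* The first bound absorbs the second-order terms of [endsq]; the other two keep [rate] between
   [1 / 2] and [3 / 2]. Adding 1 to each denominator covers vanishing constants. *)
have [rho1 [rho10 rho1C rho1M1 rho1M2]] := @common_lower_bound R (`|X L| * k0 / (C + 1))
  (1 / 4 / (M1 + 1)) (1 / 4 / (M2 + 1))
  (divr_gt0 (mulr_gt0 XL0 k00) (ltr_wpDl C0 ltr01))
  (divr_gt0 quarter (ltr_wpDl M10 ltr01)) (divr_gt0 quarter (ltr_wpDl M20 ltr01)).
have [rho [rho0 rhoh rhod rhorho1]] := common_lower_bound h0 delta0 rho10.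
have bound M b : 0 <= M -> rho1 <= b / (M + 1) -> rho * M <= b.
  by move=> M0 hb; apply: mulr_le_of_le_div => //; [exact: ltW|exact: le_trans hb].
have rhoC : C * rho <= `|X L| * k0 by rewrite mulrC; exact: bound.
have rhoM1 : rho * M1 <= 1 / 4 by exact: bound.
have rhoM2 : rho * M2 <= 1 / 4 by exact: bound.
have [Ffin|Finf] := ltP (\int[lebesgue_measure]_(s in `]0%R, L[) f `|kappa s|%R)%E +oo%E.
  have [e [d [sz G]]] := competitor_energy_lt L_gt0 K0 Kk dth dX dY X0 Y0 cchi1 cchi2
    dB1 dB2 chi1_ge0 chi2_ge0 B10 B1L B20 B2L XS YS YL k00 qk Dq h0 hK cs2 win1 win2 rho0 rhoh rhoC
    M1chi M2chi rhoM1 rhoM2 f_ge0 f_borel f_convex ck kanti kap0 kn0 B2lo B2hi s2h s2L3 Ffin.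
  by rewrite ltNge => /negP; apply; apply: H G; exact: le_trans rhod.
have [e [c [d [sz G]]]] := competitor_energy_fin L_gt0 K0 Kk dth dX dY X0 Y0 cchi1 cchi2
    dB1 dB2 chi1_ge0 chi2_ge0 B10 B1L B20 B2L XS YL k00 qk Dq h0 hK cs2 win1 win2 rho0 rhoh rhoC
    M1chi M2chi rhoM1 rhoM2 f_ge0 f_borel f_convex ck kn0 s2h s2L3.
rewrite ltNge => /negP; apply; apply: le_trans Finf _.
by apply: H G; exact: le_trans rhod.
Qed.
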